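(* Let $l\ge3$. (1) $(\mathcal{BZ}_{\mathbb Z}^e)^{\sigma}(\mathbf O^* )=(\mathcal{BZ}_{\mathbb Z}^e)^{\sigma}$, where the left-hand side is the connected component, containing $\mathbf O^*$, of the crystal $\left((\mathcal{BZ}_{\mathbb Z}^{e})^{\sigma};\mathrm{wt},\widehat{\varepsilon}_p^{*},\widehat{\varphi}_p^{*},\widehat{e}_p^{*},\widehat{f}_p^{*}\right)$. (2) $\mathcal{BZ}_{\mathbb Z}^{\sigma}(\mathbf O)=\mathcal{BZ}_{\mathbb Z}^{\sigma}$, where the left-hand side is the connected component, containing $\mathbf O$, of the crystal $\left(\mathcal{BZ}_{\mathbb Z}^{\sigma};\mathrm{wt},\widehat{\varepsilon}_p,\widehat{\varphi}_p,\widehat{e}_p,\widehat{f}_p\right)$.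
   Context: **Finite intervals.** For $n\in\mathbb Z$, $m\ge1$ let $I=[n+1,n+m]$ (an interval of integers) and $\widetilde I=I\cup\{n+m+1\}$. $\mathcal M_I$ is the set of all subsets of $\widetilde I$, and $\mathcal M_I^\times=\mathcal M_I\setminus\{\emptyset,\widetilde I\}$. An interval $[a,b]$ with $a>b$ is empty. Put $\mathcal M_I^\times(i)=\{\mathbf k\in\mathcal M_I^\times:i\in\mathbf k,\ i+1\notin\mathbf k\}$ for $i\in I$. A BZ datum associated to $I$ is a collection of integers $\mathbf M=(M_{\mathbf k})_{\mathbf k\in\mathcal M_I^\times}$ such that, with the convention $M_\emptyset=M_{\widetilde I}=0$: (BZ-1) for $i\ne j$ in $\widetilde I$ and $\mathbf k\in\mathcal M_I$ with $\mathbf k\cap\{i,j\}=\emptyset$, $M_{\mathbf k\cup\{i\}}+M_{\mathbf k\cup\{j\}}\le M_{\mathbf k\cup\{i,j\}}+M_{\mathbf k}$; (BZ-2) for $i<j<k$ in $\widetilde I$ and $\mathbf k\in\mathcal M_I$ with $\mathbf k\cap\{i,j,k\}=\emptyset$, $M_{\mathbf k\cup\{i,k\}}+M_{\mathbf k\cup\{j\}}=\min\{M_{\mathbf k\cup\{i,j\}}+M_{\mathbf k\cup\{k\}},\,M_{\mathbf k\cup\{j,k\}}+M_{\mathbf k\cup\{i\}}\}$. $\mathcal{BZ}_I$ (resp. $\mathcal{BZ}_I^e$) is the set of BZ data with $M_{[i+1,n+m+1]}=0$ (resp. $M_{[n+1,i]}=0$) for all $i\in I$. **Operators on $\mathcal{BZ}_I$.**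 For $i\in I$, $\varepsilon_i(\mathbf M)=-(M_{[n+1,i]}+M_{[n+1,i-1]\cup\{i+1\}}-M_{[n+1,i-1]}-M_{[n+1,i+1]})$. If $\varepsilon_i(\mathbf M)>0$, $\widetilde e_i\mathbf M$ is the (known to exist) unique element of $\mathcal{BZ}_I$ with $[n+1,i]$-component $M_{[n+1,i]}+1$ and $\mathbf k$-component $M_{\mathbf k}$ for all $\mathbf k\notin\mathcal M_I^\times(i)$; if $\varepsilon_i(\mathbf M)=0$, $\widetilde e_i\mathbf M=0$. $\widetilde f_i\mathbf M$ is the unique element of $\mathcal{BZ}_I$ with $[n+1,i]$-component $M_{[n+1,i]}-1$ and $\mathbf k$-component $M_{\mathbf k}$ for all $\mathbf k\notin\mathcal M_I^\times(i)$. **Data associated to $\mathbb Z$.** A Maya diagram of charge $r$ is a subset $\mathbf k\subset\mathbb Z$ with $\mathbb Z_{\le r-p}\subset\mathbf k\subset\mathbb Z_{\le r+q}$ and $|\mathbf k\cap\mathbb Z_{>r-p}|=p$ for some $p,q\ge0$; $\mathcal M_{\mathbb Z}$ is the set of all Maya diagrams (all charges) and $\mathcal M_{\mathbb Z}^c=\{\mathbf k^c=\mathbb Z\setminus\mathbf k:\mathbf k\in\mathcal M_{\mathbb Z}\}$. Put $\mathbf k(\Lambda_p)=\mathbb Z_{\le p}$, $\mathbf k(\sigma_p\Lambda_p)=\mathbb Z_{\le p-1}\cup\{p+1\}$. For $I=[n+1,n+m]$ put $\mathcal M_{\mathbb Z}(I)=\{\mathbb Z_{\le n}\cup\mathbf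 k_I:\mathbf k_I\in\mathcal M_I^\times\}$ and $\mathcal M^c_{\mathbb Z}(I)=\{\mathbf k_I\cup\mathbb Z_{>n+m+1}:\mathbf k_I\in\mathcal M_I^\times\}$; both are identified with $\mathcal M_I^\times$ by $\mathbf k\mapsto\mathbf k\cap\widetilde I$ (denoted $\mathrm{res}_I$, resp. $\mathrm{res}_I^c$), and $\Omega_I$, $\Omega_I^c$ are the bijections of $\mathcal M_{\mathbb Z}(I)$, $\mathcal M_{\mathbb Z}^c(I)$ corresponding to $\mathbf k_I\mapsto\widetilde I\setminus\mathbf k_I$. For a collection of integers $\mathbf M$ indexed by $\mathcal M_{\mathbb Z}$ or $\mathcal M_{\mathbb Z}^c$, $\mathbf M_I$ is its restriction to $\mathcal M_{\mathbb Z}(I)$ or $\mathcal M_{\mathbb Z}^c(I)$, viewed as indexed by $\mathcal M_I^\times$. $\mathcal{BZ}_{\mathbb Z}$ is the set of $\mathbf M=(M_{\mathbf k})_{\mathbf k\in\mathcal M_{\mathbb Z}^c}$ such that $\mathbf M_K\in\mathcal{BZ}_K$ for every finite interval $K$, and for each $\mathbf k\in\mathcal M_{\mathbb Z}^c$ there is a finite interval $I$ with $\mathbf k\in\mathcal M_{\mathbb Z}^c(I)$ and $M_{\Omega_J^c(\mathbf k)}=M_{\Omega_I^c(\mathbf k)}$ for every finite interval $J\supset I$; the set of such $I$ is $\mathrm{Int}^c(\mathbf M;\mathbf k)$. $\mathcal{BZ}_{\mathbb Z}^e$ is defined in the same way with $\mathcal M_{\mathbb Z}$, $\mathcal{BZ}_K^e$,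 $\Omega_I$ in place of $\mathcal M_{\mathbb Z}^c$, $\mathcal{BZ}_K$, $\Omega_I^c$. The map $*:\mathcal{BZ}_{\mathbb Z}\to\mathcal{BZ}_{\mathbb Z}^e$, $(\mathbf M^* )_{\mathbf k}=M_{\mathbf k^c}$, is a bijection; its inverse is also denoted $*$. **Operators on $\mathcal{BZ}_{\mathbb Z}$.** For $\mathbf k\in\mathcal M_{\mathbb Z}$ put $\Theta(\mathbf M)_{\mathbf k}=M_{\Omega_I^c(\mathbf k^c)}$ for any $I\in\mathrm{Int}^c(\mathbf M;\mathbf k^c)$. For $p\in\mathbb Z$, $\varepsilon_p(\mathbf M)=-(\Theta(\mathbf M)_{\mathbf k(\Lambda_p)}+\Theta(\mathbf M)_{\mathbf k(\sigma_p\Lambda_p)}-\Theta(\mathbf M)_{\mathbf k(\Lambda_{p+1})}-\Theta(\mathbf M)_{\mathbf k(\Lambda_{p-1})})\ge0$. If it is $0$, $\widetilde e_p\mathbf M=0$; otherwise $(\widetilde e_p\mathbf M)_{\mathbf k}=(\widetilde e_p\mathbf M_I)_{\mathrm{res}_I^c(\mathbf k)}$ for any $I$ with $\mathbf k\in\mathcal M_{\mathbb Z}^c(I)$ and $I\in\mathrm{Int}^c(\mathbf M;\mathbf k'^c)$ for $\mathbf k'=\mathbf k(\Lambda_p),\mathbf k(\sigma_p\Lambda_p),\mathbf k(\Lambda_{p+1}),\mathbf k(\Lambda_{p-1})$. Likewise $(\widetilde f_p\mathbf M)_{\mathbf k}=(\widetilde f_p\mathbf M_I)_{\mathrm{res}_I^c(\mathbf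 k)}$ for any $I$ with $\mathbf k\in\mathcal M_{\mathbb Z}^c(I)$ and $I\in\mathrm{Int}^c(\mathbf M;\mathbf k(\Lambda_p)^c)\cap\mathrm{Int}^c(\mathbf M;\mathbf k(\sigma_p\Lambda_p)^c)$. These are well defined with values in $\mathcal{BZ}_{\mathbb Z}\cup\{0\}$. **Affine type.** Fix $l\ge3$, $\widehat I=\{0,\dots,l-1\}$, and let $\widehat h_p,\widehat\alpha_p$ be the simple coroots and roots of type $A_{l-1}^{(1)}$. Let $\sigma(j)=j+l$ on $\mathbb Z$ and $\sigma(\mathbf M)_{\mathbf k}=M_{\sigma^{-1}(\mathbf k)}$; $\mathcal{BZ}_{\mathbb Z}^\sigma$ and $(\mathcal{BZ}_{\mathbb Z}^e)^\sigma$ are the subsets of $\sigma$-fixed elements, and $*$ restricts to a bijection between them. On $\mathcal{BZ}_{\mathbb Z}^\sigma$, for $p\in\widehat I$: $\mathrm{wt}(\mathbf M)=\sum_{p\in\widehat I}\Theta(\mathbf M)_{\mathbf k(\Lambda_p)}\widehat\alpha_p$, $\widehat\varepsilon_p(\mathbf M)=\varepsilon_p(\mathbf M)$, $\widehat\varphi_p(\mathbf M)=\widehat\varepsilon_p(\mathbf M)+\langle\widehat h_p,\mathrm{wt}(\mathbf M)\rangle$. With $L(\mathbf k,p)=\{q\in p+l\mathbb Z:q\in\mathbf k,\ q+1\notin\mathbf k\}$ (finite), $\widehat e_p\mathbf M=0$ if $\widehat\varepsilon_p(\mathbf M)=0$, otherwise $(\widehat e_p\mathbf M)_{\mathbf k}=(\prod_{q\in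 L(\mathbf k,p)}\widetilde e_q\,\mathbf M)_{\mathbf k}$; and $(\widehat f_p\mathbf M)_{\mathbf k}=(\prod_{q\in L(\mathbf k,p)}\widetilde f_q\,\mathbf M)_{\mathbf k}$ (the factors commute). This is a $U_q(\widehat{\mathfrak{sl}}_l)$-crystal. On $(\mathcal{BZ}_{\mathbb Z}^e)^\sigma$ the $*$-crystal structure is obtained by transport along $*$: $\mathrm{wt}(\mathbf M)=\mathrm{wt}(\mathbf M^* )$, $\widehat\varepsilon_p^*(\mathbf M)=\widehat\varepsilon_p(\mathbf M^* )$, $\widehat\varphi_p^*(\mathbf M)=\widehat\varepsilon_p^*(\mathbf M)+\langle\widehat h_p,\mathrm{wt}(\mathbf M)\rangle$, $\widehat e_p^*=*\circ\widehat e_p\circ*$, $\widehat f_p^*=*\circ\widehat f_p\circ*$ (with $*(0)=0$). $\mathbf O\in\mathcal{BZ}_{\mathbb Z}^\sigma$ and $\mathbf O^*\in(\mathcal{BZ}_{\mathbb Z}^e)^\sigma$ are the collections all of whose components are $0$. Connected components are those of the crystal graph (an edge joins $b$ and $b'$ whenever $b'$ is the image of $b$ under some lowering operator, for $p\in\widehat I$). *)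

(* Defs.v *)
From Stdlib Require Import Relation_Operators.
From mathcomp Require Import all_boot all_order all_algebra finmap.
From mathcomp Require Import all_classical.

Set Implicit Arguments.
Unset Strict Implicit.
Unset Printing Implicit Defensive.

Import Order.TTheory GRing.Theory Num.Theory.

Local Open Scope classical_set_scope.
Local Open Scope ring_scope.

(* A collection of integers indexed by a family D of subsets of int is encoded
   as its extension by zero to all subsets of int: it vanishes outside D.  For
   D = Mx I this includes the convention M_set0 = M_(tilde I) = 0.  With this
   encoding, equality of collections is equality of functions. *)
Definition collection := set int -> int.

Definition indexed_by (D : set (set int)) (M : collection) : Prop :=
  forall k, ~ D k -> M k = 0.

Definition zero_collection : collection := fun=> 0.

(* The pair (n, m) with m >= 1 stands for the interval I = [n + 1, n + m]. *)
Definition interval_code := (int * nat)%type.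

Definition is_interval (I : interval_code) : Prop := (0 < I.2)%N.

Definition pts (I : interval_code) : set int := `[I.1 + 1, I.1 + I.2%:Z]%classic.

Definition pts_tilde (I : interval_code) : set int :=
  pts I `|` [set I.1 + I.2%:Z + 1].

Definition Mx (I : interval_code) : set (set int) :=
  [set k | [/\ k `<=` pts_tilde I, k <> set0 & k <> pts_tilde I]].

Definition Mx_at (I : interval_code) (i : int) : set (set int) :=
  [set k | [/\ Mx I k, k i & ~ k (i + 1)]].

Definition BZ1 (I : interval_code) (M : collection) : Prop :=
  forall (i j : int) (k : set int),
    pts_tilde I i -> pts_tilde I j -> i <> j -> k `<=` pts_tilde I ->
    k `&` [set i; j] = set0 ->
    M (k `|` [set i]) + M (k `|` [set j]) <= M (k `|` [set i; j]) + M k.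

Definition BZ2 (I : interval_code) (M : collection) : Prop :=
  forall (i j h : int) (k : set int),
    pts_tilde I i -> pts_tilde I j -> pts_tilde I h -> i < j -> j < h ->
    k `<=` pts_tilde I -> k `&` [set i; j; h] = set0 ->
    M (k `|` [set i; h]) + M (k `|` [set j]) =
    Num.min (M (k `|` [set i; j]) + M (k `|` [set h]))
            (M (k `|` [set j; h]) + M (k `|` [set i])).

Definition BZ_datum (I : interval_code) (M : collection) : Prop :=
  [/\ indexed_by (Mx I) M, BZ1 I M & BZ2 I M].

Definition BZ (I : interval_code) : set collection :=
  [set M | BZ_datum I M /\
     forall i, pts I i -> M `[i + 1, I.1 + I.2%:Z + 1]%classic = 0].

Definition BZe (I : interval_code) : set collection :=
  [set M | BZ_datum I M /\ forall i, pts I i -> M `[I.1 + 1, i]%classic = 0].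

Definition eps_fin (I : interval_code) (i : int) (M : collection) : int :=
  - (M `[I.1 + 1, i]%classic + M (`[I.1 + 1, i - 1]%classic `|` [set i + 1])
     - M `[I.1 + 1, i - 1]%classic - M `[I.1 + 1, i + 1]%classic).

(* N is an element of BZ I whose [n + 1, i]-component is that of M plus c and
   whose components outside Mx_at I i are those of M. *)
Definition is_shift (I : interval_code) (i c : int) (M N : collection) : Prop :=
  [/\ BZ I N, N `[I.1 + 1, i]%classic = M `[I.1 + 1, i]%classic + c &
      forall k, Mx I k -> ~ Mx_at I i k -> N k = M k].

(* For M in BZ I (and eps_fin I i M > 0 in the case of e_fin) the elements
   below exist and are unique; xget picks them.  None is the crystal zero. *)
Definition e_fin (I : interval_code) (i : int) (M : collection) :
    option collection :=
  if eps_fin I i M == 0 then None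
  else Some (xget zero_collection [set N | is_shift I i 1 M N]).

Definition f_fin (I : interval_code) (i : int) (M : collection) : collection :=
  xget zero_collection [set N | is_shift I i (- 1) M N].

Definition maya_of_charge (r : int) (k : set int) : Prop :=
  exists p q : nat,
    [/\ [set j | j <= r - p%:Z] `<=` k, k `<=` [set j | j <= r + q%:Z] &
        ((k `&` [set j | (r - p%:Z < j)%R]) #= `I_p)%card].

Definition MZ : set (set int) := [set k | exists r, maya_of_charge r k].

Definition MZc : set (set int) := [set ~` k | k in MZ].

Definition kLambda (p : int) : set int := [set j | j <= p].

Definition ksLambda (p : int) : set int :=
  [set j | j <= p - 1] `|` [set p + 1].

Definition embed (I : interval_code) (kI : set int) : set int :=
  [set j | j <= I.1] `|` kI.

Definition embedc (I : interval_code) (kI : set int) : set int :=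
  kI `|` [set j | I.1 + I.2%:Z + 1 < j].

Definition MZ_fin (I : interval_code) : set (set int) := embed I @` Mx I.

Definition MZc_fin (I : interval_code) : set (set int) := embedc I @` Mx I.

(* This is both res_I and res_I^c. *)
Definition res (I : interval_code) (k : set int) : set int := k `&` pts_tilde I.

Definition Omega (I : interval_code) (k : set int) : set int :=
  embed I (pts_tilde I `\` res I k).

Definition Omegac (I : interval_code) (k : set int) : set int :=
  embedc I (pts_tilde I `\` res I k).

Definition restr (I : interval_code) (M : collection) : collection :=
  patch (fun=> 0) (Mx I) (fun kI => M (embed I kI)).

Definition restrc (I : interval_code) (M : collection) : collection :=
  patch (fun=> 0) (Mx I) (fun kI => M (embedc I kI)).

Definition Int (M : collection) (k : set int) : set interval_code :=
  [set I | [/\ is_interval I, MZ_fin I k &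
     forall J, is_interval J -> pts I `<=` pts J ->
       M (Omega J k) = M (Omega I k)]].

Definition Intc (M : collection) (k : set int) : set interval_code :=
  [set I | [/\ is_interval I, MZc_fin I k &
     forall J, is_interval J -> pts I `<=` pts J ->
       M (Omegac J k) = M (Omegac I k)]].

Definition BZZ : set collection :=
  [set M | [/\ indexed_by MZc M,
     forall K, is_interval K -> BZ K (restrc K M) &
     forall k, MZc k -> exists I, Intc M k I]].

Definition BZZe : set collection :=
  [set M | [/\ indexed_by MZ M,
     forall K, is_interval K -> BZe K (restr K M) &
     forall k, MZ k -> exists I, Int M k I]].

(* The same formula gives the inverse bijection. *)
Definition star (M : collection) : collection := fun k => M (~` k).

(* Below, xget picks an arbitrary admissible interval; on BZZ one exists and
   the values do not depend on the one picked. *)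
Definition pick_interval (P : set interval_code) : interval_code :=
  xget (0, 0%N) P.

Definition Theta (M : collection) (k : set int) : int :=
  M (Omegac (pick_interval (Intc M (~` k))) (~` k)).

Definition eps (p : int) (M : collection) : int :=
  - (Theta M (kLambda p) + Theta M (ksLambda p)
     - Theta M (kLambda (p + 1)) - Theta M (kLambda (p - 1))).

Definition e_adm (p : int) (M : collection) (k : set int) : set interval_code :=
  [set I | MZc_fin I k] `&`
  (Intc M (~` kLambda p) `&` Intc M (~` ksLambda p) `&`
   Intc M (~` kLambda (p + 1)) `&` Intc M (~` kLambda (p - 1))).

Definition f_adm (p : int) (M : collection) (k : set int) : set interval_code :=
  [set I | MZc_fin I k] `&`
  (Intc M (~` kLambda p) `&` Intc M (~` ksLambda p)).

(* The k-component of an element of BZZ or of the crystal zero; the value on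
   None is never relevant. *)
Definition component_at (M : option collection) (k : set int) : int :=
  oapp (fun N : collection => N k) 0 M.

Definition e_op (p : int) (M : collection) : option collection :=
  if eps p M == 0 then None
  else Some (patch (fun=> 0) MZc (fun k =>
    let I := pick_interval (e_adm p M k) in
    component_at (e_fin I p (restrc I M)) (res I k))).

Definition f_op (p : int) (M : collection) : collection :=
  patch (fun=> 0) MZc (fun k =>
    let I := pick_interval (f_adm p M k) in
    f_fin I p (restrc I M) (res I k)).

(* Raw crystal data: crystal elements form the set crys_carrier, and None is
   the crystal zero. *)
Record crystal_data (Idx P B : Type) := CrystalData {
  crys_carrier : set B;
  crys_wt : B -> P;
  crys_eps : Idx -> B -> int;
  crys_phi : Idx -> B -> int;
  crys_e : Idx -> B -> option B;
  crys_f : Idx -> B -> option B }.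

Definition crystal_edge (Idx P B : Type) (C : crystal_data Idx P B)
    (b b' : B) : Prop :=
  [/\ crys_carrier C b, crys_carrier C b' & exists p, crys_f C p b = Some b'].

Definition connected_component (Idx P B : Type) (C : crystal_data Idx P B)
    (b : B) : set B :=
  [set b' | crys_carrier C b' /\ clos_refl_sym_trans B (crystal_edge C) b b'].

Section Affine.
Variable l : nat.

(* Weights live in the root lattice, free on the simple roots; the p-th simple
   root is the p-th basis row vector. *)
Definition root_lattice := 'rV[int]_l.

Definition alpha (p : 'I_l) : root_lattice := delta_mx 0 p.

(* The Cartan matrix of type A_(l-1)^(1), for l >= 3. *)
Definition cartan : 'M[int]_l :=
  \matrix_(p, q)
    (if p == q then 2
     else if (q == p.+1 %[mod l])%N || (p == q.+1 %[mod l])%N then - 1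
     else 0).

(* The pairing <h_p, v>, determined by <h_p, alpha_q> = cartan p q. *)
Definition coroot_pairing (p : 'I_l) (v : root_lattice) : int :=
  \sum_(q < l) v 0 q * cartan p q.

Definition sigma_pt (j : int) : int := j + l%:Z.

Definition sigma (M : collection) : collection := fun k => M (sigma_pt @^-1` k).

Definition BZZ_sigma : set collection := [set M | BZZ M /\ sigma M = M].

Definition BZZe_sigma : set collection := [set M | BZZe M /\ sigma M = M].

Definition wt (M : collection) : root_lattice :=
  \sum_(p < l) Theta M (kLambda (p : nat)%:Z) *: alpha p.

Definition eps_hat (p : 'I_l) (M : collection) : int := eps (p : nat)%:Z M.

Definition phi_hat (p : 'I_l) (M : collection) : int :=
  eps_hat p M + coroot_pairing p (wt M).

Definition Lset (k : set int) (p : 'I_l) : set int :=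
  [set q | [/\ exists z : int, q = (p : nat)%:Z + l%:Z * z, k q & ~ k (q + 1)]].

(* The factors commute, so the order of enumeration is immaterial. *)
Definition e_prod (s : seq int) (M : collection) : option collection :=
  foldr (fun q N => obind (e_op q) N) (Some M) s.

Definition f_prod (s : seq int) (M : collection) : collection :=
  foldr f_op M s.

(* Lset k p is finite for k in MZc, so fset_set enumerates it. *)
Definition e_hat (p : 'I_l) (M : collection) : option collection :=
  if eps_hat p M == 0 then None
  else Some (patch (fun=> 0) MZc (fun k =>
    component_at (e_prod (enum_fset (fset_set (Lset k p))) M) k)).

Definition f_hat (p : 'I_l) (M : collection) : option collection :=
  Some (patch (fun=> 0) MZc (fun k =>
    f_prod (enum_fset (fset_set (Lset k p))) M k)).

Definition crystal_BZZ_sigma : crystal_data 'I_l root_lattice collection :=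
  CrystalData BZZ_sigma wt eps_hat phi_hat e_hat f_hat.

Definition wt_star (M : collection) : root_lattice := wt (star M).

Definition eps_hat_star (p : 'I_l) (M : collection) : int :=
  eps_hat p (star M).

Definition phi_hat_star (p : 'I_l) (M : collection) : int :=
  eps_hat_star p M + coroot_pairing p (wt_star M).

Definition e_hat_star (p : 'I_l) (M : collection) : option collection :=
  omap star (e_hat p (star M)).

Definition f_hat_star (p : 'I_l) (M : collection) : option collection :=
  omap star (f_hat p (star M)).

Definition crystal_BZZe_sigma : crystal_data 'I_l root_lattice collection :=
  CrystalData BZZe_sigma wt_star eps_hat_star phi_hat_star
    e_hat_star f_hat_star.

End Affine.

(* Main.v *)
(* Part (1) is the image of part (2) under star.  For part (2), the sum over
   p < l of - Theta M (Z_(<= p)) is a nonnegative integer, and one shows that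
   every M other than O lies at the end of an edge of the crystal graph which
   starts at an element N of BZ_Z^sigma whose sum is smaller by one.

   If some eps_p M is positive, N is the infinite product of the operators e_q,
   q in p + l Z, applied to M.  A component of e_q M at k with q in k and q + 1
   not in k is obtained from the one at s_q k by adding a slope
   M_(K + q) - M_(K + (q + 1)), where k = K + q.  By the tropical Pluecker
   relations, filling in an element below q or removing one above q + 1 changes
   the slope from d to some d' with d = min (d', g), where g involves no
   component that e_q modifies.  Hence raising the limit slope by one determines
   all the new slopes, and min-plus identities give the relations for the new
   collection.
   The same formula shows that f_q inverts e_q and that the product is
   well defined.

   If all eps_p M vanish, the Pluecker relations for Theta M give, for
   a < b <= c, Theta M (Z_(<= a) + [b, c]) >= t_a + t_c - t_(b-1), where
   t_j = Theta M (Z_(<= j)).  For b - 1 and c congruent to a modulo l the right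
   side is t_a, whereas supermodularity and the stabilization of M bound the
   left side by 2 t_a.  So t_a = 0, and by supermodularity all components of M
   are nonnegative; they are nonpositive as well. *)
Require Import Defs.
From mathcomp Require Import all_boot all_order all_algebra.
From mathcomp Require Import finmap.
From mathcomp Require Import all_classical.
From mathcomp Require Import zify.
From Stdlib Require Import Relation_Operators.

Set Implicit Arguments.
Unset Strict Implicit.
Unset Printing Implicit Defensive.

Import Order.TTheory GRing.Theory Num.Theory.

Local Open Scope classical_set_scope.
Local Open Scope ring_scope.

(** * Min-plus identities *)

(** Edges are given by lowering operators, so [e_op] is never evaluated: the starting point N of an
    edge is constructed directly on Z and recognised afterwards. The obstacle is that [f_op] and
    [f_hat] are specified through chosen windows and that a product over an infinite residue class
    has no finite expression. Both are met by one uniqueness principle: an element of BZ_Z is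
    determined by its components at the sets without a drop at p (p inside, p + 1 outside) together
    with its [Theta] at Z_(<= p). It holds because no set occurring in a gap has a drop at p, so the
    limit slope propagates to every set through gaps common to both collections. The principle
    extends to indices pairwise at distance at least 3, where it compares finite products with their
    limit, gives [sigma]-invariance and identifies the effect of each [f_op]. The relations are
    stated for a family F because they are used for subsets of tilde I, for [MZc] and, in the case
    of [Theta], for [MZ]. *)

Lemma min_add_min (d a b a' b' : int) :
  Num.min (d + a) b + Num.min (d + a') b' =
  Num.min (Num.min (d + d + (a + a')) (d + Num.min (a + b') (b + a'))) (b + b').
Proof. lia. Qed.

(** Together with [min_add_min] this is comparison of coefficients: a product of two min-plus linear
    polynomials in the free slope d has degree 2, and x = min (y, z) holds for three such
    polynomials as soon as it holds for their coefficients. *)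
Lemma min3_eq (d x2 y2 z2 x1 y1 z1 x0 y0 z0 : int) :
  x2 = Num.min y2 z2 -> x1 = Num.min y1 z1 -> x0 = Num.min y0 z0 ->
  Num.min (Num.min (d + d + x2) (d + x1)) x0 =
  Num.min (Num.min (Num.min (d + d + y2) (d + y1)) y0)
    (Num.min (Num.min (d + d + z2) (d + z1)) z0).
Proof. move=> -> -> ->; lia. Qed.

(* Below u, v, w and d with indices in {a < b < c} stand for the components of
   M at K + S, K + S + (p + 1), K + S + p + (p + 1) and for the new slope at
   K + S, where S is the set of indices; so v + d is the new component at
   K + S + p.  In the first lemma p + 1 < a, in the second a < p, p + 1 < b.
   The hypotheses on d make v + d the minimum of an expression of degree 1 in
   the free slope and of a constant, and the claim is checked coefficient by
   coefficient. *)
Lemma raise_plucker_right (u ua ub uc uab uac ubc uabc v va vb vc vab vac vbc w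
  wa wb wc d da db dc dab dac dbc : int) :
 vac + vb = Num.min (vab + vc) (vbc + va) ->
 vc + ua = Num.min (va + uc) (uac + v) ->
 vb + ua = Num.min (va + ub) (uab + v) ->
 vc + ub = Num.min (vb + uc) (ubc + v) ->
 wb + va = Num.min (wa + vb) (vab + w) ->
 uac + ub = Num.min (uab + uc) (ubc + ua) ->
 vbc + uab = Num.min (vab + ubc) (uabc + vb) ->
 da = Num.min d (w + ua - v - va) ->
 db = Num.min d (w + ub - v - vb) ->
 dc = Num.min d (w + uc - v - vc) ->
 dab = Num.min db (wb + uab - vb - vab) ->
 dbc = Num.min db (wb + ubc - vb - vbc) ->
 dac = Num.min da (wa + uac - va - vac) ->
 (vac + dac) + (vb + db) =
 Num.min ((vab + dab) + (vc + dc)) ((vbc + dbc) + (va + da)).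
Proof.
move=> c2 rac rab rbc rw ru rb da_ db_ dc_ dab_ dbc_ dac_.
(* [A] and [C] are the tropical Pluecker relations on the four indices p + 1 < a < b < c, between
   degrees 1 and 3 and within degree 2; they follow from the three-index ones. *)
have A : Num.min (ub + vac) (v + uabc) = Num.min (ua + vbc) (uc + vab).
  clear -c2 rab rbc rb; lia.
have C : uac + vb = Num.min (uab + vc) (ubc + va).
  clear -ru rab rbc; lia.
pose G : int := w - v.
(* The terms free of d in the new components with two indices; with one index this term is [G + ua],
   and so on. [c0] and [c1] below compare the coefficients of degree 0 and 1, and [c2] is the case
   of degree 2. *)
pose mac : int := Num.min (G + ua - va + vac) (wa - va + uac).
pose mab : int := Num.min (G + ub - vb + vab) (wb - vb + uab).
pose mbc : int := Num.min (G + ub - vb + vbc) (wb - vb + ubc).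
have S : vb + mac = Num.min (Num.min (G + vab + uc) (G + vbc + ua)) (wb + uac).
  rewrite /mac /G; clear -c2 rac rw; lia.
have B : mac + vb = Num.min (w + uabc) (Num.min (va + mbc) (vc + mab)).
  have -> : w = G + v by rewrite /G; lia.
  rewrite addrC S /mbc /mab; clear -A C c2; clearbody G; lia.
have c0 : mac + ub = Num.min (mab + uc) (mbc + ua).
  rewrite /mab /mbc; clear -S ru; clearbody G mac; lia.
have c1 : Num.min (vac + (G + ub)) (mac + vb) =
  Num.min (Num.min (vab + (G + uc)) (mab + vc)) (Num.min (vbc + (G + ua)) (mbc
    + va)).
  have wE : w = G + v by rewrite /G; lia.
  rewrite B wE; clear -A; clearbody G mab mbc; lia.
have -> : vac + dac = Num.min (d + vac) mac by rewrite dac_ da_ /mac /G; clear;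
  lia.
have -> : vab + dab = Num.min (d + vab) mab by rewrite dab_ db_ /mab /G; clear;
  lia.
have -> : vbc + dbc = Num.min (d + vbc) mbc by rewrite dbc_ db_ /mbc /G; clear;
  lia.
have -> : va + da = Num.min (d + va) (G + ua) by rewrite da_ /G; clear; lia.
have -> : vb + db = Num.min (d + vb) (G + ub) by rewrite db_ /G; clear; lia.
have -> : vc + dc = Num.min (d + vc) (G + uc) by rewrite dc_ /G; clear; lia.
rewrite !min_add_min; apply: min3_eq => //; clear -c0; lia.
Qed.
Lemma raise_plucker_mid (u ua ub uc uab uac ubc v va vb vc vab vac vbc w wa wb
  wc da db dc dab dac dbc : int) :
 vac + vb = Num.min (vab + vc) (vbc + va) ->
 uab + v = Num.min (va + ub) (vb + ua) ->
 uac + v = Num.min (va + uc) (vc + ua) ->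
 vc + ub = Num.min (vb + uc) (ubc + v) ->
 vab + w = Num.min (wa + vb) (wb + va) ->
 vac + w = Num.min (wa + vc) (wc + va) ->
 dab = Num.min da (wa + uab - va - vab) ->
 dac = Num.min da (wa + uac - va - vac) ->
 db = Num.min dab (wb + uab - vb - vab) ->
 dc = Num.min dac (wc + uac - vc - vac) ->
 dbc = Num.min db (wb + ubc - vb - vbc) ->
 (vac + dac) + (vb + db) =
 Num.min ((vab + dab) + (vc + dc)) ((vbc + dbc) + (va + da)).
Proof.
move=> c2 rab rac rbc rw rwc dab_ dac_ db_ dc_ dbc_.
(* The four-index relation for a < p + 1 < b < c. Filling in a, which lies below p, can only
   increase the slope, so the free slope is now [da]. *)
have C : uab + vc = Num.min (va + ubc) (uac + vb).
  clear -rab rac rbc; lia.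
pose G : int := w - va.
have pb : vb + db = Num.min (da + vb) (G + uab).
  rewrite db_ dab_ /G; clear -rw; lia.
have pc : vc + dc = Num.min (da + vc) (G + uac).
  rewrite dc_ dac_ /G; clear -rwc; lia.
have -> : vab + dab = Num.min (da + vab) (wa - va + uab) by rewrite dab_;
  clear; lia.
have -> : vac + dac = Num.min (da + vac) (wa - va + uac) by rewrite dac_;
  clear; lia.
pose mbc : int := Num.min (G + uab - vb + vbc) (wb + ubc - vb).
have -> : vbc + dbc = Num.min (da + vbc) mbc.
  rewrite dbc_ /mbc; clear -pb; clearbody G; lia.
rewrite pb pc.
have c1 : Num.min (vac + (G + uab)) (wa - va + uac + vb) =
  Num.min (Num.min (vab + (G + uac)) (wa - va + uab + vc)) (mbc + va).
  rewrite /mbc /G; clear -c2 C rw; lia.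
have -> : Num.min (da + vbc) mbc + (va + da) =
    Num.min (da + da + (vbc + va)) (da + (mbc + va)) by clear; lia.
rewrite !min_add_min c2 c1; clear; lia.
Qed.

(** * Changing the slope of a BZ datum *)

Definition nxt (p : int) : int := p + 1.

Definition ad (K : set int) (a : int) : set int := [set z | K z \/ z = a].

Definition rm (K : set int) (a : int) : set int := [set z | K z /\ z <> a].

Ltac mem := unfold ad, rm, nxt, mkset in *; cbn beta in *; rewrite /=;
  intuition (subst; try lia).

Ltac setext :=
  rewrite predeqE => z; rewrite /ad /rm /nxt /=; unfold nxt in *;
  intuition (subst; try lia).

Lemma adC K a b : ad (ad K a) b = ad (ad K b) a.
Proof. by setext. Qed.

Lemma ad_id K a : K a -> ad K a = K.
Proof. by move=> Ka; setext. Qed.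

Lemma rm_id K a : ~ K a -> rm K a = K.
Proof. by move=> Ka; setext. Qed.

Lemma adK K a : ~ K a -> rm (ad K a) a = K.
Proof. by move=> Ka; setext. Qed.

Lemma rmK K a : K a -> ad (rm K a) a = K.
Proof.
move=> Ka; rewrite predeqE => z; have [->|/eqP za] := eqVneq z a; mem.
Qed.

(* Only the largest set involved is required to lie in F, so that F may be the
   family of all subsets of tilde I. *)
Definition supermodular (F : set (set int)) (M : collection) : Prop :=
  forall k i j, i <> j -> ~ k i -> ~ k j -> F (ad (ad k i) j) ->
  M (ad k i) + M (ad k j) <= M (ad (ad k i) j) + M k.

Definition tropical_plucker (F : set (set int)) (M : collection) : Prop :=
  forall k i j h, i < j -> j < h -> ~ k i -> ~ k j -> ~ k h ->
  F (ad (ad (ad k i) j) h) ->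
  M (ad (ad k i) h) + M (ad k j) =
  Num.min (M (ad (ad k i) j) + M (ad k h)) (M (ad (ad k j) h) + M (ad k i)).

(* In the min-plus sense, the ratio of the components at K + p, K + (p + 1). *)
Definition slope (M : collection) (p : int) (K : set int) : int :=
  M (ad K p) - M (ad K (nxt p)).

(* The tropical Pluecker relation makes the slope at the lower of C and C + j
   the minimum of the slope at the upper one and of this number; C + j is the
   upper one when j < p and the lower one when j > p + 1. *)
Definition gap (M : collection) (p : int) (C : set int) (j : int) : int :=
  M (ad (ad C p) (nxt p)) + M (ad C j) - M (ad C (nxt p))
  - M (ad (ad C (nxt p)) j).

Definition drops (k : set int) (p : int) : Prop := k p /\ ~ k (nxt p).

Lemma drops_ad k p : drops k p ->
  exists K, [/\ ~ K p, ~ K (nxt p) & k = ad K p].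
Proof. by case=> kp kq; exists (rm k p); split; [mem|mem|rewrite rmK]. Qed.

Definition with_slope (M : collection) (p : int) (d : set int -> int) :
    collection :=
  fun k => if `[< drops k p >] then M (ad (rm k p) (nxt p)) + d (rm k p)
           else M k.

Lemma with_slopeE M p d K : ~ K p -> ~ K (nxt p) ->
  with_slope M p d (ad K p) = M (ad K (nxt p)) + d K.
Proof.
move=> Kp Kq; rewrite /with_slope asboolT ?adK //.
by rewrite /drops; mem.
Qed.

Lemma with_slope_id M p d k : ~ drops k p -> with_slope M p d k = M k.
Proof. by move=> kp; rewrite /with_slope asboolF. Qed.

(** Bubble sort of nested [ad] into the order of the list, so that [lia] sees the same set as the
    same atom. *)
Ltac sorts s := rewrite /gap;
  let rec go s := match s with
  | nil => idtac
  | cons ?x ?t =>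
      let rec go2 t := match t with nil => idtac
        | cons ?y ?t' => repeat rewrite (adC _ y x); go2 t' end in
      go2 t; go t
  end in do 5! go s.

Section Family.
Variables (F : set (set int)) (M : collection) (p : int).
Hypothesis FE : forall k a, F (ad k a) = F k.
Hypothesis M1 : supermodular F M.
Hypothesis M2 : tropical_plucker F M.

Lemma F_rm k a : F (rm k a) = F k.
Proof.
have [ka|ka] := pselect (k a); last by rewrite rm_id.
by rewrite -{2}(rmK ka) FE.
Qed.

Variable d : set int -> int.
(** [dl] and [dr] are the relations satisfied by the slope of M; the gaps are still those of M
    because their sets have no drop at p. [dB] is supermodularity of the new collection for the pair
    p, p + 1. *)
Hypothesis dl : forall (K : set int) (j : int), F K -> ~ K p -> ~ K (nxt p) ->
  j < p -> ~ K j ->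
  d K = Num.min (d (ad K j)) (gap M p K j).
Hypothesis dr : forall (K : set int) (j : int), F K -> ~ K p -> ~ K (nxt p) ->
  nxt p < j -> ~ K j ->
  d (ad K j) = Num.min (d K) (gap M p K j).
Hypothesis dB : forall K : set int, F K -> ~ K p -> ~ K (nxt p) ->
  d K <= M (ad (ad K p) (nxt p)) + M K - (M (ad K (nxt p)) + M (ad K (nxt p))).

Let N := with_slope M p d.

Ltac sd := try (by rewrite ?FE); try (unfold nxt in *; lia); try (by mem).
Ltac use1 K i j := have := @M1 K i j ltac:(sd) ltac:(sd) ltac:(sd) ltac:(sd).
Ltac use2 K i j h :=
  have := @M2 K i j h ltac:(sd) ltac:(sd) ltac:(sd) ltac:(sd) ltac:(sd)
    ltac:(sd).
Ltac usel K j := have := @dl K j ltac:(sd) ltac:(sd) ltac:(sd) ltac:(sd)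
  ltac:(sd).
Ltac user K j := have := @dr K j ltac:(sd) ltac:(sd) ltac:(sd) ltac:(sd)
  ltac:(sd).
Ltac useB K := have := @dB K ltac:(sd) ltac:(sd) ltac:(sd).
Ltac eval_slope := rewrite ?/N;
  repeat (rewrite with_slopeE; [|by mem..]);
  repeat (rewrite with_slope_id; [|by rewrite /drops; mem]).

Lemma with_slope_supermodular_p k j : p <> j -> ~ k p -> ~ k j ->
  F (ad (ad k p) j) -> N (ad k p) + N (ad k j) <= N (ad (ad k p) j) + N k.
Proof.
rewrite !FE => pj kp kj Fk.
have [kq|kq] := pselect (k (nxt p)).
  eval_slope; use1 k p j; clear; lia.
have [e|jq] := eqVneq j (nxt p).
  subst j; useB k; eval_slope; clear; lia.
useB k; have [jp|jp] := ltP j p.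
  usel k j; use1 k (nxt p) j; sorts [:: j; p; nxt p]; eval_slope; clear; lia.
user k j; use1 k (nxt p) j; sorts [:: j; p; nxt p]; eval_slope; clear; lia.
Qed.

Lemma with_slope_supermodular_q k j : p <> j -> nxt p <> j -> ~ k (nxt p) ->
  ~ k j -> F (ad (ad k (nxt p)) j) ->
  N (ad k (nxt p)) + N (ad k j) <= N (ad (ad k (nxt p)) j) + N k.
Proof.
rewrite !FE => pj qj kq kj Fk.
have [kp|kp] := pselect (k p); last first.
  eval_slope; use1 k (nxt p) j; clear; lia.
have {kp} [K [Kp Ek]] : exists K, ~ K p /\ k = ad K p.
  by exists (rm k p); split; [mem|rewrite rmK].
subst k; rewrite FE in Fk.
have {kj} Kj : ~ K j by mem.
have {kq} Kq : ~ K (nxt p) by mem.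
use1 (ad K (nxt p)) p j; have [jp|jp] := ltP j p.
  usel K j; useB (ad K j); sorts [:: j; p; nxt p]; eval_slope; clear; lia.
user K j; sorts [:: j; p; nxt p]; eval_slope; clear; lia.
Qed.

Lemma with_slope_supermodular_lt k i j : i < j -> i <> p -> i <> nxt p ->
  j <> p -> j <> nxt p -> ~ k i -> ~ k j -> F (ad (ad k i) j) ->
  N (ad k i) + N (ad k j) <= N (ad (ad k i) j) + N k.
Proof.
rewrite !FE => ij ip iq jp jq ki kj Fk.
have [kp|kp] := pselect (drops k p); last first.
  move: kp; rewrite /drops => kp; eval_slope; use1 k i j; clear; lia.
have [K [Kp Kq Ek]] := drops_ad kp.
subst k; rewrite FE in Fk.
have {ki} Ki : ~ K i by mem.
have {kj} Kj : ~ K j by mem.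
use1 (ad K (nxt p)) i j; have [jlp|jgp] := ltP j p.
  usel K i; usel K j; usel (ad K j) i; usel (ad K i) j; useB (ad K i).
  use2 (ad K (nxt p)) i j p; sorts [:: i; j; p; nxt p]; eval_slope.
  by clear; lia.
have [ilp|igp] := ltP i p.
  usel K i; usel (ad K j) i; user K j; user (ad K i) j; useB (ad K i).
  use2 (ad K (nxt p)) i p j; use2 K i (nxt p) j.
  by sorts [:: i; j; p; nxt p]; eval_slope; clear; lia.
user K i; user K j; user (ad K i) j; useB (ad K i).
use2 K (nxt p) i j; sorts [:: i; j; p; nxt p]; eval_slope.
by clear; lia.
Qed.

Lemma with_slope_supermodular : supermodular F N.
Proof.
move=> k i j ij ki kj Fk.
have [ip|/eqP ip] := eqVneq i p.
  by subst i; apply: with_slope_supermodular_p.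
have [jp|/eqP jp] := eqVneq j p.
  subst j; rewrite addrC adC; apply: with_slope_supermodular_p; auto.
  by rewrite adC.
have [iq|/eqP iq] := eqVneq i (nxt p).
  by subst i; apply: with_slope_supermodular_q => //; auto.
have [jq|/eqP jq] := eqVneq j (nxt p).
  subst j; rewrite addrC adC; apply: with_slope_supermodular_q; auto.
  by rewrite adC.
have [ltij|leji] := ltP i j; first exact: with_slope_supermodular_lt.
rewrite addrC adC; apply: with_slope_supermodular_lt => //; first lia.
by rewrite adC.
Qed.

Lemma with_slope_plucker_p k i j h : i < j -> j < h ->
  ~ k i -> ~ k j -> ~ k h -> F (ad (ad (ad k i) j) h) ->
  [\/ i = p, j = p | h = p] ->
  N (ad (ad k i) h) + N (ad k j) =
  Num.min (N (ad (ad k i) j) + N (ad k h)) (N (ad (ad k j) h) + N (ad k i)).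
Proof.
rewrite !FE => ij jh ki kj kh Fk.
have [kq|kq] := pselect (k (nxt p)).
  by move=> _; eval_slope; use2 k i j h; clear; lia.
case=> e.
- subst i; have [e|jq] := eqVneq j (nxt p).
    subst j; user k h; sorts [:: h; p; nxt p]; eval_slope; clear; lia.
  use2 k (nxt p) j h; user k j; user k h.
  by sorts [:: j; h; p; nxt p]; eval_slope; clear; lia.
- subst j; have [e|hq] := eqVneq h (nxt p).
    subst h; usel k i; sorts [:: i; p; nxt p]; eval_slope; clear; lia.
  use2 k i (nxt p) h; usel k i; user k h.
  by sorts [:: i; h; p; nxt p]; eval_slope; clear; lia.
subst h; use2 k i j (nxt p); usel k i; usel (ad k i) j.
use2 (ad k (nxt p)) i j p; usel (ad k j) i.
by sorts [:: i; j; p; nxt p]; eval_slope; clear; lia.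
Qed.

Lemma with_slope_plucker_q k i j h : i < j -> j < h ->
  ~ k i -> ~ k j -> ~ k h -> F (ad (ad (ad k i) j) h) ->
  i <> p -> j <> p -> h <> p ->
  [\/ i = nxt p, j = nxt p | h = nxt p] ->
  N (ad (ad k i) h) + N (ad k j) =
  Num.min (N (ad (ad k i) j) + N (ad k h)) (N (ad (ad k j) h) + N (ad k i)).
Proof.
rewrite !FE => ij jh ki kj kh Fk ip jp hp.
have [kp|kp] := pselect (k p); last first.
  by move=> _; eval_slope; use2 k i j h; clear; lia.
have {kp} [K [Kp Ek]] : exists K, ~ K p /\ k = ad K p.
  by exists (rm k p); split; [mem|rewrite rmK].
subst k; rewrite FE in Fk.
have {ki} Ki : ~ K i by mem.
have {kj} Kj : ~ K j by mem.
have {kh} Kh : ~ K h by mem.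
case=> e; subst.
- user K j; user K h; user (ad K j) h.
  use2 (ad K (nxt p)) p j h; use2 K (nxt p) j h.
  by sorts [:: j; h; p; nxt p]; eval_slope; clear; lia.
- usel (ad K h) i; user (ad K i) h.
  use2 (ad K (nxt p)) i p h.
  by sorts [:: i; h; p; nxt p]; eval_slope; clear; lia.
usel (ad K j) i; usel (ad K i) j.
use2 (ad K (nxt p)) i j p.
by sorts [:: i; j; p; nxt p]; eval_slope; clear; lia.
Qed.

Local Notation mv x := (M (ad x (nxt p))).
Local Notation mw x := (M (ad (ad x p) (nxt p))).

Lemma with_slope_plucker_other K i j h : i < j -> j < h ->
  ~ K p -> ~ K (nxt p) -> ~ K i -> ~ K j -> ~ K h -> F K ->
  i <> p -> j <> p -> h <> p -> i <> nxt p -> j <> nxt p -> h <> nxt p ->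
  N (ad (ad (ad K i) h) p) + N (ad (ad K j) p) =
  Num.min (N (ad (ad (ad K i) j) p) + N (ad (ad K h) p))
    (N (ad (ad (ad K j) h) p) + N (ad (ad K i) p)).
Proof.
move=> ij jh Kp Kq Ki Kj Kh FK ip jp hp iq jq hq.
eval_slope.
(* Complementing sets and reversing the order of the integers, with p and p + 1
   exchanged, preserves the relations; so the first two cases are dual to the
   last two. *)
have [hlp|hgp] := ltP h p.
  rewrite [LHS]addrC minC [X in Num.min X _]addrC [X in Num.min _ X]addrC.
  have := @raise_plucker_right (mw (ad (ad (ad K i) j) h)) (mw (ad (ad K i) j))
    (mw (ad (ad K i) h)) (mw (ad (ad K j) h)) (mw (ad K i)) (mw (ad K j)) (mw
    (ad K h)) (mw K)
    (mv (ad (ad (ad K i) j) h)) (mv (ad (ad K i) j)) (mv (ad (ad K i) h)) (mv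
      (ad (ad K j) h)) (mv (ad K i)) (mv (ad K j)) (mv (ad K h))
    (M (ad (ad (ad K i) j) h)) (M (ad (ad K i) j)) (M (ad (ad K i) h)) (M (ad
      (ad K j) h))
    (d (ad (ad (ad K i) j) h)) (d (ad (ad K i) j)) (d (ad (ad K i) h)) (d (ad
      (ad K j) h)) (d (ad K i)) (d (ad K j)) (d (ad K h)).
  apply.
  - by use2 (ad K (nxt p)) i j h; sorts [:: i; j; h; p; nxt p]; clear; lia.
  - by use2 (ad (ad K j) (nxt p)) i h p; sorts [:: i; j; h; p; nxt p]; clear;
    lia.
  - by use2 (ad (ad K i) (nxt p)) j h p; sorts [:: i; j; h; p; nxt p]; clear;
    lia.
  - by use2 (ad (ad K h) (nxt p)) i j p; sorts [:: i; j; h; p; nxt p]; clear;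
    lia.
  - by use2 (ad K i) j h (nxt p); sorts [:: i; j; h; p; nxt p]; clear; lia.
  - by use2 (ad (ad K p) (nxt p)) i j h; sorts [:: i; j; h; p; nxt p]; clear;
    lia.
  - by use2 (ad K (nxt p)) i h p; sorts [:: i; j; h; p; nxt p]; clear; lia.
  - by usel (ad (ad K i) j) h; sorts [:: i; j; h; p; nxt p]; clear; lia.
  - by usel (ad (ad K i) h) j; sorts [:: i; j; h; p; nxt p]; clear; lia.
  - by usel (ad (ad K j) h) i; sorts [:: i; j; h; p; nxt p]; clear; lia.
  - by usel (ad K i) h; sorts [:: i; j; h; p; nxt p]; clear; lia.
  - by usel (ad K h) i; sorts [:: i; j; h; p; nxt p]; clear; lia.
  - by usel (ad K j) i; sorts [:: i; j; h; p; nxt p]; clear; lia.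
have [jlp|jgp] := ltP j p.
  rewrite [LHS]addrC minC [X in Num.min X _]addrC [X in Num.min _ X]addrC.
  have := @raise_plucker_mid (mw (ad (ad (ad K i) j) h)) (mw (ad (ad K i) j))
    (mw (ad (ad K i) h)) (mw (ad (ad K j) h)) (mw (ad K i)) (mw (ad K j)) (mw
    (ad K h))
    (mv (ad (ad (ad K i) j) h)) (mv (ad (ad K i) j)) (mv (ad (ad K i) h)) (mv
      (ad (ad K j) h)) (mv (ad K i)) (mv (ad K j)) (mv (ad K h))
    (M (ad (ad (ad K i) j) h)) (M (ad (ad K i) j)) (M (ad (ad K i) h)) (M (ad
      (ad K j) h))
    (d (ad (ad K i) j)) (d (ad (ad K i) h)) (d (ad (ad K j) h)) (d (ad K i)) (d
      (ad K j)) (d (ad K h)).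
  apply.
  - by use2 (ad K (nxt p)) i j h; sorts [:: i; j; h; p; nxt p]; clear; lia.
  - by use2 (ad (ad K i) (nxt p)) j p h; sorts [:: i; j; h; p; nxt p]; clear;
    lia.
  - by use2 (ad (ad K j) (nxt p)) i p h; sorts [:: i; j; h; p; nxt p]; clear;
    lia.
  - by use2 (ad (ad K h) (nxt p)) i j p; sorts [:: i; j; h; p; nxt p]; clear;
    lia.
  - by use2 (ad K i) j (nxt p) h; sorts [:: i; j; h; p; nxt p]; clear; lia.
  - by use2 (ad K j) i (nxt p) h; sorts [:: i; j; h; p; nxt p]; clear; lia.
  - by usel (ad K i) j; sorts [:: i; j; h; p; nxt p]; clear; lia.
  - by usel (ad K j) i; sorts [:: i; j; h; p; nxt p]; clear; lia.
  - by user (ad K i) h; sorts [:: i; j; h; p; nxt p]; clear; lia.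
  - by user (ad K j) h; sorts [:: i; j; h; p; nxt p]; clear; lia.
  - by usel (ad K h) i; sorts [:: i; j; h; p; nxt p]; clear; lia.
have [ilp|igp] := ltP i p.
  have := @raise_plucker_mid (M K) (M (ad K i)) (M (ad K j)) (M (ad K h)) (M
    (ad (ad K i) j)) (M (ad (ad K i) h)) (M (ad (ad K j) h))
    (mv K) (mv (ad K i)) (mv (ad K j)) (mv (ad K h)) (mv (ad (ad K i) j)) (mv
      (ad (ad K i) h)) (mv (ad (ad K j) h))
    (mw K) (mw (ad K i)) (mw (ad K j)) (mw (ad K h))
    (d (ad K i)) (d (ad K j)) (d (ad K h)) (d (ad (ad K i) j)) (d (ad (ad K i)
      h)) (d (ad (ad K j) h)).
  apply.
  - by use2 (ad K (nxt p)) i j h; sorts [:: i; j; h; p; nxt p]; clear; lia.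
  - by use2 K i (nxt p) j; sorts [:: i; j; h; p; nxt p]; clear; lia.
  - by use2 K i (nxt p) h; sorts [:: i; j; h; p; nxt p]; clear; lia.
  - by use2 K (nxt p) j h; sorts [:: i; j; h; p; nxt p]; clear; lia.
  - by use2 (ad K (nxt p)) i p j; sorts [:: i; j; h; p; nxt p]; clear; lia.
  - by use2 (ad K (nxt p)) i p h; sorts [:: i; j; h; p; nxt p]; clear; lia.
  - by user (ad K i) j; sorts [:: i; j; h; p; nxt p]; clear; lia.
  - by user (ad K i) h; sorts [:: i; j; h; p; nxt p]; clear; lia.
  - by usel (ad K j) i; sorts [:: i; j; h; p; nxt p]; clear; lia.
  - by usel (ad K h) i; sorts [:: i; j; h; p; nxt p]; clear; lia.
  - by user (ad K j) h; sorts [:: i; j; h; p; nxt p]; clear; lia.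
have := @raise_plucker_right (M K) (M (ad K i)) (M (ad K j)) (M (ad K h)) (M
  (ad (ad K i) j)) (M (ad (ad K i) h)) (M (ad (ad K j) h)) (M (ad (ad (ad K i)
  j) h))
  (mv K) (mv (ad K i)) (mv (ad K j)) (mv (ad K h)) (mv (ad (ad K i) j)) (mv (ad
    (ad K i) h)) (mv (ad (ad K j) h))
  (mw K) (mw (ad K i)) (mw (ad K j)) (mw (ad K h))
  (d K) (d (ad K i)) (d (ad K j)) (d (ad K h)) (d (ad (ad K i) j)) (d (ad (ad K
    i) h)) (d (ad (ad K j) h)).
apply.
- by use2 (ad K (nxt p)) i j h; sorts [:: i; j; h; p; nxt p]; clear; lia.
- by use2 K (nxt p) i h; sorts [:: i; j; h; p; nxt p]; clear; lia.
- by use2 K (nxt p) i j; sorts [:: i; j; h; p; nxt p]; clear; lia.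
- by use2 K (nxt p) j h; sorts [:: i; j; h; p; nxt p]; clear; lia.
- by use2 (ad K (nxt p)) p i j; sorts [:: i; j; h; p; nxt p]; clear; lia.
- by use2 K i j h; sorts [:: i; j; h; p; nxt p]; clear; lia.
- by use2 (ad K j) (nxt p) i h; sorts [:: i; j; h; p; nxt p]; clear; lia.
- by user K i; sorts [:: i; j; h; p; nxt p]; clear; lia.
- by user K j; sorts [:: i; j; h; p; nxt p]; clear; lia.
- by user K h; sorts [:: i; j; h; p; nxt p]; clear; lia.
- by user (ad K j) i; sorts [:: i; j; h; p; nxt p]; clear; lia.
- by user (ad K j) h; sorts [:: i; j; h; p; nxt p]; clear; lia.
- by user (ad K i) h; sorts [:: i; j; h; p; nxt p]; clear; lia.
Qed.

Lemma with_slope_plucker : tropical_plucker F N.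
Proof.
move=> k i j h ij jh ki kj kh Fk.
have [e|np] := pselect [\/ i = p, j = p | h = p].
  exact: with_slope_plucker_p.
have ip : i <> p by move=> e; apply: np; apply: Or31.
have jp : j <> p by move=> e; apply: np; apply: Or32.
have hp : h <> p by move=> e; apply: np; apply: Or33.
have [e|nq] := pselect [\/ i = nxt p, j = nxt p | h = nxt p].
  exact: with_slope_plucker_q.
have iq : i <> nxt p by move=> e; apply: nq; apply: Or31.
have jq : j <> nxt p by move=> e; apply: nq; apply: Or32.
have hq : h <> nxt p by move=> e; apply: nq; apply: Or33.
rewrite !FE in Fk.
have [kp|kp] := pselect (drops k p); last first.
  rewrite /drops in kp; eval_slope; use2 k i j h; clear; lia.
have [K [Kp Kq Ek]] := drops_ad kp.
subst k; rewrite FE in Fk.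
rewrite !(adC _ p i) !(adC _ p j) !(adC _ p h).
apply: with_slope_plucker_other => //; mem.
Qed.

End Family.

(** * Slopes along upward paths *)

Lemma slope_left F M p K j : tropical_plucker F M -> ~ K p -> ~ K (nxt p) ->
  j < p -> ~ K j -> F (ad (ad (ad K j) p) (nxt p)) ->
  slope M p K = Num.min (slope M p (ad K j)) (gap M p K j).
Proof.
move=> M2 Kp Kq jp Kj FK.
have : j < p by []; have : p < nxt p by rewrite /nxt; lia.
move=> H1 H2; have := M2 K j p (nxt p) H2 H1 Kj Kp Kq FK.
rewrite /slope /gap (adC _ (nxt p) j); clear; lia.
Qed.

Lemma slope_right F M p K j : tropical_plucker F M -> ~ K p -> ~ K (nxt p) ->
  nxt p < j -> ~ K j -> F (ad (ad (ad K p) (nxt p)) j) ->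
  slope M p (ad K j) = Num.min (slope M p K) (gap M p K j).
Proof.
move=> M2 Kp Kq qj Kj FK.
have pq : p < nxt p by rewrite /nxt; lia.
have := M2 K p (nxt p) j pq qj Kp Kq Kj FK.
rewrite /slope /gap (adC _ p j) (adC _ (nxt p) j); clear; lia.
Qed.

Definition needs (p : int) (K : set int) (j : int) : Prop :=
  j < p /\ ~ K j \/ nxt p < j /\ K j.

Definition up (p : int) (K : set int) (j : int) : set int :=
  if j < p then ad K j else if nxt p < j then rm K j else K.

(* The slope at K is the minimum of x and of the gaps met when K is moved by
   the steps up, which never decrease the slope, to a set of slope x.  This
   does not depend on the order of the steps (gap_square). *)
Fixpoint path_min (M : collection) (p x : int) (s : seq int) (K : set int) :
    int :=
  if s is j :: s' then
    if `[< needs p K j >]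
    then Num.min (gap M p (rm K j) j) (path_min M p x s' (up p K j))
    else path_min M p x s' K
  else x.

Lemma up_left p K j : j < p -> up p K j = ad K j.
Proof. by rewrite /up => ->. Qed.

Lemma up_right p K j : nxt p < j -> up p K j = rm K j.
Proof. by move=> pj; rewrite /up pj ifF //; rewrite /nxt in pj; lia. Qed.

Lemma upE p K j z :
  up p K j z <-> (z = j /\ j < p) \/ (K z /\ ~ (z = j /\ nxt p < j)).
Proof.
rewrite /up; case: ifP => [jp|/negbT]; first by mem.
by move=> jp; case: ifP => [|/negbT] jq; mem.
Qed.

Lemma up_id p K j : ~ needs p K j -> up p K j = K.
Proof.
move=> nK; rewrite predeqE => z; rewrite upE; move: nK; rewrite /needs.
have [->|/eqP zj] := eqVneq z j; last by intuition.
by have [Kj|Kj] := pselect (K j); intuition lia.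
Qed.

Lemma upC p K i j : up p (up p K i) j = up p (up p K j) i.
Proof.
rewrite predeqE => z; rewrite !upE.
by have [e|/eqP zj] := eqVneq z j; have [e'|/eqP zi] := eqVneq z i;
  intuition (subst; lia).
Qed.

Lemma up_not_needs p K j : ~ needs p (up p K j) j.
Proof. by rewrite /needs !upE /nxt; intuition lia. Qed.

Lemma needs_up p K i j : i <> j -> needs p (up p K i) j = needs p K j.
Proof.
by move=> ij; apply/propext; rewrite /needs !upE; intuition (subst; lia).
Qed.

Definition ups (p : int) (K : set int) (s : seq int) : set int :=
  foldl (up p) K s.

Lemma upsE p K s z : ups p K s z <->
  (z \in s /\ z < p) \/ (K z /\ ~ (z \in s /\ nxt p < z)).
Proof.
elim: s K => [|j s IH] K; first by rewrite /ups /= ?in_nil; intuition.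
rewrite /= IH upE inE; have [->|/eqP zj] := eqVneq z j => /=.
  by case: (j \in s); rewrite /nxt; intuition lia.
by case: (z \in s); intuition.
Qed.

Lemma path_min_cat M p x s t K :
  path_min M p x (s ++ t) K = path_min M p (path_min M p x t (ups p K s)) s K.
Proof.
elim: s K => [|j s IH] K //=; case: asboolP => nK; rewrite IH //.
by rewrite up_id.
Qed.

Section Edges.
Variables (F : set (set int)) (M : collection) (p x : int).
Hypothesis FE : forall k a, F (ad k a) = F k.
Hypothesis M2 : tropical_plucker F M.

Ltac sd := try (by rewrite ?FE); try (unfold nxt in *; lia); try (by mem).
Ltac use2 K i j h :=
  have := @M2 K i j h ltac:(sd) ltac:(sd) ltac:(sd) ltac:(sd) ltac:(sd)
    ltac:(sd).
(** The steps at i and j meet the same minimal gap in either order. Each case combines two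
    three-index relations at the set C common to all terms: one for i, j, p + 1 at C and one for i,
    j, p at C + (p + 1). *)
Lemma gap_square_lt K i j : F K -> ~ K p -> ~ K (nxt p) -> i < j ->
  needs p K i -> needs p K j ->
  Num.min (gap M p (rm K i) i) (gap M p (rm (up p K i) j) j) =
  Num.min (gap M p (rm K j) j) (gap M p (rm (up p K j) i) i).
Proof.
move=> FK Kp Kq ij [[ip Ki]|[ip Ki]] [[jp Kj]|[jp Kj]]; last 2 first.
- by exfalso; rewrite /nxt in ip; lia.
- have [C [Ci Cj EK]] : exists C, [/\ ~ C i, ~ C j & K = ad (ad C i) j].
    exists (rm (rm K i) j); split; [by mem|by mem|].
    rewrite predeqE => z; have [->|/eqP zi] := eqVneq z i; first by mem.
    by have [->|/eqP zj] := eqVneq z j; mem.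
  subst K; rewrite !FE in FK.
  have Cp : ~ C p by mem.
  have Cq : ~ C (nxt p) by mem.
  have -> : rm (ad (ad C i) j) i = ad C j by setext.
  have -> : rm (ad (ad C i) j) j = ad C i by setext.
  have -> : rm (up p (ad (ad C i) j) i) j = C.
    by rewrite up_right; [setext|].
  have -> : rm (up p (ad (ad C i) j) j) i = C.
    by rewrite up_right; [setext|].
  use2 C (nxt p) i j; use2 (ad C (nxt p)) p i j.
  by sorts [:: i; j; p; nxt p]; clear; lia.
- have -> : rm K i = K by rewrite rm_id.
  have -> : rm K j = K by rewrite rm_id.
  have -> : rm (up p K i) j = ad K i.
    by rewrite up_left // rm_id //; mem.
  have -> : rm (up p K j) i = ad K j.
    by rewrite up_left // rm_id //; mem.
  use2 K i j (nxt p); use2 (ad K (nxt p)) i j p.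
  by sorts [:: i; j; p; nxt p]; clear; lia.
have [C [Ci Cj EK]] : exists C, [/\ ~ C i, ~ C j & K = ad C j].
  by exists (rm K j); split; [by mem|by mem|rewrite rmK].
subst K; rewrite !FE in FK.
have Cp : ~ C p by mem.
have Cq : ~ C (nxt p) by mem.
have -> : rm (ad C j) i = ad C j by rewrite rm_id.
have -> : rm (ad C j) j = C by rewrite adK.
have -> : rm (up p (ad C j) i) j = ad C i.
  by rewrite up_left //; setext.
have -> : rm (up p (ad C j) j) i = C.
  by rewrite up_right; [setext|].
use2 C i (nxt p) j; use2 (ad C (nxt p)) i p j.
by sorts [:: i; j; p; nxt p]; clear; lia.
Qed.

Lemma gap_square K i j : F K -> ~ K p -> ~ K (nxt p) -> i <> j ->
  needs p K i -> needs p K j ->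
  Num.min (gap M p (rm K i) i) (gap M p (rm (up p K i) j) j) =
  Num.min (gap M p (rm K j) j) (gap M p (rm (up p K j) i) i).
Proof.
move=> FK Kp Kq /eqP; rewrite neq_lt => /orP[ij|ji] ni nj.
  exact: gap_square_lt.
by apply/esym; apply: gap_square_lt.
Qed.

Lemma F_up K j : F (up p K j) = F K.
Proof. by rewrite /up; case: ifP => _; rewrite ?FE //; case: ifP;
  rewrite ?F_rm. Qed.

Lemma up_p K j : ~ K p -> ~ up p K j p.
Proof. by rewrite upE /nxt; intuition lia. Qed.

Lemma up_q K j : ~ K (nxt p) -> ~ up p K j (nxt p).
Proof. by rewrite upE /nxt; intuition lia. Qed.

(** By [gap_square] a needed step can be brought to the front of the path. Hence [path_min]
    satisfies the recursion of a slope at every j, not only along the order chosen in s. *)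
Lemma path_min_edge s K j : F K -> ~ K p -> ~ K (nxt p) -> j \in s ->
  needs p K j ->
  path_min M p x s K =
  Num.min (gap M p (rm K j) j) (path_min M p x s (up p K j)).
Proof.
elim: s K => // i s IH K FK Kp Kq; rewrite inE => /orP[/eqP <-|js] nj /=.
  by rewrite asboolT // asboolF //; apply: up_not_needs.
have [ij|/eqP ij] := eqVneq i j.
  by subst i; rewrite asboolT // asboolF //; apply: up_not_needs.
rewrite needs_up; last by auto.
case: asboolP => ni; last by rewrite IH.
rewrite (IH (up p K i)) ?needs_up ?F_up //; first last.
- exact: up_q.
- exact: up_p.
by rewrite !minA gap_square // (upC p K i).
Qed.

End Edges.

(** * Maya diagrams and BZ data on Z *)

Lemma finite_int_itv (a b : int) : finite_set [set z : int | a <= z /\ z <= b].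
Proof.
apply: sub_finite_set (finite_seq [seq a + i%:Z | i <- iota 0 `|b - a|.+1]).
move=> z /= [az zb]; suff: z \in [seq a + i%:Z | i <- iota 0 `|b - a|.+1] by [].
apply/mapP; exists `|z - a|%N; last by lia.
by rewrite mem_iota; lia.
Qed.

Lemma MZP (k : set int) :
  MZ k <-> exists B : int, forall z : int, (z < - B -> k z) /\ (B < z -> ~ k z).
Proof.
split=> [[r [p [q [Hl Hr _]]]]|[B HB]].
  exists (`|r| + p%:Z + q%:Z) => z; split=> [zB|Bz kz].
    by apply: Hl => /=; lia.
  by have /= := Hr z kz; lia.
pose C : int := `|B|; pose A := k `&` [set j | (- C - 1 < j)%R].
have /finite_setP[c cA] : finite_set A.
  apply: sub_finite_set (finite_int_itv (- C - 1) C) => z [kz /= zC].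
  split; first by lia.
  by rewrite leNgt; apply/negP => Cz; apply: (HB z).2 kz; lia.
(* The charge r: since c counts the elements of k above - C - 1, the choice makes r - c = - C - 1.
   The last witness makes r + q at least C. *)
exists (c%:Z - C - 1); exists c; exists (absz (C - (c%:Z - C - 1))%R); split.
- by move=> z /= zc; apply: (HB z).1; lia.
- move=> z kz /=; rewrite leNgt; apply/negP => Cz.
  by apply: (HB z).2 kz; lia.
have -> : c%:Z - C - 1 - c%:Z = - C - 1 by lia.
exact: cA.
Qed.

Lemma MZcP (k : set int) :
  MZc k <-> exists B : int, forall z : int, (z < - B -> ~ k z) /\ (B < z ->
    k z).
Proof.
split=> [[k' /MZP[B HB] <-]|[B HB]].
  by exists B => z; split=> zB /=; [move=> /(_ ((HB z).1 zB))|apply: (HB z).2].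
exists (~` k); last by rewrite setCK.
apply/MZP; exists B => z; split=> zB /=; first exact: (HB z).1.
by move=> /(_ ((HB z).2 zB)).
Qed.

Lemma MZ_setC (k : set int) : MZ (~` k) <-> MZc k.
Proof.
split=> [h|[k' h <-]]; last by rewrite setCK.
by exists (~` k) => //; rewrite setCK.
Qed.

Lemma MZ_ad k a : MZ (ad k a) = MZ k.
Proof.
apply/propext; rewrite !MZP; split=> -[B HB]; exists (`|B| + `|a| + 1) => z.
  have := HB z; rewrite /ad /= => -[H1 H2]; split=> zB.
    by case: H1 => //; lia.
  by move=> kz; apply: H2; [lia|left].
have [H1 H2] := HB z; rewrite /ad /=; split=> zB; first by left; apply: H1; lia.
by case=> [kz|]; [apply: H2 kz; lia|lia].
Qed.

Lemma MZc_ad k a : MZc (ad k a) = MZc k.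
Proof.
apply/propext; rewrite !MZcP; split=> -[B HB]; exists (`|B| + `|a| + 1) => z.
  have := HB z; rewrite /ad /= => -[H1 H2]; split=> zB.
    by move=> kz; apply: H1; [lia|left].
  by case: H2 => //; lia.
have [H1 H2] := HB z; rewrite /ad /=; split=> zB; last by left; apply: H2; lia.
by case=> [kz|]; [apply: H1 kz; lia|lia].
Qed.

(** For n = J.1 and N = [hi J] this is [Omegac] of J at the complement of k ([OmegacE]), that is,
    the set at which M is evaluated to read off [Theta M k] in the window J. *)
Definition cut (n N : int) (k : set int) : set int :=
  [set z | n < z /\ z <= N /\ k z \/ N < z].

Lemma cut_MZc n N k : MZc (cut n N k).
Proof.
apply/MZcP; exists (`|n| + `|N|) => z; rewrite /cut /=; split; first by lia.
by move=> zB; right; lia.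
Qed.

(* For M in BZ_Z and k a Maya diagram this says that v is Theta M k. *)
Definition stable (M : collection) (k : set int) (v : int) : Prop :=
  exists B : int, forall n N : int, n <= - B -> B <= N -> M (cut n N k) = v.

(** BZ data on all windows at once. Half-lines are the images of both the empty set and tilde I in
    every window, so [BZ_norm] contains the two conventions as well as the normalization, and
    [restrc] becomes evaluation at cuts without exceptional cases ([restrcE]). *)
Record BZdata (M : collection) : Prop := BZdata_intro {
  BZ_indexed : indexed_by MZc M;
  BZ_super : supermodular MZc M;
  BZ_plucker : tropical_plucker MZc M;
  BZ_norm : forall a, M [set z | a < z] = 0 }.

(** * Passage between finite windows and Z *)

Lemma ptsE I z : pts I z <-> I.1 < z /\ z <= I.1 + I.2%:Z.
Proof.
rewrite /pts /= in_itv /=; split; first by move=> /andP[]; lia.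
by move=> [h1 h2]; apply/andP; lia.
Qed.

Lemma pts_tildeE I z : pts_tilde I z <-> I.1 < z /\ z <= I.1 + I.2%:Z + 1.
Proof.
rewrite /pts_tilde /setU /=; split.
  by case=> [/ptsE|->]; lia.
move=> h; have [->|/eqP e] := eqVneq z (I.1 + I.2%:Z + 1); first by right.
by left; apply/ptsE; lia.
Qed.

Definition hi (I : interval_code) : int := I.1 + I.2%:Z + 1.

Lemma embedcE I k : k `<=` pts_tilde I -> embedc I k = cut I.1 (hi I) k.
Proof.
move=> kI; rewrite predeqE => z; rewrite /embedc /cut /setU /hi /=.
split=> [[kz|]|[[_ [_ kz]]|]]; [|by right|by left|by right].
by left; have /pts_tildeE := kI z kz; split; [lia|split; [lia|]].
Qed.

Lemma MZc_finP I k : is_interval I ->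
  MZc_fin I k <-> [/\ k = cut I.1 (hi I) k, exists2 z, pts_tilde I z & k z &
    exists2 z, pts_tilde I z & ~ k z].
Proof.
move=> I0; split=> [[kI [kI1 kI2 kI3] <-]|[Ek [a aI ka] [b bI kb]]].
  have inI z : pts_tilde I z -> (embedc I kI z <-> kI z).
    rewrite /embedc /setU /= => /pts_tildeE zI; split; last by left.
    by case=> // ?; exfalso; lia.
  split.
  - rewrite predeqE => z; rewrite /cut /=; split.
      case=> [kz|]; last by right.
      by left; have /pts_tildeE := kI1 _ kz; rewrite /hi; split; [lia|split;
        [lia|left]].
    by case=> [[_ [_]]|] //; right.
  - have /set0P[z kz] : kI != set0 by apply/eqP.
    by exists z; [apply: kI1|apply/inI => //; apply: kI1].
  apply: contrapT => H; apply: kI3; rewrite eqEsubset; split=> // z zI.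
  apply: contrapT => kz; apply: H; exists z => //.
  by move=> /(inI z zI).
exists (k `&` pts_tilde I).
  split; first by move=> z [].
    by move=> E; have : (k `&` pts_tilde I) a by []; rewrite E.
  by move=> E; apply: kb; rewrite -E in bI; case: bI.
rewrite embedcE; last by move=> z [].
rewrite {2}Ek predeqE => z; rewrite /cut /setI /=; split.
  by case=> [[? [? [? _]]]|]; [left|right].
case=> [[zn [zN kz]]|]; [left|by right]; do ?split => //.
by apply/pts_tildeE; rewrite /hi in zN.
Qed.

Lemma OmegacE J k : Omegac J (~` k) = cut J.1 (hi J) k.
Proof.
rewrite /Omegac embedcE => [|z []] //.
rewrite predeqE => z; rewrite /cut /res /setD /setI /setC /=; split.
  case=> [[zn [zN [zI nk]]]|]; last by right.
  left; do ?split=> //; apply: contrapT => kz; exact: nk.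
case=> [[zn [zN kz]]|]; [left|by right]; do ?split=> //; last by case.
by apply/pts_tildeE; rewrite /hi in zN.
Qed.

Lemma setU1_ad (k : set int) i : k `|` [set i] = ad k i.
Proof. by rewrite predeqE => z; rewrite /ad /setU /=. Qed.

Lemma setU2_ad (k : set int) i j : k `|` [set i; j] = ad (ad k i) j.
Proof. by rewrite predeqE => z; rewrite /ad /setU /=; intuition. Qed.

Lemma setI_set1 (k A : set int) i : k `&` A = set0 -> A i -> ~ k i.
Proof. by move=> E Ai ki; have : (k `&` A) i by []; rewrite E. Qed.

Lemma cut_ad n N k i : n < i -> i <= N -> cut n N (ad k i) = ad (cut n N k) i.
Proof.
move=> ni iN; rewrite predeqE => z; rewrite /cut /ad /=.
by have [->|/eqP zi] := eqVneq z i; intuition.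
Qed.

Lemma cutP n N k i : n < i -> i <= N -> cut n N k i <-> k i.
Proof. by move=> ni iN; rewrite /cut /=; intuition lia. Qed.

Lemma restrcE I M k : (forall a, M [set z | a < z] = 0) ->
  k `<=` pts_tilde I -> restrc I M k = M (cut I.1 (hi I) k).
Proof.
move=> nM kI; rewrite /restrc /patch; case: ifPn => [_|/negP].
  by rewrite embedcE.
rewrite inE => nk; have [->|/eqP k0] := eqVneq k set0.
  rewrite -(nM (hi I)); congr M; rewrite predeqE => z.
  by rewrite /cut /set0 /mkset; intuition.
have -> : k = pts_tilde I.
  by apply: contrapT => kn; apply: nk; split=> //; apply/eqP.
rewrite -(nM I.1); congr M; rewrite predeqE => z.
rewrite /cut /= pts_tildeE /hi; lia.
Qed.

Lemma BZdata_BZ M K : is_interval K -> BZdata M -> BZ K (restrc K M).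
Proof.
move=> K0 MB; have inK i : pts_tilde K i -> K.1 < i /\ i <= hi K.
  by move=> /pts_tildeE.
have adK k i : k `<=` pts_tilde K -> pts_tilde K i -> ad k i `<=` pts_tilde K.
  by move=> kK iK z [/kK|->].
split; first split.
- by move=> k nk; rewrite /restrc /patch ifF //; apply/negP; rewrite inE.
- move=> i j k iK jK ij kK kij.
  have ki : ~ k i by apply: setI_set1 kij _; left.
  have kj : ~ k j by apply: setI_set1 kij _; right.
  have [i1 i2] := inK i iK; have [j1 j2] := inK j jK.
  rewrite !setU1_ad setU2_ad !(restrcE (BZ_norm MB)) // ?cut_ad //;
    try exact: (adK _ _ kK); try exact: (adK _ _ (adK _ _ kK _)).
  apply: (BZ_super MB) => //; rewrite ?cutP // ?MZc_ad //; exact: cut_MZc.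
- move=> i j h k iK jK hK ij jh kK kij.
  have ki : ~ k i by apply: setI_set1 kij _; left; left.
  have kj : ~ k j by apply: setI_set1 kij _; left; right.
  have kh : ~ k h by apply: setI_set1 kij _; right.
  have [i1 i2] := inK i iK; have [j1 j2] := inK j jK; have [h1 h2] := inK h hK.
  rewrite !setU1_ad !setU2_ad !(restrcE (BZ_norm MB)) // ?cut_ad //;
    try exact: (adK _ _ kK); try exact: (adK _ _ (adK _ _ kK _)).
  apply: (BZ_plucker MB) => //; rewrite ?cutP // ?MZc_ad //; exact: cut_MZc.
move=> i /ptsE iK; rewrite (restrcE (BZ_norm MB)) //; last first.
  by move=> z /=; rewrite in_itv /= => /andP[z1 z2]; apply/pts_tildeE; lia.
rewrite -(BZ_norm MB i); congr M; rewrite predeqE => z.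
by rewrite /cut /= in_itv /= /hi; split; [case=> [[_ [_ /andP[]]]|]|]; lia.
Qed.

Lemma BZ_norm_of M : (forall K, is_interval K -> BZ K (restrc K M)) ->
  forall a, M [set z | a < z] = 0.
Proof.
move=> H a; pose K : interval_code := (a - 1, 2%N).
have aK : pts K a by apply/ptsE => /=; lia.
have [_ /(_ a aK) <-] := H K isT.
rewrite /restrc /patch ifT.
  congr M; rewrite predeqE => z; rewrite /embedc /setU /= in_itv /=; split.
    by move=> az; have [h|h] := leP z (a - 1 + 2 + 1); [left; apply/andP;
      lia|right].
  by case=> [/andP[]|]; lia.
rewrite inE; split.
- by move=> z /=; rewrite in_itv /= => /andP[? ?]; apply/pts_tildeE => /=; lia.
- by apply/eqP/set0P; exists (a + 1); rewrite /= in_itv /=; lia.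
move=> E; have : pts_tilde K a by left.
by rewrite -E /= in_itv /=; lia.
Qed.

(** The window whose [pts_tilde] is the set of z with - C < z <= C; the length is 2C - 1 because
    [pts_tilde] has one more point than [pts]. *)
Definition box (C : nat) : interval_code := (- C%:Z, (C + C - 1)%N).

Lemma hi_box C : (0 < C)%N -> hi (box C) = C%:Z.
Proof. by rewrite /hi /box /=; lia. Qed.

(** Each relation involves finitely many sets, and all of them arise by [cut] from subsets of one
    sufficiently large box, where the relation is known. *)
Lemma BZdata_of M : indexed_by MZc M ->
  (forall K, is_interval K -> BZ K (restrc K M)) -> BZdata M.
Proof.
move=> MI H; have nM := BZ_norm_of H.
have big k : MZc k -> exists C0 : nat, forall C : nat, (C0 < C)%N ->
    k = cut (box C).1 (hi (box C)) (k `&` pts_tilde (box C)).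
  move=> /MZcP[B HB]; exists `|B|%N => C BC; rewrite hi_box; last by lia.
  rewrite predeqE => z;
    rewrite /cut /setI /= pts_tildeE -[_ + 1]/(hi (box C)) hi_box /=; last lia.
  have [h1 h2] := HB z; split=> [kz|]; last first.
    by case=> [[_ [_ []]]|zC] //; apply: h2; lia.
  have [zC|Cz] := leP z C%:Z; last by right.
  left; suff : - C%:Z < z by [].
  by rewrite ltNge; apply/negP => zC'; apply: h1 => //; lia.
have inB (C : nat) z : (`|z| < C)%N -> pts_tilde (box C) z.
  by move=> zC; apply/pts_tildeE => /=; lia.
have capA k i C : (`|i| < C)%N ->
    ad k i `&` pts_tilde (box C) = ad (k `&` pts_tilde (box C)) i.
  move=> iC; rewrite predeqE => z; rewrite /ad /setI /=; split;
    first by intuition.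
  by case=> [|->]; [intuition|split; [right|apply: inB]].
have ltB (C : nat) z : (`|z| < C)%N -> (box C).1 < z /\ z <= hi (box C).
  by move=> zC; rewrite hi_box /=; lia.
have emp k A (B : set int) : (forall z, B z -> ~ k z) -> k `&` A `&` B = set0.
  by move=> kB; rewrite predeqE => z; split=> // -[[kz _] /kB].
split=> //.
- move=> k i j ij ki kj; rewrite !MZc_ad => Fk.
  have [C0 HC] := big _ Fk; pose C := (C0 + `|i| + `|j|).+1.
  have Ek := HC C ltac:(lia);
    have {HC} [[_ B1 _] _] := H (box C) ltac:(rewrite /is_interval /box /=;
    lia).
  have [iC jC] : (`|i| < C)%N /\ (`|j| < C)%N by lia.
  have [i1 i2] := ltB _ _ iC; have [j1 j2] := ltB _ _ jC.
  have := B1 i j (k `&` pts_tilde (box C)) (inB _ _ iC) (inB _ _ jC) ij.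
  have adB k' i' : (`|i'| < C)%N -> k' `<=` pts_tilde (box C) ->
    ad k' i' `<=` pts_tilde (box C) by move=> h kK z [/kK|->] //; apply: inB.
  have kB : k `&` pts_tilde (box C) `<=` pts_tilde (box C) by move=> z [].
  move=> /(_ kB); rewrite emp; last by move=> z [] ->.
  move=> /(_ erefl); rewrite !setU1_ad setU2_ad.
  rewrite !(restrcE nM) //; try exact: (adB _ _ _ kB);
    try exact: (adB _ _ _ (adB _ _ _ kB)).
  by rewrite !cut_ad // -Ek.
- move=> k i j h ij jh ki kj kh; rewrite !MZc_ad => Fk.
  have [C0 HC] := big _ Fk; pose C := (C0 + `|i| + `|j| + `|h|).+1.
  have Ek := HC C ltac:(lia);
    have {HC} [[_ _ B2] _] := H (box C) ltac:(rewrite /is_interval /box /=;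
    lia).
  have [iC jC hC] : [/\ (`|i| < C)%N, (`|j| < C)%N & (`|h| < C)%N].
    by split; lia.
  have [i1 i2] := ltB _ _ iC; have [j1 j2] := ltB _ _ jC.
  have [h1 h2] := ltB _ _ hC.
  have := B2 i j h (k `&` pts_tilde (box C)) (inB _ _ iC) (inB _ _ jC) (inB _ _
    hC) ij jh.
  have adB k' i' : (`|i'| < C)%N -> k' `<=` pts_tilde (box C) ->
    ad k' i' `<=` pts_tilde (box C) by move=> hh kK z [/kK|->] //; apply: inB.
  have kB : k `&` pts_tilde (box C) `<=` pts_tilde (box C) by move=> z [].
  move=> /(_ kB); rewrite emp; last by move=> z [[]|] ->.
  move=> /(_ erefl); rewrite !setU1_ad !setU2_ad.
  rewrite !(restrcE nM) //; try exact: (adB _ _ _ kB);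
    try exact: (adB _ _ _ (adB _ _ _ kB)).
  by rewrite !cut_ad // -Ek.
Qed.

Lemma pts_sub I J : is_interval I -> is_interval J ->
  pts I `<=` pts J <-> J.1 <= I.1 /\ hi I <= hi J.
Proof.
rewrite /is_interval /hi => I0 J0; split=> [IJ|[h1 h2] z /ptsE zI].
  have /ptsE := IJ (I.1 + 1) ltac:(apply/ptsE; lia).
  by have /ptsE := IJ (I.1 + I.2%:Z) ltac:(apply/ptsE; lia); lia.
by apply/ptsE; lia.
Qed.

Lemma stable_uniq M k v w : stable M k v -> stable M k w -> v = w.
Proof.
move=> [B HB] [C HC]; rewrite -(HB (- `|B| - `|C|) (`|B| + `|C|)); try lia.
by rewrite HC //; lia.
Qed.

Lemma Intc_stable M k I : Intc M (~` k) I ->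
  stable M k (M (cut I.1 (hi I) k)).
Proof.
move=> [I0 _ HI]; exists (`|I.1| + `|hi I|) => n N nB BN.
rewrite /is_interval in I0.
have := HI (n, absz (N - n - 1)%R); rewrite !OmegacE /hi /= in BN nB *.
have -> : n + (absz (N - n - 1)%R)%:Z + 1 = N by lia.
apply; first by rewrite /is_interval /=; lia.
by apply/pts_sub; rewrite /is_interval /hi /=; lia.
Qed.

Lemma stable_Intc M k v : MZ k -> stable M k v ->
  exists C0 : nat, forall C, (C0 < C)%N -> Intc M (~` k) (box C).
Proof.
move=> /MZP[B HB] [B' HB']; exists (`|B| + `|B'|).+1 => C BC.
have C0 : is_interval (box C) by rewrite /is_interval /box /=; lia.
have hC := @hi_box C ltac:(lia); split=> //.
  apply/MZc_finP => //; split.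
  - rewrite predeqE => z; rewrite /cut hC /setC /=; have [h1 h2] := HB z.
    have [zC|Cz] := leP z C%:Z; last by intuition; apply: h2 => //; lia.
    split=> [kz|]; last by case=> [[_ []]|] //; lia.
    left; split=> //; rewrite ltNge; apply/negP => zC'; apply: kz.
    by apply: h1; lia.
  - exists C%:Z; first by apply/pts_tildeE => /=; lia.
    by apply: (HB C%:Z).2; lia.
  - exists (- C%:Z + 1); first by apply/pts_tildeE => /=; lia.
    by move=> /(_ ((HB _).1 _)); apply; lia.
move=> J J0 /(pts_sub C0 J0); rewrite hC => -[/= h1 h2].
by rewrite !OmegacE /= hC !HB' //; lia.
Qed.

(** The form in which BZ_Z is used from here on: relations on [MZc], and limits over growing windows
    in place of the sets [Intc]. *)
Lemma BZZP M :
  BZZ M <-> BZdata M /\ forall k, MZ k -> exists v, stable M k v.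
Proof.
split=> [[MI MK MS]|[MB MS]].
  split; first exact: BZdata_of.
  move=> k kM; have kc : MZc (~` k) by exists k.
  by have [I /Intc_stable h] := MS _ kc; eexists; exact: h.
split; [exact: BZ_indexed|by move=> K K0; apply: BZdata_BZ|move=> k kM].
have kM' : MZ (~` k) by apply/MZ_setC.
have [v /(stable_Intc kM')[C0 HC]] := MS _ kM'.
by exists (box C0.+1); have := HC C0.+1; rewrite setCK; apply.
Qed.

Lemma Theta_stable M k : BZZ M -> MZ k -> stable M k (Theta M k).
Proof.
move=> [_ _ MS] kM; have kc : MZc (~` k) by exists k.
by rewrite /Theta OmegacE; apply: Intc_stable; apply: xgetPex; apply: MS.
Qed.

Lemma ThetaE M k v : BZZ M -> MZ k -> stable M k v -> Theta M k = v.
Proof. by move=> MZ kM; apply: stable_uniq; apply: Theta_stable. Qed.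

(** * Existence of the raising operators *)

Lemma kLambda_ad p : kLambda p = ad (kLambda (p - 1)) p.
Proof. by rewrite predeqE => z; rewrite /ad /kLambda /=; lia. Qed.

Lemma kLambda_nxt p :
  kLambda (p + 1) = ad (ad (kLambda (p - 1)) p) (nxt p).
Proof. by rewrite predeqE => z; rewrite /ad /kLambda /nxt /=; lia. Qed.

Lemma ksLambda_ad p : ksLambda p = ad (kLambda (p - 1)) (nxt p).
Proof. by rewrite predeqE => z; rewrite /ad /kLambda /nxt /ksLambda /setU /=.
  Qed.

Lemma MZ_kLambda p : MZ (kLambda p).
Proof. by apply/MZP; exists `|p| => z; rewrite /kLambda /=; lia. Qed.

Lemma MZ_ksLambda p : MZ (ksLambda p).
Proof. by rewrite ksLambda_ad MZ_ad; apply: MZ_kLambda. Qed.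

Lemma cut_rm n N k i : n < i -> i <= N -> cut n N (rm k i) = rm (cut n N k) i.
Proof.
move=> ni iN; rewrite predeqE => z; rewrite /cut /rm /=; split.
  case=> [[? [? [? ?]]]|?]; first by split=> //; left.
  by split; [right|lia].
by case=> [[[? [? ?]]|?] ?]; [left|right].
Qed.

(** Enumeration by increasing absolute value, starting with m + 1 and - (m + 1). Thus a longer
    [box_seq] extends a shorter one at its end, and a path along it widens a window one point at a
    time. *)
Fixpoint outward (m r : nat) : seq int :=
  if r is r'.+1 then m.+1%:Z :: - m.+1%:Z :: outward m.+1 r' else [::].

Lemma outward_cat m r1 r2 :
  outward m (r1 + r2) = outward m r1 ++ outward (m + r1) r2.
Proof.
elim: r1 m => [|r IH] m /=; first by rewrite addn0.
by rewrite IH addSnnS.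
Qed.

Lemma mem_outward m r (z : int) :
  (z \in outward m r) = ((m < `|z|)%N && (`|z| <= m + r)%N).
Proof.
elim: r m => [|r IH] m /=; first by rewrite in_nil; lia.
by rewrite !inE IH; lia.
Qed.

Definition box_seq (m : nat) : seq int := 0 :: outward 0 m.

Lemma mem_box_seq m (z : int) : (z \in box_seq m) = (`|z| <= m)%N.
Proof. by rewrite inE mem_outward; lia. Qed.

Lemma box_seq_cat m r : box_seq (m + r) = box_seq m ++ outward m r.
Proof. by rewrite /box_seq outward_cat. Qed.

(** The eventual value of u, with x0 as default when u is not eventually constant. *)
Definition evl (T : choiceType) (x0 : T) (u : nat -> T) : T :=
  xget x0 [set v | exists B, forall m, (B <= m)%N -> u m = v].

Lemma evlE (T : choiceType) (x0 : T) (u : nat -> T) B v :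
  (forall m, (B <= m)%N -> u m = v) -> evl x0 u = v.
Proof.
move=> Bv; apply: xget_unique; first by exists B.
move=> w [C Cw]; rewrite -(Bv (B + C)%N) ?leq_addr //.
by rewrite Cw ?leq_addl.
Qed.

Section Raising.
Variables (M : collection) (p : int).
Hypothesis MB : BZdata M.
(** Here s, t', t'' are the values of [Theta M] at [ksLambda p], [kLambda (p + 1)],
    [kLambda (p - 1)], reached from [B0] on, and x is the prescribed limit slope. The bound on x is
    the condition [dB] in the limit; it allows x to exceed the old limit slope by [eps p M]. *)
Variables (t s t' t'' x : int) (B0 : nat).
Let T := kLambda (p - 1).
Hypothesis pB : (`|p| + 2 <= B0)%N.
Hypothesis Ms : forall n N : int, n <= - B0%:Z -> B0%:Z <= N ->
  M (cut n N (ad T (nxt p))) = s.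
Hypothesis Mt' : forall n N : int, n <= - B0%:Z -> B0%:Z <= N ->
  M (cut n N (ad (ad T p) (nxt p))) = t'.
Hypothesis Mt'' : forall n N : int, n <= - B0%:Z -> B0%:Z <= N ->
  M (cut n N T) = t''.
Hypothesis xle : x <= t' + t'' - s - s.

Lemma cut_shrink (n N : int) k : n <= N -> ~ k (N + 1) ->
  ad (cut n (N + 1) k) (N + 1) = cut n N k.
Proof.
move=> nN kN; rewrite predeqE => z; rewrite /cut /ad /=.
have [->|/eqP zN] := eqVneq z (N + 1); first by split=> _; [right; lia|right].
split.
  by case=> [[[? [? ?]]|?]|?] //; [left; split; [|split; [lia|]]|right; lia].
case=> [[? [? ?]]|?]; first by left; left; split; [|split; [lia|]].
by left; right; lia.
Qed.

Lemma cut_extend (n N : int) k : n <= N -> k n ->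
  ad (cut n N k) n = cut (n - 1) N k.
Proof.
move=> nN kN; rewrite predeqE => z; rewrite /cut /ad /=.
have [->|/eqP zN] := eqVneq z n.
  by split=> _; [left; split; [lia|split]|right].
split.
  by case=> [[[? [? ?]]|?]|?] //; [left; split; [lia|split]|right].
case=> [[? [? ?]]|?]; last by left; right.
by left; left; split; [lia|split].
Qed.

(** At a cut of T a needed step only widens the window by one point, and the gap met is t' + t'' - s
    - s, which is at least x. So the minimum remains x, and paths may be prolonged at will. *)
Lemma path_min_top m r (n N : int) : n <= - B0%:Z -> B0%:Z <= N ->
  n <= - m%:Z - 1 -> m%:Z <= N ->
  path_min M p x (outward m r) (cut n N T) = x.
Proof.
elim: r m n N => // r IH m n N nB BN nm mN.
have pn : n < p by lia.
have qN : nxt p < N by rewrite /nxt; lia.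
have np : n < nxt p by rewrite /nxt; lia.
have pN : p <= N by lia.
have right_step : needs p (cut n N T) m.+1%:Z ->
    exists N' : int, [/\ m.+1%:Z <= N', B0%:Z <= N',
      up p (cut n N T) m.+1%:Z = cut n N' T &
      x <= gap M p (rm (cut n N T) m.+1%:Z) m.+1%:Z].
  move=> nd; have [qm jN] : nxt p < m.+1%:Z /\ N + 1 = m.+1%:Z.
    by move: nd; rewrite /needs /cut /T /kLambda /nxt /=; lia.
  have nT : ~ T (N + 1) by rewrite /T /kLambda /=; lia.
  have nTq : ~ ad T (nxt p) (N + 1).
    by move: qN nT; rewrite /ad /nxt /=; intuition lia.
  have nC : ~ cut n (N + 1) T (N + 1) by rewrite /cut /=; intuition lia.
  exists (N + 1); split; [lia|lia| |].
    by rewrite up_right // -jN -(@cut_shrink n N T) ?adK //; lia.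
  rewrite -jN -(@cut_shrink n N T) ?adK //; last lia.
  rewrite /gap -(@cut_ad n (N + 1) T p) -?(@cut_ad n (N + 1) _ (nxt p)) //;
    try lia.
  rewrite !cut_shrink //; try lia.
  rewrite !Ms ?Mt' ?Mt'' //; try lia.
have left_step (N' : int) : B0%:Z <= N' -> needs p (cut n N' T) (- m.+1%:Z) ->
    exists n' : int, [/\ n' <= - m.+1%:Z - 1, n' <= - B0%:Z,
      up p (cut n N' T) (- m.+1%:Z) = cut n' N' T &
      x <= gap M p (rm (cut n N' T) (- m.+1%:Z)) (- m.+1%:Z)].
  move=> BN' nd; have [mp jn] : - m.+1%:Z < p /\ n = - m.+1%:Z.
    by move: nd; rewrite /needs /cut /T /kLambda /nxt /=; lia.
  have nT : T n by rewrite /T /kLambda /=; lia.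
  have nTq : ad T (nxt p) n by left.
  have nC : ~ cut n N' T n by rewrite /cut /=; intuition lia.
  exists (n - 1); split; [lia|lia| |].
    by rewrite up_left // -jn cut_extend //; lia.
  rewrite -jn rm_id // /gap -(@cut_ad n N' T p) -?(@cut_ad n N' _ (nxt p)) //;
    try (rewrite /nxt; lia).
  rewrite !cut_extend //; try lia.
  rewrite !Ms ?Mt' ?Mt'' //; try lia.
have left_tail (N' : int) : m.+1%:Z <= N' -> B0%:Z <= N' ->
    path_min M p x (- m.+1%:Z :: outward m.+1 r) (cut n N' T) = x.
  move=> mN' BN' /=; case: asboolP => nd.
    have [n' [n'm n'B -> xg]] := left_step N' BN' nd.
    by rewrite IH //; apply/min_idPr.
  apply: IH => //; move: nd; rewrite /needs /cut /T /kLambda /nxt /=; lia.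
change (path_min M p x (m.+1%:Z :: (- m.+1%:Z :: outward m.+1 r)) (cut n N T) =
  x).
rewrite [LHS]/=; case: asboolP => nd.
  have [N' [mN' BN' -> xg]] := right_step nd.
  by have /= -> := left_tail N' mN' BN'; apply/min_idPr.
apply: left_tail => //; move: nd; rewrite /needs /cut /T /kLambda /nxt /=.
lia.
Qed.

Lemma path_min_box B (k : set int) (n N : int) m : (B0 <= B)%N ->
  (forall z : int, (z < - B%:Z -> k z) /\ (B%:Z < z -> ~ k z)) ->
  ~ k p -> ~ k (nxt p) -> n <= - B%:Z - 1 -> B%:Z <= N -> (B <= m)%N ->
  path_min M p x (box_seq m) (cut n N k) =
  path_min M p x (box_seq B) (cut n N k).
Proof.
move=> B0B kB kp kq nB BN /subnKC <-.
rewrite box_seq_cat path_min_cat.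
have -> : ups p (cut n N k) (box_seq B) = cut n N T.
  rewrite predeqE => z; rewrite upsE mem_box_seq /cut /T /kLambda /=.
  have [h1 h2] := kB z.
  have zp : z = p -> ~ k z by move=> ->.
  have zq : z = p + 1 -> ~ k z by move=> ->.
  rewrite /nxt; have [kz|kz] := pselect (k z).
    rewrite (propT kz); have zB : ~ B%:Z < z by move/h2.
    have {}zp : z <> p by move/zp.
    by have {}zq : z <> p + 1 by [move/zq]; clear h1 h2; lia.
  by rewrite (propF kz); have zB : ~ z < - B%:Z by [move/h1]; clear h1 h2; lia.
by rewrite path_min_top //; lia.
Qed.

Definition raised_slope (K : set int) : int :=
  evl 0 (fun m => path_min M p x (box_seq m) K).

Lemma raised_slope_cut B (k : set int) (n N : int) : (B0 <= B)%N ->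
  (forall z : int, (z < - B%:Z -> k z) /\ (B%:Z < z -> ~ k z)) ->
  ~ k p -> ~ k (nxt p) -> n <= - B%:Z - 1 -> B%:Z <= N ->
  raised_slope (cut n N k) = path_min M p x (box_seq B) (cut n N k).
Proof.
by move=> B0B kB kp kq nB BN; apply: evlE => m; apply: path_min_box.
Qed.

Lemma raised_slope_eventually K : MZc K -> ~ K p -> ~ K (nxt p) ->
  exists B, forall m, (B <= m)%N ->
    path_min M p x (box_seq m) K = raised_slope K.
Proof.
move=> /MZcP[C HC] Kp Kq; pose B := (B0 + `|C|)%N.
(* A Maya diagram with the same trace as K between - B and B; K is one of its cuts, so
   [path_min_box] applies. *)
pose k : set int := [set z | z < - B%:Z \/ z <= B%:Z /\ K z].
have EK : K = cut (- B%:Z - 1) B%:Z k.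
  rewrite predeqE => z; rewrite /cut /k /=; have [h1 h2] := HC z.
  have BC : (`|C| <= B)%N by rewrite leq_addl.
  have [kz|kz] := pselect (K z); first rewrite (propT kz).
    by have : ~ z < - C by [move/h1]; clear h1 h2; clearbody B; lia.
  rewrite (propF kz).
  by have : ~ C < z by [move/h2]; clear h1 h2; clearbody B; lia.
have kB (z : int) : (z < - B%:Z -> k z) /\ (B%:Z < z -> ~ k z).
  by rewrite /k /=; split; [left|move=> Bz [|[]]; lia].
have kp : ~ k p by rewrite /k /= => -[|[]//]; lia.
have kq : ~ k (nxt p) by rewrite /k /= /nxt => -[|[]//]; lia.
exists B => m Bm; rewrite EK (raised_slope_cut _ kB) ?(path_min_box _ kB) //;
  lia.
Qed.

Lemma raised_slope_left K j : MZc K -> ~ K p -> ~ K (nxt p) -> j < p ->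
  ~ K j ->
  raised_slope K = Num.min (raised_slope (ad K j)) (gap M p K j).
Proof.
move=> FK Kp Kq jp Kj.
have Kp' : ~ ad K j p by mem.
have Kq' : ~ ad K j (nxt p) by mem.
have FK' : MZc (ad K j) by rewrite MZc_ad.
have [B1 HB1] := raised_slope_eventually FK Kp Kq.
have [B2 HB2] := raised_slope_eventually FK' Kp' Kq'.
pose m := (B1 + B2 + `|j|)%N.
rewrite -(HB1 m) -?(HB2 m); try by rewrite /m; lia.
rewrite (path_min_edge x MZc_ad (BZ_plucker MB) FK Kp Kq (j := j)).
- by rewrite rm_id // up_left // minC.
- by rewrite mem_box_seq /m; lia.
by left.
Qed.

Lemma raised_slope_right K j : MZc K -> ~ K p -> ~ K (nxt p) -> nxt p < j ->
  ~ K j ->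
  raised_slope (ad K j) = Num.min (raised_slope K) (gap M p K j).
Proof.
move=> FK Kp Kq jp Kj.
have Kp' : ~ ad K j p by mem.
have Kq' : ~ ad K j (nxt p) by mem.
have FK' : MZc (ad K j) by rewrite MZc_ad.
have [B1 HB1] := raised_slope_eventually FK Kp Kq.
have [B2 HB2] := raised_slope_eventually FK' Kp' Kq'.
pose m := (B1 + B2 + `|j|)%N.
rewrite -(HB1 m) -?(HB2 m); try by rewrite /m; lia.
rewrite (path_min_edge x MZc_ad (BZ_plucker MB) FK' Kp' Kq' (j := j)).
- by rewrite up_right // adK // minC.
- by rewrite mem_box_seq /m; lia.
by right; split=> //; right.
Qed.

Lemma raised_slope_le K : MZc K -> ~ K p -> ~ K (nxt p) ->
  raised_slope K <=
  M (ad (ad K p) (nxt p)) + M K - (M (ad K (nxt p)) + M (ad K (nxt p))).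
Proof.
move=> FK Kp Kq; have /MZcP[B HB] := FK.
(* Any j < p outside K serves: [raised_slope K] is at most the gap at j, and supermodularity for p +
   1 and j bounds that gap as required. *)
pose j : int := - (`|B| + `|p|) - 1.
have Kj : ~ K j by apply: (HB j).1; rewrite /j; lia.
have jp : j < p by rewrite /j; lia.
have qj : nxt p <> j by rewrite /nxt; lia.
rewrite (raised_slope_left FK Kp Kq jp Kj) /gap.
have := BZ_super MB qj Kq Kj; rewrite !MZc_ad => /(_ FK); lia.
Qed.

Definition raise : collection :=
  patch (fun=> 0) MZc (with_slope M p raised_slope).

Lemma raiseE k : MZc k -> raise k = with_slope M p raised_slope k.
Proof. by move=> kM; rewrite /raise /patch ifT //; rewrite inE. Qed.

Lemma raise_no_drop k : ~ drops k p -> raise k = M k.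
Proof.
move=> kp; have [kM|kM] := pselect (MZc k).
  by rewrite raiseE // with_slope_id.
by rewrite /raise /patch ifF ?(BZ_indexed MB) //; apply/negP; rewrite inE.
Qed.

Lemma BZdata_raise : BZdata raise.
Proof.
split.
- by move=> k kM; rewrite /raise /patch ifF //; apply/negP; rewrite inE.
- move=> k i j ij ki kj Fk; have := Fk; rewrite !MZc_ad => Fk'.
  rewrite !raiseE ?MZc_ad //.
  exact: (with_slope_supermodular MZc_ad (BZ_super MB) (BZ_plucker MB)
    raised_slope_left raised_slope_right raised_slope_le).
- move=> k i j h ij jh ki kj kh Fk; have := Fk; rewrite !MZc_ad => Fk'.
  rewrite !raiseE ?MZc_ad //.
  exact: (with_slope_plucker MZc_ad (BZ_plucker MB)
    raised_slope_left raised_slope_right raised_slope_le).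
move=> a; rewrite raise_no_drop ?(BZ_norm MB) //.
by rewrite /drops /nxt /=; lia.
Qed.

Hypothesis MS : forall k, MZ k -> exists v, stable M k v.

Lemma gap_stable k j : MZ k -> exists v, exists B : int,
  forall n N : int, n <= - B -> B <= N -> gap M p (cut n N k) j = v.
Proof.
move=> kM; have S a b : exists v, exists B : int, forall n N : int,
    n <= - B -> B <= N -> M (ad (ad (cut n N k) a) b) = v.
  have [|v [B HB]] := @MS (ad (ad k a) b); first by rewrite !MZ_ad.
  exists v, (`|B| + `|a| + `|b| + 1) => n N nB BN.
  by rewrite -!cut_ad ?HB //; lia.
have S1 a : exists v, exists B : int, forall n N : int,
    n <= - B -> B <= N -> M (ad (cut n N k) a) = v.
  have [v [B HB]] := S a a; exists v, B => n N nB BN.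
  by rewrite -(HB n N nB BN) [in RHS]ad_id //; right.
have [v1 [B1 H1]] := S p (nxt p); have [v2 [B2 H2]] := S1 j.
have [v3 [B3 H3]] := S1 (nxt p); have [v4 [B4 H4]] := S (nxt p) j.
exists (v1 + v2 - v3 - v4), (`|B1| + `|B2| + `|B3| + `|B4|) => n N nB BN.
by rewrite /gap H1 ?H2 ?H3 ?H4 //; lia.
Qed.

Lemma path_min_stable y u k : MZ k -> exists v, exists B : int,
  forall n N : int, n <= - B -> B <= N -> path_min M p y u (cut n N k) = v.
Proof.
elim: u k => [|j u IH] k kM; first by exists y, 0.
have kM' : MZ (up p k j).
  rewrite /up; case: ifP => _; first by rewrite MZ_ad.
  by case: ifP => _ //; rewrite (F_rm MZ_ad).
have [v1 [B1 H1]] := IH k kM; have [v2 [B2 H2]] := IH _ kM'.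
have [v3 [B3 H3]] : exists v, exists B : int, forall n N : int,
    n <= - B -> B <= N -> gap M p (cut n N (rm k j)) j = v.
  by apply: gap_stable; rewrite (F_rm MZ_ad).
exists (if `[< needs p k j >] then Num.min v3 v2 else v1).
exists (`|B1| + `|B2| + `|B3| + `|j| + 1) => n N nB BN /=.
have -> : needs p (cut n N k) j = needs p k j.
  by rewrite /needs (propext (@cutP n N k j _ _)) //; lia.
case: ifP => _; last by rewrite H1 //; lia.
rewrite -cut_rm ?H3; try lia.
have -> : up p (cut n N k) j = cut n N (up p k j).
  rewrite /up; case: ifP => _; first by rewrite cut_ad //; lia.
  by case: ifP => _ //; rewrite cut_rm //; lia.
by rewrite H2 //; lia.
Qed.

(** For all large windows the raised slope at the cut is the minimum along one fixed path, which
    involves finitely many gaps of M, and these stabilize. *)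
Lemma raise_stable k : MZ k -> exists v, stable raise k v.
Proof.
move=> kM; have [B HB] := (MZP k).1 kM.
have [kp|kp] := pselect (drops k p); last first.
  have [v [C HC]] := MS kM; exists v, (`|C| + `|p| + 2) => n N nC CN.
  rewrite raise_no_drop; first by apply: HC; lia.
  by rewrite /drops !cutP /nxt //; lia.
have [K [Kp Kq Ek]] := drops_ad kp.
subst k; rewrite MZ_ad in kM.
pose D := (B0 + `|B| + `|p| + 2)%N.
have KD (z : int) : (z < - D%:Z -> K z) /\ (D%:Z < z -> ~ K z).
  have [h1 h2] := HB z; split=> zD.
    by case: h1 => //; rewrite /D in zD; lia.
  by move=> Kz; apply: h2; [rewrite /D in zD; lia|left].
have [v [C HC]] : exists v, stable M (ad K (nxt p)) v.
  by apply: MS; rewrite MZ_ad.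
have [w [E HE]] := path_min_stable x (box_seq D) kM.
exists (v + w), (`|C| + `|E| + D%:Z + 1) => n N nC CN.
rewrite cut_ad; try (rewrite /D in nC CN; lia).
rewrite raiseE ?MZc_ad; last exact: cut_MZc.
rewrite with_slopeE; try by rewrite cutP // /nxt; rewrite /D in nC CN; lia.
rewrite (raised_slope_cut _ KD) //; try (rewrite /D in nC CN *; lia).
rewrite HE -?cut_ad ?HC //; rewrite /nxt; rewrite /D in nC CN; lia.
Qed.

Lemma path_min_id u K : (forall j, j \in u -> ~ needs p K j) ->
  path_min M p x u K = x.
Proof.
elim: u => //= j u IH H; rewrite asboolF ?IH //.
  by move=> i iu; apply: H; rewrite inE iu orbT.
by apply: H; rewrite inE eqxx.
Qed.

Lemma stable_raise_kLambda : stable raise (kLambda p) (s + x).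
Proof.
have Tp : ~ T p by rewrite /T /kLambda /=; lia.
have Tq : ~ T (nxt p) by rewrite /T /kLambda /nxt /=; lia.
exists (B0%:Z + 1) => n N nB BN; rewrite kLambda_ad -/T cut_ad; try lia.
rewrite raiseE ?MZc_ad; last exact: cut_MZc.
rewrite with_slopeE; try by rewrite cutP // /nxt; lia.
rewrite -cut_ad ?Ms; try (rewrite /nxt; lia).
have TB (z : int) : (z < - B0%:Z -> T z) /\ (B0%:Z < z -> ~ T z).
  by rewrite /T /kLambda /=; lia.
rewrite (raised_slope_cut _ TB) //; try lia.
rewrite path_min_id // => j; rewrite mem_box_seq => jB.
by rewrite /needs cutP /T /kLambda /nxt /=; lia.
Qed.

End Raising.

Lemma BZZ_raise M p : BZZ M -> 0 < eps p M ->
  exists N, [/\ BZZ N, forall k, ~ drops k p -> N k = M k &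
    Theta N (kLambda p) = Theta M (kLambda p) + 1].
Proof.
move=> MZ ep; have [MB MS] := (BZZP M).1 MZ.
have TM := MZ_kLambda (p - 1).
have [B1 H1] := Theta_stable MZ (MZ_kLambda p).
have [B2 H2] := Theta_stable MZ (MZ_ksLambda p).
have [B3 H3] := Theta_stable MZ (MZ_kLambda (p + 1)).
have [B4 H4] := Theta_stable MZ TM.
pose B0 := (`|p| + `|B1| + `|B2| + `|B3| + `|B4| + 2)%N.
rewrite /eps in ep.
set t := Theta M (kLambda p) in H1 ep *.
set s := Theta M (ksLambda p) in H2 ep.
set t' := Theta M (kLambda (p + 1)) in H3 ep.
set t'' := Theta M (kLambda (p - 1)) in H4 ep.
(* One more than the old limit slope t - s; the bound [xle] is then exactly [eps p M] >= 1. *)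
pose x := t - s + 1.
have pB : (`|p| + 2 <= B0)%N by rewrite /B0; lia.
have Ms (n N : int) : n <= - B0%:Z -> B0%:Z <= N ->
    M (cut n N (ad (kLambda (p - 1)) (nxt p))) = s.
  by move=> nB BN; rewrite -ksLambda_ad H2 //; rewrite /B0 in nB BN; lia.
have Mt' (n N : int) : n <= - B0%:Z -> B0%:Z <= N ->
    M (cut n N (ad (ad (kLambda (p - 1)) p) (nxt p))) = t'.
  by move=> nB BN; rewrite -kLambda_nxt H3 //; rewrite /B0 in nB BN; lia.
have Mt'' (n N : int) : n <= - B0%:Z -> B0%:Z <= N ->
    M (cut n N (kLambda (p - 1))) = t''.
  by move=> nB BN; rewrite H4 //; rewrite /B0 in nB BN; lia.
have xle : x <= t' + t'' - s - s by rewrite /x; lia.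
have RZ : BZZ (raise M p x).
  apply/BZZP; split; first exact: (BZdata_raise MB pB Ms Mt' Mt'' xle).
  by move=> k; apply: (raise_stable MB pB Ms Mt' Mt'' xle MS).
exists (raise M p x); split=> // [k|]; first exact: raise_no_drop.
apply: ThetaE => //; first exact: MZ_kLambda.
have := stable_raise_kLambda pB Ms Mt' Mt'' xle.
by rewrite /x; congr stable; lia.
Qed.

(** * The lowering operators *)

Lemma slope_up F M p K j : tropical_plucker F M -> ~ K p -> ~ K (nxt p) ->
  needs p K j -> F (ad (ad (ad K j) p) (nxt p)) ->
  slope M p K = Num.min (slope M p (up p K j)) (gap M p (rm K j) j).
Proof.
move=> M2 Kp Kq [[jp Kj]|[qj Kj]] FK.
  by rewrite up_left // rm_id //; apply: slope_left FK.
have E : K = ad (rm K j) j by rewrite rmK.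
rewrite up_right // {1}E; apply: (slope_right M2); try by mem.
suff -> : ad (ad (ad (rm K j) p) (nxt p)) j = ad (ad (ad K j) p) (nxt p) by [].
by rewrite (adC _ _ j) (adC (rm K j) _ j) rmK // (ad_id Kj).
Qed.

Lemma gap_agree M N p C j :
  (forall k, ~ drops k p -> M k = N k) -> ~ C p -> j <> p ->
  gap M p C j = gap N p C j.
Proof.
move=> MN Cp jp; rewrite /gap !MN //; rewrite /drops /ad /nxt /=; intuition lia.
Qed.

(** Both slopes are carried back along the path by the same gaps, so a truncation by c at its end
    remains a truncation by c at its start. Taking c to be the slope at the end gives equality of
    the slopes ([slope_eq_ups]). *)
Lemma slope_min_ups F M N p c s K :
  tropical_plucker F M -> tropical_plucker F N ->
  (forall k, ~ drops k p -> M k = N k) ->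
  (forall C j, j \in s -> F (ad (ad C p) (nxt p)) ->
    F (ad (ad (ad C j) p) (nxt p)) /\ F (ad (ad (up p C j) p) (nxt p))) ->
  ~ K p -> ~ K (nxt p) -> F (ad (ad K p) (nxt p)) ->
  slope M p (ups p K s) = Num.min c (slope N p (ups p K s)) ->
  slope M p K = Num.min c (slope N p K).
Proof.
move=> M2 N2 MN; elim: s K => // j s IH K Fs Kp Kq FK /= H.
have [F1 F2] := Fs K j (mem_head _ _) FK.
have Fs' C i : i \in s -> F (ad (ad C p) (nxt p)) ->
    F (ad (ad (ad C i) p) (nxt p)) /\ F (ad (ad (up p C i) p) (nxt p)).
  by move=> si; apply: Fs; rewrite inE si orbT.
have [nd|nd] := pselect (needs p K j); last first.
  by rewrite up_id // in H; apply: IH H.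
rewrite !(slope_up _ Kp Kq nd F1) // (IH _ Fs' _ _ F2 H).
- rewrite minA; congr Num.min; apply: gap_agree => //.
    by rewrite /rm /=; case.
  by case: nd; rewrite /nxt; lia.
- exact: up_p.
- exact: up_q.
Qed.

Lemma slope_eq_ups F M N p s K :
  tropical_plucker F M -> tropical_plucker F N ->
  (forall k, ~ drops k p -> M k = N k) ->
  (forall C j, j \in s -> F (ad (ad C p) (nxt p)) ->
    F (ad (ad (ad C j) p) (nxt p)) /\ F (ad (ad (up p C j) p) (nxt p))) ->
  ~ K p -> ~ K (nxt p) -> F (ad (ad K p) (nxt p)) ->
  slope M p (ups p K s) = slope N p (ups p K s) -> slope M p K = slope N p K.
Proof.
move=> M2 N2 MN Fs Kp Kq FK H.
have h1 := @slope_min_ups F M N p _ s K M2 N2 MN Fs Kp Kq FK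
  (esym (etrans (minxx _) (esym H))).
have h2 := @slope_min_ups F N M p _ s K N2 M2 (fun k kp => esym (MN k kp))
  Fs Kp Kq FK (esym (etrans (minxx _) H)).
move: h1 h2; rewrite H; move: (slope N p _) (slope M p K) (slope N p K) =>
  c a b.
by clear; lia.
Qed.

Lemma drops_cut n N k r : drops (cut n N k) r -> drops k r.
Proof.
rewrite /drops /cut /nxt /= => -[[[nr [rN kr]]|Nr] h]; last first.
  by exfalso; apply: h; right; lia.
split=> // kr1; apply: h; have [rN'|] := ltP N (r + 1); first by right.
by left; split; [lia|].
Qed.

Lemma Mx_sub I k : Mx I k -> k `<=` pts_tilde I.
Proof. by case. Qed.

(** The steps at the points of tilde I move every K to [n + 1, p - 1], where the slope is fixed by
    the prescribed [n + 1, p]-component; equality is carried back along the path. *)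
Lemma shift_unique I p c M N N' : is_interval I -> pts I p ->
  is_shift I p c M N -> is_shift I p c M N' -> N = N'.
Proof.
move=> I0 /ptsE pI [[[NI _ N2] _] Np NM] [[[NI' _ N2'] _] Np' NM'].
pose F : set (set int) := [set k | k `<=` pts_tilde I].
have plu X : BZ2 I X -> tropical_plucker F X.
  move=> X2 k i j h ij jh ki kj kh Fk.
  rewrite -!setU2_ad -!setU1_ad; apply: X2 => //.
  - by apply: Fk; left; left; right.
  - by apply: Fk; left; right.
  - by apply: Fk; right.
  - by move=> z kz; apply: Fk; left; left; left.
  by rewrite predeqE => z; split=> // -[kz [[|]|]] /= e; rewrite e in kz.
have agree k : ~ drops k p -> N k = N' k.
  move=> kp; have [kM|kM] := pselect (Mx I k); last by rewrite NI ?NI'.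
  by rewrite NM ?NM' // => -[_ k1 k2]; apply: kp.
rewrite funeqE => k; have [kp|] := pselect (drops k p); last exact: agree.
have [kM|kM] := pselect (Mx I k); last by rewrite NI ?NI'.
have [K [Kp Kq Ek]] := drops_ad kp; subst k.
have KI : K `<=` pts_tilde I by move=> z Kz; apply: (Mx_sub kM); left.
have inI z : pts_tilde I z <-> I.1 < z /\ z <= hi I by rewrite pts_tildeE.
have pI' : pts_tilde I p /\ pts_tilde I (nxt p).
  by rewrite !pts_tildeE /nxt; lia.
suff : slope N p K = slope N' p K.
  rewrite /slope (agree (ad K (nxt p))); first by lia.
  by rewrite /drops /ad /nxt /=; intuition lia.
pose s := [seq I.1 + i%:Z | i <- iota 1 (I.2).+1].
have ms z : z \in s <-> pts_tilde I z.
  rewrite inI /hi; split=> [/mapP[i]|zI].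
    by rewrite mem_iota => iI ->; lia.
  by apply/mapP; exists (absz (z - I.1)%R); [rewrite mem_iota|]; lia.
have adF C j : F C -> pts_tilde I j -> F (ad C j).
  by move=> FC Ij z [/FC|->].
apply: (slope_eq_ups (F := F) (s := s));
  [exact: plu|exact: plu|by []| |by []|by []| |].
- move=> C j /ms js FC; have FC' : F C by move=> z Cz; apply: FC; left; left.
  case: pI' => pI1 pI2; split; apply: (adF) => //; apply: (adF) => //.
    exact: adF.
  by rewrite /up; case: ifP => _; [exact: adF|case: ifP => // _ z [/FC']].
- by case: pI' => pI1 pI2; apply: (adF) => //; apply: (adF).
have -> : ups p K s = [set z | I.1 < z /\ z < p].
  rewrite predeqE => z; rewrite upsE (propext (ms z)) inI /=.
  have [Kz|Kz] := pselect (K z); last by rewrite (propF Kz) /hi; lia.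
  rewrite (propT Kz).
  have zp : z <> p by move=> e; apply: Kp; rewrite -e.
  have zq : z <> p + 1 by move=> e; apply: Kq; rewrite /nxt -e.
  have := KI _ Kz; rewrite inI /nxt /hi; lia.
rewrite /slope; congr (_ - _); last first.
  by apply: agree; rewrite /drops /ad /nxt /=; intuition lia.
have -> : ad [set z | I.1 < z /\ z < p] p = `[I.1 + 1, p]%classic.
  rewrite predeqE => z; rewrite /ad /= in_itv /=; split; first by move=> h;
    apply/andP; lia.
  by move=> /andP; lia.
by rewrite Np Np'.
Qed.

Lemma eq_cut (n N : int) (k k' : set int) :
  (forall z, n < z -> z <= N -> (k z <-> k' z)) -> cut n N k = cut n N k'.
Proof.
move=> kk; rewrite predeqE => z; rewrite /cut /=; split.
  by case=> [[nz [zN /kk kz]]|]; [left; split=> //; split=> //;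
    apply: kz|right].
by case=> [[nz [zN /kk kz]]|]; [left; split=> //; split=> //; apply: kz|right].
Qed.

Lemma Intc_eval M k I v : Intc M (~` k) I -> stable M k v ->
  M (cut I.1 (hi I) k) = v.
Proof. by move=> /Intc_stable h /(stable_uniq h). Qed.

Lemma kLambda_pred_p p : ~ kLambda (p - 1) p.
Proof. by rewrite /kLambda /=; lia. Qed.

Lemma kLambda_pred_q p : ~ kLambda (p - 1) (nxt p).
Proof. by rewrite /kLambda /nxt /=; lia. Qed.

Lemma drops_ksLambda p r : drops (ksLambda p) r -> r = p - 1 \/ r = p + 1.
Proof. by rewrite /drops /ksLambda /setU /nxt /=; lia. Qed.

Lemma drops_kLambda p r : drops (kLambda p) r -> r = p.
Proof. by rewrite /drops /kLambda /nxt /=; lia. Qed.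

Lemma slope_cut_kLambda M p (n N : int) : n < p -> nxt p <= N ->
  slope M p (cut n N (kLambda (p - 1))) =
  M (cut n N (kLambda p)) - M (cut n N (ksLambda p)).
Proof.
move=> np qN; have pN : p <= N by rewrite /nxt in qN; lia.
by rewrite /slope -!cut_ad // -?kLambda_ad -?ksLambda_ad //; rewrite /nxt; lia.
Qed.

Lemma f_op_val M N p k I : BZZ M -> BZZ N ->
  (forall k, ~ drops k p -> N k = M k) ->
  Theta N (kLambda p) = Theta M (kLambda p) - 1 ->
  MZc_fin I k -> Intc M (~` kLambda p) I -> Intc M (~` ksLambda p) I ->
  f_fin I p (restrc I M) (res I k) = N k.
Proof.
move=> MZ NZ NM ThN kI I1 I2; have I0 : is_interval I by case: I1.
have MB := (BZZP M).1 MZ; have NB := (BZZP N).1 NZ.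
have [Ip pI] : I.1 < p /\ p < hi I.
  case: I1 => _ /(MZc_finP _ I0)[_ [a /pts_tildeE aI ka] [b /pts_tildeE bI kb]]
    _.
  have : ~ ~ kLambda p b by [].
  by move: ka; rewrite /setC /kLambda /hi /=; lia.
have pI' : pts I p by apply/ptsE; rewrite /hi in pI; lia.
have qI : nxt p <= hi I by rewrite /nxt; lia.
pose th := Theta M (kLambda p); pose s := Theta M (ksLambda p).
have M1 : M (cut I.1 (hi I) (kLambda p)) = th.
  by apply: Intc_eval I1 _; apply: Theta_stable MZ (MZ_kLambda p).
have M2 : M (cut I.1 (hi I) (ksLambda p)) = s.
  by apply: Intc_eval I2 _; apply: Theta_stable MZ (MZ_ksLambda p).
have sd n m : ~ drops (cut n m (ksLambda p)) p.
  by move=> h; have := drops_ksLambda (drops_cut h); lia.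
(* The window I is stable for M but is not assumed stable for N. In a larger window where both are
   stable, the slope of N is that of M truncated by th - 1 - s; this truncation is carried back to
   I, where the slope of M is th - s. *)
have N1 : N (cut I.1 (hi I) (kLambda p)) = th - 1.
  have [B1 H1] := Theta_stable MZ (MZ_kLambda p).
  have [B2 H2] := Theta_stable MZ (MZ_ksLambda p).
  have [B3 H3] := Theta_stable NZ (MZ_kLambda p).
  pose B := (`|B1| + `|B2| + `|B3| + `|I.1| + `|hi I| + `|p| + 2)%N.
  have BE : (`|B1| + `|B2| + `|B3| + `|I.1| + `|hi I| + `|p| + 2)%N = B by [].
  have Bn : - B%:Z - 1 < p by lia.
  have BN : nxt p <= B%:Z by rewrite /nxt; lia.
  pose T := cut I.1 (hi I) (kLambda (p - 1)).
  have Tp : ~ T p by rewrite /T cutP; [exact: kLambda_pred_p|lia|lia].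
  have Tq : ~ T (nxt p).
    by rewrite /T cutP; [exact: kLambda_pred_q|rewrite /nxt; lia|].
  have TB : ups p T (box_seq B) = cut (- B%:Z - 1) B%:Z (kLambda (p - 1)).
    rewrite predeqE => z; rewrite upsE mem_box_seq /T /cut /kLambda /nxt /=.
    by clear -BE Ip pI; clearbody B; lia.
  have := @slope_min_ups MZc N M p (th - 1 - s) (box_seq B) T
    (BZ_plucker NB.1) (BZ_plucker MB.1) NM.
  rewrite TB !slope_cut_kLambda //.
  rewrite M1 M2 !(NM (cut _ _ (ksLambda p))) // M2
    (H1 (- B%:Z - 1) B%:Z) ?(H2 (- B%:Z - 1) B%:Z) ?(H3 (- B%:Z - 1) B%:Z)
      ?ThN; try lia.
  move=> H; suff : N (cut I.1 (hi I) (kLambda p)) - M (cut I.1 (hi I) (ksLambda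
    p))
      = Num.min (th - 1 - s) (th - s).
    by rewrite M2; clear; lia.
  rewrite M2; apply: H => //.
  - by move=> C j _; rewrite !MZc_ad F_up //; exact: MZc_ad.
  - by rewrite !MZc_ad; apply: cut_MZc.
  by rewrite -/th -/s; clear; lia.
have kE : k = cut I.1 (hi I) (res I k).
  have [Ek _ _] := (MZc_finP k I0).1 kI; rewrite {1}Ek.
  apply: eq_cut => z nz zN.
  rewrite /res /setI /=; split; last by case.
  by split=> //; apply/pts_tildeE; rewrite /hi in zN.
have rI : res I k `<=` pts_tilde I by move=> z [].
rewrite {2}kE -(restrcE (BZ_norm NB.1)) //; congr (_ (res I k)).
have shN : is_shift I p (- 1) (restrc I M) (restrc I N).
  have itvE : cut I.1 (hi I) `[I.1 + 1, p]%classic = cut I.1 (hi I) (kLambda p).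
    by apply: eq_cut => z nz zN; rewrite /= in_itv /kLambda /=; split;
      [case/andP|move=> ?; apply/andP]; lia.
  have itvI : `[I.1 + 1, p]%classic `<=` pts_tilde I.
    move=> z /=; rewrite in_itv /= => /andP[z1 z2]; apply/pts_tildeE.
    by rewrite /hi in pI; lia.
  split.
  - exact: BZdata_BZ I0 NB.1.
  - by rewrite !(restrcE (BZ_norm NB.1)) // (restrcE (BZ_norm MB.1)) // itvE N1
    M1.
  move=> k' k'M k'p; have k'I := Mx_sub k'M.
  rewrite (restrcE (BZ_norm NB.1)) // (restrcE (BZ_norm MB.1)) //.
  by apply: NM => h; have [h1 h2] := drops_cut h; apply: k'p.
rewrite /f_fin; apply: xget_unique => // N' shN'.
exact: shift_unique shN' shN.
Qed.

Lemma Intc_box_MZc_fin k : MZc k -> exists C0 : nat, forall C, (C0 < C)%N ->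
  MZc_fin (box C) k.
Proof.
move=> kM; have kM' : MZ (~` k) by apply/MZ_setC.
have St : stable (fun=> 0) (~` k) 0 by exists 0.
have [C0 H] := stable_Intc kM' St.
by exists C0 => C /H[_]; rewrite setCK.
Qed.

(** A characterization of [f_op] without windows, through which N is recognised as the lowered
    collection. *)
Lemma f_op_eq M N p : BZZ M -> BZZ N ->
  (forall k, ~ drops k p -> N k = M k) ->
  Theta N (kLambda p) = Theta M (kLambda p) - 1 -> f_op p M = N.
Proof.
move=> MZ NZ NM ThN; rewrite funeqE => k; rewrite /f_op /patch.
case: ifPn => [|/negP]; rewrite inE => kM; last first.
  by rewrite (BZ_indexed ((BZZP N).1 NZ).1).
have : f_adm p M k (pick_interval (f_adm p M k)).
  apply: xgetPex; have [C1 H1] := Intc_box_MZc_fin kM.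
  have [C2 H2] := stable_Intc (MZ_kLambda p) (Theta_stable MZ (MZ_kLambda p)).
  have [C3 H3] := stable_Intc (MZ_ksLambda p) (Theta_stable MZ (MZ_ksLambda p)).
  exists (box (C1 + C2 + C3).+1); split; [apply: H1|split;
    [apply: H2|apply: H3]]; lia.
by case=> kI [I1 I2]; apply: f_op_val.
Qed.

(** * Products of raising operators *)

(** At distance 3, no set in the formula for [eps q] has a drop at another r in Q, and exchanging q
    for q + 1 in a set leaves its drops at such r unchanged. For a residue class modulo l this is
    where l >= 3 enters. *)
Definition separated (Q : set int) : Prop :=
  forall r r', Q r -> Q r' -> r <> r' -> 3 <= `|r - r'|.

Lemma gap_agree_at M N p C j :
  M (ad (ad C p) (nxt p)) = N (ad (ad C p) (nxt p)) ->
  M (ad C j) = N (ad C j) -> M (ad C (nxt p)) = N (ad C (nxt p)) ->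
  M (ad (ad C (nxt p)) j) = N (ad (ad C (nxt p)) j) ->
  gap M p C j = gap N p C j.
Proof. by rewrite /gap => -> -> -> ->. Qed.

Section Squeeze.
Variables (Q : set int) (M N : collection) (p : int) (K : set int).
Hypothesis sQ : separated Q.
Hypothesis Qp : Q p.
Hypotheses (MZ : BZZ M) (NZ : BZZ N).
Hypothesis Th : Theta M (kLambda p) = Theta N (kLambda p).
Hypotheses (Kp : ~ K p) (Kq : ~ K (nxt p)) (KM : MZc K).
(** The induction hypothesis of [BZZ_agree]: agreement at all sets whose drops in Q are among those
    of K + p, with p itself excluded. *)
Hypothesis agree : forall k, ~ drops k p ->
  (forall r, Q r -> drops k r -> drops (ad K p) r) -> M k = N k.

(* K with everything between a and p filled in and everything between p + 1
   and b removed: moving K up in this order creates no new drop in Q. *)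
Let squeeze (a b : int) : set int :=
  [set z | z <= a /\ K z \/ a < z /\ z < p \/ b <= z /\ K z].

Lemma squeeze_agree (a b : int) k : a < p -> nxt p < b -> ~ drops k p ->
  (forall z : int, z < p - 1 -> (k z -> a < z \/ K z) /\ (K z ->
    k z) /\ (a < z -> k z)) ->
  (forall z : int, nxt p + 1 < z -> (k z -> K z /\ b <= z) /\ (K z -> b <= z ->
    k z)) ->
  M k = N k.
Proof.
move=> ap pb kp kl kr; apply: agree => // r Qr [kr0 kr1].
have [e|/eqP e] := eqVneq r p; first by subst r; case: kp.
have := sQ Qr Qp e; have [rp|pr] := ltP r p => r3.
  have [_ [h1 h2]] := kl (nxt r) ltac:(rewrite /nxt; lia).
  have [h3 _] := kl r ltac:(lia).
  have ra : ~ a < r by move=> ar; apply: kr1; apply: h2; rewrite /nxt; lia.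
  split; first by left; case: (h3 kr0).
  by rewrite /ad /= => -[/h1 //|]; rewrite /nxt; lia.
have [h1 h2] := kr r ltac:(rewrite /nxt; lia).
have [h3 h4] := kr (nxt r) ltac:(rewrite /nxt; lia).
have [Kr br] := h1 kr0.
split; first by left.
rewrite /ad /= => -[Kr1|]; last by rewrite /nxt; lia.
by apply: kr1; apply: h4 => //; rewrite /nxt; lia.
Qed.
Lemma squeeze_p (a b : int) : nxt p < b -> a < p -> ~ squeeze a b p.
Proof. by rewrite /squeeze /nxt /=; lia. Qed.

Lemma squeeze_q (a b : int) : nxt p < b -> a < p -> ~ squeeze a b (nxt p).
Proof. by rewrite /squeeze /nxt /=; lia. Qed.

Ltac squeeze_agree_tac ap pb a b :=
  apply: (@squeeze_agree a b); rewrite /drops /squeeze /ad /nxt /=; try lia;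
  first [
    let h1 := fresh "h" in let h2 := fresh "h" in intros [h1 h2];
    first [apply h2; by intuition | clear h2; intuition lia]
  | let z := fresh "z" in let zp := fresh "zp" in intros z zp;
    case: (pselect (K z)) => [/propT ->|/propF ->]; clear -zp ap pb; lia].

Lemma squeeze_MZc a b : MZc (squeeze a b).
Proof.
have [B HB] := (MZcP K).1 KM; apply/MZcP.
exists (`|B| + `|a| + `|b| + `|p|) => z; have [h1 h2] := HB z.
rewrite /squeeze /=; split=> zB; last by right; right; split; [lia|apply: h2;
  lia].
by case=> [[_ /h1]|[|[_ /h1]]]; apply || lia; lia.
Qed.

Lemma squeeze_right (a b : int) : a < p -> nxt p < b ->
  slope M p (squeeze a (b + 1)) = slope N p (squeeze a (b + 1)) ->
  slope M p (squeeze a b) = slope N p (squeeze a b).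
Proof.
move=> ap pb H; have [Kb|Kb] := pselect (K b); last first.
  suff -> : squeeze a b = squeeze a (b + 1) by [].
  rewrite predeqE => z; rewrite /squeeze /=.
  have [->|/eqP zb] := eqVneq z b; first by intuition lia.
  by have [Kz|Kz] := pselect (K z); rewrite ?(propT Kz) ?(propF Kz); lia.
have pb1 : nxt p < b + 1 by rewrite /nxt in pb *; lia.
have E : squeeze a b = ad (squeeze a (b + 1)) b.
  rewrite predeqE => z; rewrite /squeeze /ad /=.
  have [->|/eqP zb] := eqVneq z b; first by intuition lia.
  by have [Kz|Kz] := pselect (K z); rewrite ?(propT Kz) ?(propF Kz); lia.
have Sp := squeeze_p pb1 ap; have Sq := squeeze_q pb1 ap.
have Sb : ~ squeeze a (b + 1) b by rewrite /squeeze /=; rewrite /nxt in pb;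
  intuition lia.
have FS : MZc (ad (ad (ad (squeeze a (b + 1)) p) (nxt p)) b).
  by rewrite !MZc_ad; apply: squeeze_MZc.
rewrite E !(slope_right _ Sp Sq pb Sb FS) ?H //; first last.
- exact: BZ_plucker ((BZZP M).1 MZ).1.
- exact: BZ_plucker ((BZZP N).1 NZ).1.
congr Num.min; apply: gap_agree_at.
- rewrite /nxt in pb; squeeze_agree_tac ap pb a (b + 1).
- rewrite -E; rewrite /nxt in pb; squeeze_agree_tac ap pb a b.
- rewrite /nxt in pb; squeeze_agree_tac ap pb a (b + 1).
- rewrite adC -E; rewrite /nxt in pb; squeeze_agree_tac ap pb a b.
Qed.

Lemma squeeze_left (a b : int) : a < p -> nxt p < b ->
  slope M p (squeeze (a - 1) b) = slope N p (squeeze (a - 1) b) ->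
  slope M p (squeeze a b) = slope N p (squeeze a b).
Proof.
move=> ap pb H; have [Ka|Ka] := pselect (K a).
  suff -> : squeeze a b = squeeze (a - 1) b by [].
  rewrite predeqE => z; rewrite /squeeze /=; have [->|/eqP za] := eqVneq z a.
    by rewrite (propT Ka); clear -ap; lia.
  by have [/propT ->|/propF ->] := pselect (K z); clear -ap za; lia.
have ap1 : a - 1 < p by lia.
have E : squeeze (a - 1) b = ad (squeeze a b) a.
  rewrite predeqE => z; rewrite /squeeze /ad /=.
  have [->|/eqP za] := eqVneq z a.
    by rewrite (propF Ka); clear -ap; lia.
  by have [/propT ->|/propF ->] := pselect (K z); clear -ap za; lia.
have Sp := squeeze_p pb ap; have Sq := squeeze_q pb ap.
have Sa : ~ squeeze a b a.
  by rewrite /squeeze /= (propF Ka); clear; lia.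
have FS : MZc (ad (ad (ad (squeeze a b) a) p) (nxt p)).
  by rewrite !MZc_ad; apply: squeeze_MZc.
rewrite !(slope_left _ Sp Sq ap Sa FS) -?E ?H //; first last.
- exact: BZ_plucker ((BZZP M).1 MZ).1.
- exact: BZ_plucker ((BZZP N).1 NZ).1.
congr Num.min; apply: gap_agree_at.
- rewrite /nxt in pb; squeeze_agree_tac ap pb a b.
- rewrite -E; rewrite /nxt in pb; squeeze_agree_tac ap1 pb (a - 1) b.
- rewrite /nxt in pb; squeeze_agree_tac ap pb a b.
- rewrite adC -E; rewrite /nxt in pb; squeeze_agree_tac ap1 pb (a - 1) b.
Qed.

Lemma squeeze_loop (a b : int) (m n : nat) : a < p -> nxt p < b ->
  slope M p (squeeze (a - m%:Z) (b + n%:Z)) =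
  slope N p (squeeze (a - m%:Z) (b + n%:Z)) ->
  slope M p (squeeze a b) = slope N p (squeeze a b).
Proof.
move=> ap pb; elim: n => [|n IHn]; last first.
  rewrite -[n.+1]addn1 PoszD addrA => H; apply: IHn; apply: squeeze_right => //.
    by lia.
  by rewrite /nxt in pb *; lia.
rewrite addr0; elim: m => [|m IHm]; first by rewrite subr0.
rewrite -[m.+1]addn1 PoszD opprD addrA => H; apply: IHm.
by apply: squeeze_left => //; lia.
Qed.

Lemma agree_at : M (ad K p) = N (ad K p).
Proof.
have sd n m : M (cut n m (ksLambda p)) = N (cut n m (ksLambda p)).
  apply: agree => [|r Qr] h; have := drops_ksLambda (drops_cut h); first lia.
  have [->|/eqP rp] := eqVneq r p; first by lia.
  by have := sQ Qr Qp rp; lia.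
suff : slope M p K = slope N p K.
  rewrite /slope (agree (k := ad K (nxt p))); first by lia.
    by rewrite /drops /ad /nxt /=; intuition lia.
  move=> r Qr [kr kr1]; have [e|/eqP rp] := eqVneq r p.
    by exfalso; subst r; apply: kr1; right.
  have r3 := sQ Qr Qp rp; split.
    by case: kr => [|e]; [left|exfalso; rewrite /nxt in e; lia].
  by case=> [Kr|e]; [apply: kr1; left|rewrite /nxt in e; lia].
have EK : K = squeeze (p - 1) (nxt p + 1).
  rewrite predeqE => z; rewrite /squeeze /nxt /=.
  have zp : z = p -> ~ K z by move=> ->.
  have zq : z = p + 1 -> ~ K z by move=> ->.
  have [Kz|/propF ->] := pselect (K z); last by clear; lia.
  have {}zp : z <> p by move/zp.
  have {}zq : z <> p + 1 by move/zq.
  by rewrite (propT Kz); clear -zp zq; lia.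
have [B HB] := (MZcP K).1 KM.
have [B1 H1] := Theta_stable MZ (MZ_kLambda p).
have [B2 H2] := Theta_stable NZ (MZ_kLambda p).
pose C := (`|B| + `|B1| + `|B2| + `|p| + 3)%N.
have CE : C = (`|B| + `|B1| + `|B2| + `|p| + 3)%N by [].
(* After C steps on each side K is empty to the left and full to the right, so the squeezed set is a
   cut of [kLambda (p - 1)] and both slopes are read off from [Theta]. *)
rewrite EK; apply: (@squeeze_loop _ _ C C); [lia|rewrite /nxt; lia|].
have -> : squeeze (p - 1 - C%:Z) (nxt p + 1 + C%:Z) =
    cut (p - 1 - C%:Z) (nxt p + C%:Z) (kLambda (p - 1)).
  rewrite predeqE => z; rewrite /squeeze /cut /kLambda /nxt /=.
  have [h1 h2] := HB z; have [Kz|Kz] := pselect (K z).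
    have zB : ~ z < - B by move/h1.
    by rewrite (propT Kz); clear -zB CE; clearbody C; lia.
  have zB : ~ B < z by move/h2.
  by rewrite (propF Kz); clear -zB CE; clearbody C; lia.
rewrite !slope_cut_kLambda ?sd ?H1 ?H2 ?Th //; rewrite /nxt; clearbody C; lia.
Qed.

End Squeeze.

(* Induction on the set of drops of k in Q: moving k up towards Z_(< r) removes
   the drop at r without creating another one (squeeze). *)
Lemma BZZ_agree (Q D : set int) M N k : separated Q -> D `<=` Q ->
  BZZ M -> BZZ N ->
  (forall r, D r -> Theta M (kLambda r) = Theta N (kLambda r)) ->
  (forall k, (forall r, Q r -> ~ drops k r) -> M k = N k) ->
  (forall r, Q r -> drops k r -> D r) -> M k = N k.
Proof.
move=> sQ DQ MZ NZ Th agree kD.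
have out k' : ~ MZc k' -> M k' = N k'.
  move=> nk; rewrite (BZ_indexed ((BZZP M).1 MZ).1) //.
  by rewrite (BZ_indexed ((BZZP N).1 NZ).1).
have [kM|] := pselect (MZc k); last exact: out.
have [u ku] : exists u : seq int, forall r, Q r -> drops k r -> r \in u.
  have [B HB] := (MZcP k).1 kM; exists (box_seq `|B|.+1) => r _ [kr kr1].
  rewrite mem_box_seq; have [h1 h2] := HB r; have [h3 h4] := HB (nxt r).
  have a1 : ~ r < - B by move/h1.
  have a2 : ~ B < nxt r by move/h4.
  by rewrite /nxt in a2; clear -a1 a2; lia.
elim: u k kM kD ku => [|q u IH] k kM kD ku.
  by apply: agree => r Qr /(ku r Qr).
have [[Qq kq]|nq] := pselect (Q q /\ drops k q); last first.
  apply: IH => // r Qr kr; have := ku r Qr kr; rewrite inE => /orP[/eqP e|//].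
  by subst r; case: nq.
have [K [Kp Kq Ek]] := drops_ad kq; subst k.
apply: (agree_at sQ Qq MZ NZ _ Kp Kq) => [||k' kq' H].
- exact: Th (kD _ Qq kq).
- by rewrite MZc_ad in kM.
have [k'M|] := pselect (MZc k'); last exact: out.
apply: IH => // r Qr kr; first exact: kD Qr (H r Qr kr).
have := ku r Qr (H r Qr kr); rewrite inE => /orP[/eqP e|//].
by subst r.
Qed.

Lemma Theta_agree M N k : BZZ M -> BZZ N -> MZ k ->
  (forall n m, M (cut n m k) = N (cut n m k)) -> Theta M k = Theta N k.
Proof.
move=> MZ' NZ kM H; apply: ThetaE => //; have [B HB] := Theta_stable NZ kM.
by exists B => n m nB Bm; rewrite H HB.
Qed.

Lemma Theta_no_drop (Q : set int) M N k : BZZ M -> BZZ N -> MZ k ->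
  (forall k, (forall r, Q r -> ~ drops k r) -> N k = M k) ->
  (forall r, Q r -> ~ drops k r) -> Theta N k = Theta M k.
Proof.
move=> MZ' NZ kM H kQ; apply: Theta_agree => // n m; apply: H => r Qr h.
by apply: (kQ r Qr); apply: drops_cut h.
Qed.

(* N is the result of applying to M all the operators e_r with r in A; the set
   A may be infinite. *)
Record raises (A : set int) (M N : collection) : Prop := Raises {
  raises_BZZ : BZZ N;
  raises_agree : forall k, (forall r, A r -> ~ drops k r) -> N k = M k;
  raises_Theta : forall r, A r ->
    Theta N (kLambda r) = Theta M (kLambda r) + 1 }.

(** By separation, raising at the other elements of u changes none of the four values in [eps q], so
    it is still positive when the turn of q comes. *)
Lemma raises_seq (Q : set int) M (u : seq int) : separated Q -> BZZ M ->
  (forall r, Q r -> 0 < eps r M) -> uniq u -> (forall r, r \in u -> Q r) ->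
  exists N, raises [set` u] M N.
Proof.
move=> sQ MZ' eM; elim: u => [_ _|q u IH /= /andP[qu uu] uQ].
  by exists M; split.
have [|N [NZ NM NT]] := IH uu; first by move=> r ru; apply: uQ;
  rewrite inE ru orbT.
have Qq : Q q by apply: uQ; rewrite inE eqxx.
have far r : r \in u -> 3 <= `|r - q|.
  move=> ru; apply: sQ => //; first by apply: uQ; rewrite inE ru orbT.
  by move=> e; move: qu; rewrite -e ru.
have T1 p : (forall r, r \in u -> r <> p) ->
    Theta N (kLambda p) = Theta M (kLambda p).
  move=> up; apply: (Theta_no_drop MZ' NZ (MZ_kLambda p) NM) => r /= ru h.
  exact: up ru (drops_kLambda h).
have T2 : Theta N (ksLambda q) = Theta M (ksLambda q).
  apply: (Theta_no_drop MZ' NZ (MZ_ksLambda q) NM) => r /= ru h.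
  by have := far _ ru; have := drops_ksLambda h; lia.
have eN : 0 < eps q N.
  rewrite /eps T2 !T1; first exact: eM.
  - by move=> r /far; lia.
  - by move=> r /far; lia.
  by move=> r /far; lia.
have [N' [NZ' NM' NT']] := BZZ_raise NZ eN.
exists N'; split=> // [k kA|r /=].
  rewrite NM'; last by apply: kA; rewrite /= inE eqxx.
  by apply: NM => r ru; apply: kA; rewrite /= inE; apply/orP; right.
rewrite inE => /orP[/eqP ->|ru].
  by rewrite NT' T1 // => r' /far; lia.
rewrite -(NT r ru); apply: (@Theta_no_drop [set q]) => //.
- exact: MZ_kLambda.
- by move=> k kq; apply: NM'; apply: kq.
by move=> r' /= -> h; have := drops_kLambda h; have := far r ru; lia.
Qed.

Lemma drops_bounded k : MZ k \/ MZc k ->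
  exists B : nat, forall r, drops k r -> (`|r| <= B)%N.
Proof.
case=> [/MZP|/MZcP] [B HB]; exists `|B|.+1 => r [kr kr1].
  have h1 : ~ nxt r < - B by move/(HB _).1.
  have h2 : ~ B < r by move/(HB _).2.
  by rewrite /nxt in h1; clear -h1 h2; lia.
have h1 : ~ r < - B by move/(HB _).1.
have h2 : ~ B < nxt r by move/(HB _).2.
by rewrite /nxt in h2; clear -h1 h2; lia.
Qed.

(** A component at k depends only on the finitely many drops of k in A, so the finite products over
    the part of A in [- B, B] become constant in B at each k ([BZZ_agree]). Every relation for the
    limit is one for a single large B. *)
Lemma raises_set (Q A : set int) M : separated Q -> BZZ M ->
  (forall r, Q r -> 0 < eps r M) -> A `<=` Q -> exists N, raises A M N.
Proof.
move=> sQ MZ' eM AQ.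
pose u B := [seq r <- undup (box_seq B) | `[< A r >]].
have uE B r : r \in u B <-> A r /\ (`|r| <= B)%N.
  rewrite mem_filter mem_undup mem_box_seq; split.
    by move=> /andP[/asboolP].
  by move=> [/asboolP -> ->].
have /choice[N HN] B : exists N, raises [set` u B] M N.
  apply: (raises_seq sQ MZ' eM); first by rewrite filter_uniq ?undup_uniq.
  by move=> r /uE[/AQ].
have NE B B' k : (B <= B')%N ->
    (forall r, A r -> drops k r -> (`|r| <= B)%N) -> N B' k = N B k.
  move=> BB' kB; apply: (@BZZ_agree [set` u B'] [set` u B]).
  - by move=> r r' /uE[/AQ Qr _] /uE[/AQ Qr' _]; apply: sQ.
  - by move=> r /uE[Ar rB]; apply/uE; split=> //; apply: leq_trans BB'.
  - exact: raises_BZZ (HN B').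
  - exact: raises_BZZ (HN B).
  - move=> r /= rB; rewrite (raises_Theta (HN B)) // (raises_Theta (HN B')) //.
    by move: rB => /uE[Ar rB]; apply/uE; split=> //; apply: leq_trans BB'.
  - move=> k' kn; rewrite (raises_agree (HN B')) // (raises_agree (HN B)) //.
    move=> r /uE[Ar rB]; apply: kn; apply/uE; split=> //.
    exact: leq_trans BB'.
  by move=> r /uE[Ar _] kr; apply/uE; split=> //; apply: kB.
pose L k := evl 0 (fun B => N B k).
have LE B k : (forall r, A r -> drops k r -> (`|r| <= B)%N) -> L k = N B k.
  by move=> kB; apply: (@evlE _ _ _ B) => m Bm; apply: NE.
have LE' k : MZc k -> exists B, forall B', (B <= B')%N -> L k = N B' k.
  move=> kM; have [B HB] := drops_bounded (or_intror kM); exists B => B' BB'.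
  by apply: LE => r _ /HB h; apply: leq_trans BB'.
(* Cutting creates no drop, so one B serves all windows of k at once; this is what makes the limit
   stable. *)
have Lcut k B n m : (forall r, drops k r -> (`|r| <= B)%N) ->
    L (cut n m k) = N B (cut n m k).
  by move=> kB; apply: LE => r _ h; apply: kB; apply: drops_cut h.
have NB B : BZdata (N B) := ((BZZP _).1 (raises_BZZ (HN B))).1.
have LZ : BZZ L.
  apply/BZZP; split; first split.
  - move=> k nk; apply: (@evlE _ _ _ 0%N) => m _; exact: (BZ_indexed (NB m)).
  - move=> k i j ij ki kj FK; have := FK; rewrite !MZc_ad => kM.
    have [B1 H1] := LE' (ad k i) ltac:(by rewrite MZc_ad).
    have [B2 H2] := LE' (ad k j) ltac:(by rewrite MZc_ad).
    have [B3 H3] := LE' _ FK; have [B4 H4] := LE' _ kM.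
    pose B := (B1 + B2 + B3 + B4)%N.
    rewrite (H1 B) ?(H2 B) ?(H3 B) ?(H4 B); try by rewrite /B; lia.
    exact: (BZ_super (NB B)).
  - move=> k i j h ij jh ki kj kh FK; have := FK; rewrite !MZc_ad => kM.
    have [B1 H1] := LE' (ad k i) ltac:(by rewrite MZc_ad).
    have [B2 H2] := LE' (ad k j) ltac:(by rewrite MZc_ad).
    have [B3 H3] := LE' (ad k h) ltac:(by rewrite MZc_ad).
    have [B4 H4] := LE' (ad (ad k i) h) ltac:(by rewrite !MZc_ad).
    have [B5 H5] := LE' (ad (ad k i) j) ltac:(by rewrite !MZc_ad).
    have [B6 H6] := LE' (ad (ad k j) h) ltac:(by rewrite !MZc_ad).
    pose B := (B1 + B2 + B3 + B4 + B5 + B6)%N.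
    rewrite (H1 B) ?(H2 B) ?(H3 B) ?(H4 B) ?(H5 B) ?(H6 B);
      try by rewrite /B; lia.
    exact: (BZ_plucker (NB B)).
  - by move=> a; apply: (@evlE _ _ _ 0%N) => m _; exact: (BZ_norm (NB m)).
  move=> k kM; have [B HB] := drops_bounded (or_introl kM).
  have [v [C HC]] := ((BZZP _).1 (raises_BZZ (HN B))).2 k kM.
  by exists v, C => n m nC Cm; rewrite (Lcut _ B) // HC.
exists L; split=> // [k kA|r Ar].
  apply: (@evlE _ _ _ 0%N) => m _; apply: (raises_agree (HN m)).
  by move=> r /uE[Ar _]; apply: kA.
have ru : [set` u `|r|%N] r by apply/uE.
rewrite -(raises_Theta (HN _) ru); apply: Theta_agree => //.
- exact: raises_BZZ (HN _).
- exact: MZ_kLambda.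
by move=> n m; apply: Lcut => r' h; rewrite (drops_kLambda h).
Qed.

(** * Translation by l *)

Lemma sigma_ad l k a :
  sigma_pt l @^-1` (ad k a) = ad (sigma_pt l @^-1` k) (a - l%:Z).
Proof.
rewrite predeqE => z; rewrite /ad /preimage /sigma_pt /=.
by have -> : (z + l%:Z = a) = (z = a - l%:Z) by apply/propext; split; lia.
Qed.

Lemma sigma_MZc l k : MZc (sigma_pt l @^-1` k) = MZc k.
Proof.
apply/propext; rewrite !MZcP; split=> -[B HB]; exists (`|B| + l%:Z) => z.
  have [h1 h2] := HB (z - l%:Z); rewrite /preimage /sigma_pt /= subrK in h1 h2.
  by split=> zB; [apply: h1|apply: h2]; lia.
have [h1 h2] := HB (z + l%:Z); rewrite /preimage /sigma_pt /=.
by split=> zB; [apply: h1|apply: h2]; lia.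
Qed.

Lemma sigma_MZ l k : MZ (sigma_pt l @^-1` k) = MZ k.
Proof.
apply/propext; rewrite !MZP; split=> -[B HB]; exists (`|B| + l%:Z) => z.
  have [h1 h2] := HB (z - l%:Z); rewrite /preimage /sigma_pt /= subrK in h1 h2.
  by split=> zB; [apply: h1|apply: h2]; lia.
have [h1 h2] := HB (z + l%:Z); rewrite /preimage /sigma_pt /=.
by split=> zB; [apply: h1|apply: h2]; lia.
Qed.

Lemma sigma_cut l (n m : int) k : sigma_pt l @^-1` (cut n m k) =
  cut (n - l%:Z) (m - l%:Z) (sigma_pt l @^-1` k).
Proof.
rewrite predeqE => z; rewrite /cut /preimage /sigma_pt /=.
have -> : (n < z + l%:Z) = (n - l%:Z < z) by lia.
have -> : (z + l%:Z <= m) = (z <= m - l%:Z) by lia.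
by have -> : (m < z + l%:Z) = (m - l%:Z < z) by lia.
Qed.

Lemma sigma_drops l k r : drops (sigma_pt l @^-1` k) r = drops k (r + l%:Z).
Proof.
rewrite /drops /preimage /sigma_pt /nxt /=.
by have -> : r + 1 + l%:Z = r + l%:Z + 1 by lia.
Qed.

Lemma sigma_kLambda l r : sigma_pt l @^-1` kLambda r = kLambda (r - l%:Z).
Proof.
by rewrite predeqE => z; rewrite /kLambda /preimage /sigma_pt /=; lia.
Qed.

Lemma sigma_stable l M k v : stable M (sigma_pt l @^-1` k) v ->
  stable (sigma l M) k v.
Proof.
move=> [B HB]; exists (`|B| + l%:Z) => n m nB Bm.
by rewrite /sigma sigma_cut HB //; lia.
Qed.

Lemma BZZ_sigma_closed l M : BZZ M -> BZZ (sigma l M).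
Proof.
move=> /BZZP[MB MS]; apply/BZZP; split; first split.
- by move=> k; rewrite /sigma -(sigma_MZc l) => /(BZ_indexed MB).
- move=> k i j ij ki kj; rewrite -(sigma_MZc l) /sigma !sigma_ad => FK.
  apply: (BZ_super MB) => //; first by lia.
    by rewrite /preimage /sigma_pt /= subrK.
  by rewrite /preimage /sigma_pt /= subrK.
- move=> k i j h ij jh ki kj kh; rewrite -(sigma_MZc l) /sigma !sigma_ad => FK.
  apply: (BZ_plucker MB) => //; try (by lia);
  by rewrite /preimage /sigma_pt /= subrK.
- move=> a; rewrite -(BZ_norm MB (a - l%:Z)) /sigma; congr M.
  by rewrite predeqE => z; rewrite /preimage /sigma_pt /=; lia.
move=> k kM; have [|v Hv] := MS (sigma_pt l @^-1` k); first by rewrite sigma_MZ.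
by exists v; apply: sigma_stable.
Qed.

Lemma Theta_sigma l M k : BZZ M -> MZ k ->
  Theta (sigma l M) k = Theta M (sigma_pt l @^-1` k).
Proof.
move=> MZ' kM; apply: ThetaE => //; first exact: BZZ_sigma_closed.
by apply: sigma_stable; apply: Theta_stable => //; rewrite sigma_MZ.
Qed.

(** * Edges of the crystal graph *)

Definition residue_class (l p : nat) : set int :=
  [set q | exists z : int, q = p%:Z + l%:Z * z].

Lemma residue_separated (l p : nat) : (3 <= l)%N ->
  separated (residue_class l p).
Proof.
move=> l3 _ _ [z ->] [z' ->] ne.
have zz : z <> z' by move=> e; apply: ne; rewrite e.
have -> : p%:Z + l%:Z * z - (p%:Z + l%:Z * z') = l%:Z * (z - z') by lia.
by rewrite normrM -[3]mulr1; apply: ler_pM; lia.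
Qed.

Lemma Theta_period l M r : BZZ M -> sigma l M = M ->
  Theta M (kLambda (r - l%:Z)) = Theta M (kLambda r).
Proof.
by move=> MZ' sM; rewrite -{2}sM Theta_sigma ?sigma_kLambda //;
  apply: MZ_kLambda.
Qed.

Lemma sigma_ksLambda l r : sigma_pt l @^-1` ksLambda r = ksLambda (r - l%:Z).
Proof.
rewrite predeqE => z; rewrite /ksLambda /preimage /sigma_pt /setU /=.
by have -> : (z + l%:Z = r + 1) = (z = r - l%:Z + 1);
  [apply/propext; lia|have ->
    : (z + l%:Z <= r - 1) = (z <= r - l%:Z - 1) by lia].
Qed.

Lemma eps_period l M r : BZZ M -> sigma l M = M ->
  eps (r - l%:Z) M = eps r M.
Proof.
move=> MZ' sM; rewrite /eps -sigma_ksLambda -Theta_sigma ?sM //;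
  last exact: MZ_ksLambda.
have -> : r - l%:Z + 1 = r + 1 - l%:Z by lia.
have -> : r - l%:Z - 1 = r - 1 - l%:Z by lia.
by rewrite !(Theta_period _ MZ' sM).
Qed.

Lemma eps_residue l M p q : BZZ M -> sigma l M = M -> residue_class l p q ->
  eps q M = eps p%:Z M.
Proof.
move=> MZ' sM [z ->].
have H (n : nat) r : eps (r + l%:Z * n%:Z) M = eps r M.
  elim: n => [|n IH]; first by rewrite mulr0 addr0.
  rewrite -IH -(eps_period (r + l%:Z * n.+1%:Z) MZ' sM); congr (eps _ M); lia.
case: (intP z) => [|n|n]; first exact: (H 0%N).
  exact: H.
by rewrite -(H n.+1 (p%:Z + _)); congr (eps _ M); lia.
Qed.

Section Lowering.
Variables (l : nat) (p : 'I_l) (M : collection).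
Hypothesis l3 : (3 <= l)%N.
Hypotheses (MZ' : BZZ M) (sM : sigma l M = M) (eM : 0 < eps_hat p M).

Let Q := residue_class l p.

(** Write [N A] for M raised along A. By uniqueness [f_op q] sends [N A] to the collection for A
    without q. At a given k the product over [Lset k p] therefore leaves M raised at indices where k
    has no drop, and its k-component is that of M. *)
Lemma f_hat_raises : exists N, raises Q M N /\ f_hat p N = Some M.
Proof.
have sQ : separated Q by apply: residue_separated.
have eQ r : Q r -> 0 < eps r M by move=> Qr; rewrite (eps_residue MZ' sM Qr).
have /choice[N HN] A : exists N, A `<=` Q -> raises A M N.
  have [AQ|nAQ] := pselect (A `<=` Q); last by exists M.
  by have [N HN] := raises_set sQ MZ' eQ AQ; exists N.
have f_one A q : A `<=` Q -> A q -> f_op q (N A) = N (A `\ q).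
  move=> AQ Aq; have AQ' : A `\ q `<=` Q by move=> r [/AQ].
  have R := HN A AQ; have R' := HN _ AQ'.
  apply: f_op_eq (raises_BZZ R) (raises_BZZ R') _ _ => [k kq|].
    apply: (@BZZ_agree A (A `\ q)).
    - by move=> r r' /AQ Qr /AQ; apply: sQ.
    - by move=> r [].
    - exact: raises_BZZ R'.
    - exact: raises_BZZ R.
    - by move=> r Ar; rewrite (raises_Theta R') // (raises_Theta R) //;
      case: Ar.
    - move=> k' kA; rewrite (raises_agree R) // (raises_agree R') //.
      by move=> r [/kA].
    by move=> r Ar kr; split=> // e; apply: kq; rewrite -e.
  rewrite (raises_Theta R Aq) addrK.
  apply: (Theta_no_drop MZ' (raises_BZZ R') (MZ_kLambda q) (raises_agree R')).
  by move=> r [_ rq] h; apply: rq; exact: drops_kLambda h.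
have f_all s A : A `<=` Q -> uniq s -> [set` s] `<=` A ->
    f_prod s (N A) = N (A `\` [set` s]).
  move=> AQ; elim: s => [|q s IH] /=.
    by move=> _ _; congr N; rewrite predeqE => z; rewrite /setD /=;
      split=> [|[]].
  move=> /andP[qs us] sA; rewrite IH //; last first.
    by move=> r rs; apply: sA; rewrite /= inE; apply/orP; right.
  rewrite f_one.
  - congr N; rewrite predeqE => z; rewrite /setD /= inE.
    by case: eqP => [->|zq] /=; split; intuition.
  - by move=> r [/AQ].
  by split; [apply: sA; rewrite /= inE eqxx|move: qs => /negP].
exists (N Q); split; first exact: HN.
rewrite /f_hat; congr Some; rewrite funeqE => k; rewrite /patch.
case: ifPn => [|/negP]; rewrite inE => kM; last first.
  by rewrite (BZ_indexed ((BZZP M).1 MZ').1).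
have fL : finite_set (Lset k p).
  have [B HB] := drops_bounded (or_intror kM).
  apply: sub_finite_set (finite_int_itv (- B%:Z) B%:Z) => q [_ k1 k2] /=.
  by have := HB q (conj k1 k2); lia.
set s := enum_fset _.
have ms r : r \in s <-> Lset k p r.
  by rewrite /s; rewrite (in_fset_set fL); split; [rewrite inE|move=> ?;
    rewrite inE].
rewrite f_all //; first last.
- by move=> r /ms[[z ->] _ _]; exists z.
- exact: fset_uniq.
have R := HN (Q `\` [set` s]) ltac:(by move=> r []).
rewrite (raises_agree R) // => r [[z rz] rs] [k1 k2]; apply: rs.
by apply/ms; split=> //; exists z.
Qed.

End Lowering.

(** * The highest weight element *)

Section Supermodular.
Variables (F : set (set int)) (M : collection).
Hypothesis FE : forall k a, F (ad k a) = F k.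
Hypothesis M1 : supermodular F M.

Lemma foldl_adE C s z : foldl ad C s z <-> C z \/ z \in s.
Proof.
elim: s C => [|j s IH] C /=; first by rewrite in_nil; intuition.
rewrite IH inE /ad /=; split.
  by case=> [[|->]|zs]; [left|right; rewrite eqxx|right; rewrite zs orbT].
by case=> [|/orP[/eqP|]]; [left; left|left; right|right].
Qed.

Lemma supermodular_ad C i s : F C -> ~ C i -> i \notin s -> uniq s ->
  (forall j, j \in s -> ~ C j) ->
  M (ad C i) + M (foldl ad C s) <= M (foldl ad (ad C i) s) + M C.
Proof.
elim: s C => [|j s IH] C FC Ci /=; first by rewrite addrC.
rewrite inE negb_or => /andP[/eqP ij is_] /andP[js us] Cs.
have Cj : ~ C j by apply: Cs; rewrite inE eqxx.
have h1 := M1 ij Ci Cj; rewrite !FE in h1; have {}h1 := h1 FC.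
have FCj : F (ad C j) by rewrite FE.
have Cij : ~ ad C j i by case.
have {}IH := IH _ FCj Cij is_ us.
have : forall j0, j0 \in s -> ~ ad C j j0.
  move=> r rs [/Cs|e]; first by apply; rewrite inE rs orbT.
  by move: js; rewrite -e rs.
move=> /IH; rewrite (adC C j i); move: h1.
move: (M _) (M _) (M _) (M _) (M _) (M _) => *; lia.
Qed.

Lemma supermodular_foldl C t s : F C -> uniq (t ++ s) ->
  (forall j, j \in t ++ s -> ~ C j) ->
  M (foldl ad C t) + M (foldl ad C s) <=
  M (foldl ad (foldl ad C t) s) + M C.
Proof.
elim: t C => [|i t IH] C FC /=; first by rewrite addrC.
move=> /andP[its uts] Cts.
have Ci : ~ C i by apply: Cts; rewrite inE eqxx.
have is_ : i \notin s by move: its; rewrite mem_cat negb_or => /andP[].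
have us : uniq s by move: uts; rewrite cat_uniq => /and3P[].
have Cs j : j \in s -> ~ C j.
  by move=> js; apply: Cts; rewrite inE mem_cat js !orbT.
have h1 := supermodular_ad FC Ci is_ us Cs.
have FCi : F (ad C i) by rewrite FE.
have : forall j, j \in t ++ s -> ~ ad C i j.
  move=> j js [Cj|e]; first by apply: (Cts j) Cj; rewrite inE js orbT.
  by move: its; rewrite -e js.
move=> /(IH _ FCi uts); move: h1.
move: (M _) (M _) (M _) (M _) (M _) => *; lia.
Qed.

Lemma finite_ad C S : C `<=` S -> finite_set (S `\` C) ->
  exists s, [/\ uniq s, S = foldl ad C s & forall j, j \in s <-> (S `\` C) j].
Proof.
move=> CS fS; exists (enum_fset (fset_set (S `\` C))).
have ms j : j \in enum_fset (fset_set (S `\` C)) <-> (S `\` C) j.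
  by rewrite (in_fset_set fS); split; [rewrite inE|move=> ?; rewrite inE].
split=> //; first exact: fset_uniq.
rewrite predeqE => z; rewrite foldl_adE; split=> [Sz|].
  by have [Cz|nC] := pselect (C z); [left|right; apply/ms].
by case=> [/CS|/ms[]].
Qed.

(** The relation for two elements is summed while the finite differences are adjoined to the
    intersection one element at a time. *)
Lemma supermodular_set S T : F (S `&` T) -> finite_set (S `\` T) ->
  finite_set (T `\` S) -> M S + M T <= M (S `|` T) + M (S `&` T).
Proof.
move=> FST fS fT.
have ES : S `\` (S `&` T) = S `\` T.
  by rewrite predeqE => z; rewrite /setD /setI /=; intuition.
have ET : T `\` (S `&` T) = T `\` S.
  by rewrite predeqE => z; rewrite /setD /setI /=; intuition.
have fS' : finite_set (S `\` (S `&` T)) by rewrite ES.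
have fT' : finite_set (T `\` (S `&` T)) by rewrite ET.
have sS : S `&` T `<=` S by move=> z [].
have sT : S `&` T `<=` T by move=> z [].
have [u [uu Eu mu]] := finite_ad sS fS'.
have [v [uv Ev mv]] := finite_ad sT fT'.
have EU : S `|` T = foldl ad (foldl ad (S `&` T) u) v.
  rewrite predeqE => z; rewrite !foldl_adE mu mv ES ET /setU /setI /setD /=.
  by have [Sz|Sz] := pselect (S z); have [Tz|Tz] := pselect (T z); intuition.
rewrite EU {1}Eu {2}Ev; apply: supermodular_foldl => //.
  rewrite cat_uniq uu uv andbT /=; apply/hasPn => z /mv[Tz nz].
  by apply/negP => /mu[Sz _]; apply: nz.
by move=> j; rewrite mem_cat => /orP[/mu[]|/mv[]].
Qed.

End Supermodular.

Lemma finite_setD_MZc S T : MZc S -> MZc T -> finite_set (S `\` T).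
Proof.
move=> /MZcP[B HB] /MZcP[C HC].
apply: sub_finite_set (finite_int_itv (- `|B|) `|C|) => z [Sz Tz] /=.
have h1 : ~ z < - B by move/(HB z).1.
have h2 : ~ C < z by move/(HC z).2.
by clear -h1 h2; lia.
Qed.

Lemma finite_setD_MZ S T : MZ S -> MZ T -> finite_set (S `\` T).
Proof.
move=> /MZP[B HB] /MZP[C HC].
apply: sub_finite_set (finite_int_itv (- `|C|) `|B|) => z [Sz Tz] /=.
have h1 : ~ z < - C by move/(HC z).1.
have h2 : ~ B < z by move/(HB z).2.
by clear -h1 h2; lia.
Qed.

Lemma MZc_setI S T : MZc S -> MZc T -> MZc (S `&` T).
Proof.
move=> /MZcP[B HB] /MZcP[C HC]; apply/MZcP; exists (`|B| + `|C|) => z.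
have [h1 h2] := HB z; have [h3 h4] := HC z; rewrite /setI /=; split=> zB.
  by case=> Sz _; apply: h1 => //; lia.
by split; [apply: h2|apply: h4]; lia.
Qed.

Lemma MZc_gt a : MZc [set z | a < z].
Proof. by apply/MZcP; exists `|a| => z /=; lia. Qed.

Lemma BZ_superset M S T : BZdata M -> MZc S -> MZc T ->
  M S + M T <= M (S `|` T) + M (S `&` T).
Proof.
move=> MB SM TM; apply: (supermodular_set MZc_ad (BZ_super MB)).
- exact: MZc_setI.
- exact: finite_setD_MZc.
- exact: finite_setD_MZc.
Qed.

(* Removing the least element of k cannot decrease the component. *)
Lemma BZ_le0 M k : BZdata M -> MZc k -> M k <= 0.
Proof.
move=> MB kM; have [B HB] := (MZcP k).1 kM; pose N : int := `|B|.
have NB (z : int) : (z < - N -> ~ k z) /\ (N < z -> k z).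
  have [h1 h2] := HB z; rewrite /N; split=> zN; first by apply: h1; lia.
  by apply: h2; lia.
have : forall z : int, z < N - (`|B|.*2)%:Z -> ~ k z.
  by move=> z zN; apply: (NB z).1; rewrite /N in zN *; lia.
move: (_.*2) => m; have {}NB z : N < z -> k z by move/(NB z).2.
clearbody N; clear HB B.
elim: m k kM NB => [|m IH] k kM NB km.
  have [kN|kN] := pselect (k N).
    suff -> : k = [set z | N - 1 < z] by rewrite (BZ_norm MB).
    rewrite predeqE => z /=; split=> [kz|zN].
      have : ~ z < N - 0%:Z by move=> /km.
      by clear; lia.
    have [->//|/eqP zN'] := eqVneq z N; apply: NB; lia.
  suff -> : k = [set z | N < z] by rewrite (BZ_norm MB).
  rewrite predeqE => z /=; split=> [kz|]; last exact: NB.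
  have zN : z <> N by move=> e; apply: kN; rewrite -e.
  have : ~ z < N - 0%:Z by move=> /km.
  by clear -zN; lia.
pose j := N - m.+1%:Z; have [kj|kj] := pselect (k j); last first.
  apply: IH => // z zm; have [->//|/eqP zj] := eqVneq z j.
  by apply: km; rewrite /j in zj; lia.
have h := BZ_superset MB kM (MZc_gt j).
have k'M : MZc (rm k j) by rewrite (F_rm MZc_ad).
have k'0 : M (rm k j) <= 0.
  apply: IH => // [z Nz|z zm].
    by split; [apply: NB|rewrite /j; lia].
  by case=> kz zj; apply: (km z) kz; rewrite /j in zj; lia.
have EU : k `|` [set z | j < z] = [set z | j - 1 < z].
  rewrite predeqE => z; rewrite /setU /=; split.
    case=> [kz|]; last by lia.
    have : ~ z < j by move/km.
    by clear; lia.
  by move=> zj; have [->|/eqP zj'] := eqVneq z j; [left|right; lia].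
have EI : k `&` [set z | j < z] = rm k j.
  rewrite predeqE => z; rewrite /setI /rm /=; split=> -[kz zj]; split=> //.
    by lia.
  have : ~ z < j by move=> h'; apply: km h' kz.
  by clear -zj; lia.
by move: h; rewrite EU EI !(BZ_norm MB); move: k'0; clear; lia.
Qed.

(** * Relations for the limit collection *)

Section ThetaBZ.
Variable M : collection.
Hypothesis MZ' : BZZ M.

Lemma Theta_cut k : MZ k -> exists B : nat, forall C : nat, (B <= C)%N ->
  M (cut (- C%:Z) C%:Z k) = Theta M k.
Proof.
move=> kM; have [B HB] := Theta_stable MZ' kM.
by exists `|B|%N => C BC; apply: HB; lia.
Qed.

Lemma Theta_supermodular : supermodular MZ (Theta M).
Proof.
move=> k i j ij ki kj; rewrite !MZ_ad => kM.
have [B1 H1] := @Theta_cut (ad k i) ltac:(by rewrite MZ_ad).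
have [B2 H2] := @Theta_cut (ad k j) ltac:(by rewrite MZ_ad).
have [B3 H3] := @Theta_cut (ad (ad k i) j) ltac:(by rewrite !MZ_ad).
have [B4 H4] := Theta_cut kM.
pose C := (B1 + B2 + B3 + B4 + `|i| + `|j|).+1.
rewrite -(H1 C) -?(H2 C) -?(H3 C) -?(H4 C); try by rewrite /C; lia.
have i1 : - C%:Z < i by rewrite /C; lia.
have i2 : i <= C%:Z by rewrite /C; lia.
have j1 : - C%:Z < j by rewrite /C; lia.
have j2 : j <= C%:Z by rewrite /C; lia.
rewrite !cut_ad //; apply: (BZ_super ((BZZP M).1 MZ').1) => //.
- by rewrite cutP.
- by rewrite cutP.
by rewrite !MZc_ad; apply: cut_MZc.
Qed.

Lemma Theta_plucker : tropical_plucker MZ (Theta M).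
Proof.
move=> k i j h ij jh ki kj kh; rewrite !MZ_ad => kM.
have [B1 H1] := @Theta_cut (ad k i) ltac:(by rewrite MZ_ad).
have [B2 H2] := @Theta_cut (ad k j) ltac:(by rewrite MZ_ad).
have [B3 H3] := @Theta_cut (ad k h) ltac:(by rewrite MZ_ad).
have [B4 H4] := @Theta_cut (ad (ad k i) h) ltac:(by rewrite !MZ_ad).
have [B5 H5] := @Theta_cut (ad (ad k i) j) ltac:(by rewrite !MZ_ad).
have [B6 H6] := @Theta_cut (ad (ad k j) h) ltac:(by rewrite !MZ_ad).
pose C := (B1 + B2 + B3 + B4 + B5 + B6 + `|i| + `|j| + `|h|).+1.
rewrite -(H1 C) -?(H2 C) -?(H3 C) -?(H4 C) -?(H5 C) -?(H6 C);
  try by rewrite /C; lia.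
have [i1 i2] : - C%:Z < i /\ i <= C%:Z by rewrite /C; lia.
have [j1 j2] : - C%:Z < j /\ j <= C%:Z by rewrite /C; lia.
have [h1 h2] : - C%:Z < h /\ h <= C%:Z by rewrite /C; lia.
rewrite !cut_ad //; apply: (BZ_plucker ((BZZP M).1 MZ').1) => //.
- by rewrite cutP.
- by rewrite cutP.
- by rewrite cutP.
by rewrite !MZc_ad; apply: cut_MZc.
Qed.

Lemma kLambda_succ a : ad (kLambda a) (a + 1) = kLambda (a + 1).
Proof. by rewrite predeqE => z; rewrite /ad /kLambda /=; lia. Qed.

Lemma eps_ge0 p : 0 <= eps p M.
Proof.
have pq : p <> nxt p by rewrite /nxt; lia.
have := Theta_supermodular pq (@kLambda_pred_p p) (@kLambda_pred_q p).
rewrite !MZ_ad -kLambda_nxt -kLambda_ad -ksLambda_ad => /(_ (MZ_kLambda _)).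
rewrite /eps; move: (Theta M (kLambda p)) (Theta M (ksLambda p)).
move: (Theta M (kLambda (p + 1))) (Theta M (kLambda (p - 1))) => *; lia.
Qed.

Lemma Theta_le0 k : MZ k -> Theta M k <= 0.
Proof.
move=> kM; have [B HB] := Theta_cut kM; rewrite -(HB B) //.
exact: BZ_le0 ((BZZP M).1 MZ').1 (cut_MZc _ _ _).
Qed.

Hypothesis eps0 : forall p, eps p M = 0.

Let th (a : int) : int := Theta M (kLambda a).

(** For m = 1 this is [eps (a + 1) M] = 0. Beyond, with b = a + m + 1, the Pluecker relation for a +
    1 < b - 1 < b gives the lower bound, and supermodularity for a + 1 and b the upper one. *)
Lemma Theta_one_gap (a : int) (m : nat) :
  Theta M (ad (kLambda a) (a + m%:Z + 1)) =
  th a + th (a + m%:Z + 1) - th (a + m%:Z).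
Proof.
elim/ltn_ind: m a => -[|[|m]] IH a.
- by rewrite addr0 kLambda_succ /th; clear; lia.
- have E : ad (kLambda a) (a + 1 + 1) = ksLambda (a + 1).
    by rewrite ksLambda_ad addrK.
  rewrite E; have := eps0 (a + 1); rewrite /eps addrK /th.
  move: (Theta M (kLambda (a + 1))) (Theta M (ksLambda (a + 1))).
  by move: (Theta M (kLambda (a + 1 + 1))) (Theta M (kLambda a)); clear; lia.
pose b := a + m.+2%:Z + 1.
have IH1 := IH m.+1 (ltnSn _) (a + 1).
have IH2 := IH m (ltnW (ltnSn _)) (a + 1).
have IH3 := IH m.+1 (ltnSn _) a.
have E1 : a + 1 + m.+1%:Z + 1 = b by rewrite /b; lia.
have E2 : a + 1 + m.+1%:Z = b - 1 by rewrite /b; lia.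
have E3 : a + 1 + m%:Z + 1 = b - 1 by rewrite /b; lia.
have E4 : a + 1 + m%:Z = b - 1 - 1 by rewrite /b; lia.
have E5 : a + m.+1%:Z + 1 = b - 1 by rewrite /b; lia.
have E6 : a + m.+1%:Z = b - 1 - 1 by rewrite /b; lia.
have E7 : a + m.+2%:Z = b - 1 by rewrite /b; lia.
rewrite E1 E2 in IH1; rewrite E3 E4 in IH2; rewrite E5 E6 in IH3.
rewrite -/b E7; have ab : a + 1 < b - 1 by rewrite /b; lia.
have bb : b - 1 < b by lia.
have n1 : ~ kLambda a (a + 1) by rewrite /kLambda /=; lia.
have n2 : ~ kLambda a (b - 1) by rewrite /kLambda /=; lia.
have n3 : ~ kLambda a b by rewrite /kLambda /=; lia.
have n4 : a + 1 <> b by lia.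
have := Theta_supermodular n4 n1 n3; rewrite !MZ_ad => /(_ (MZ_kLambda _)).
have := Theta_plucker ab bb n1 n2 n3; rewrite !MZ_ad => /(_ (MZ_kLambda _)).
rewrite !kLambda_succ IH1 IH2 IH3 -!/(th _).
move: (Theta M _) (Theta M _) => x y; clear; lia.
Qed.

(** The block is extended one point b at a time: supermodularity against Z_(<= a) + b adds th b - th
    (b - 1), and the sum telescopes. *)
Lemma Theta_gap_ge (a : int) (m n : nat) :
  th a + th (a + m%:Z + n%:Z) - th (a + m%:Z) <=
  Theta M (kLambda a `|` [set z | a + m%:Z < z /\ z <= a + m%:Z + n%:Z]).
Proof.
have MZI n' : MZ (kLambda a `|` [set z | a + m%:Z < z /\ z <= a + m%:Z +
  n'%:Z]).
  apply/MZP; exists (`|a| + m%:Z + n'%:Z) => z.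
  by rewrite /kLambda /setU /=; lia.
elim: n => [|n IH].
  have -> : kLambda a `|` [set z | a + m%:Z < z /\ z <= a + m%:Z + 0%:Z] =
    kLambda a.
    by rewrite predeqE => z; rewrite /kLambda /setU /=; lia.
  by rewrite -/(th a) addr0; clear; lia.
pose b := a + m%:Z + n.+1%:Z; pose S := ad (kLambda a) b.
pose T := kLambda a `|` [set z | a + m%:Z < z /\ z <= a + m%:Z + n%:Z].
have SM : MZ S by rewrite /S MZ_ad; apply: MZ_kLambda.
have EI : S `&` T = kLambda a.
  by rewrite predeqE => z; rewrite /S /T /b /ad /kLambda /setU /setI /=; lia.
have EU : S `|` T = kLambda a `|` [set z | a + m%:Z < z /\ z <= b].
  by rewrite predeqE => z; rewrite /S /T /b /ad /kLambda /setU /=; lia.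
have := supermodular_set MZ_ad Theta_supermodular (S := S) (T := T).
rewrite EI EU => /(_ (MZ_kLambda a) (finite_setD_MZ SM (MZI n))
  (finite_setD_MZ (MZI n) SM)).
have := Theta_one_gap a (m + n).
have -> : a + (m + n)%N%:Z + 1 = b by rewrite /b; lia.
have -> : a + (m + n)%N%:Z = a + m%:Z + n%:Z by lia.
rewrite -/S -/(th a) => ->; move: IH; rewrite -/T -/b.
by move: (Theta M T) (Theta M _) (th _) (th _) (th _) (th _) => *; lia.
Qed.

End ThetaBZ.

Lemma Theta_period_mul l M r (u : nat) : BZZ M -> sigma l M = M ->
  Theta M (kLambda (r + (l * u)%N%:Z)) = Theta M (kLambda r).
Proof.
move=> MZ' sM; elim: u => [|u IH]; first by rewrite muln0 addr0.
rewrite -IH -(Theta_period (r + (l * u.+1)%N%:Z) MZ' sM).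
by congr (Theta M (kLambda _)); lia.
Qed.

Lemma cut_period_mul l M r (n m : int) (u : nat) : sigma l M = M ->
  M (cut n m (kLambda (r + (l * u)%N%:Z))) =
  M (cut (n - (l * u)%N%:Z) (m - (l * u)%N%:Z) (kLambda r)).
Proof.
move=> sM; elim: u n m => [|u IH] n m; first by rewrite muln0 addr0 !subr0.
rewrite -{1}sM /sigma sigma_cut sigma_kLambda.
have -> : r + (l * u.+1)%N%:Z - l%:Z = r + (l * u)%N%:Z by lia.
by rewrite IH; congr (M (cut _ _ _)); lia.
Qed.

Section HighestWeight.
Variables (l : nat) (M : collection).
Hypothesis l0 : (0 < l)%N.
Hypotheses (MZ' : BZZ M) (sM : sigma l M = M).
Hypothesis eps0 : forall p, eps p M = 0.

Let MB : BZdata M := ((BZZP M).1 MZ').1.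

Lemma Theta_kLambda_eq0 a : Theta M (kLambda a) = 0.
Proof.
apply/eqP; rewrite eq_le Theta_le0 //=; last exact: MZ_kLambda.
have [B HB] := Theta_stable MZ' (MZ_kLambda a).
(* The size of w puts the block between b and c above N, while a <= N. The size of v ensures that
   the window of [cut b C (kLambda c)], translated back by c - a, starts at or below - B. *)
pose N := (`|B| + `|a|)%N; pose w := (N + `|a|).+1; pose v := (`|B| + `|a|)%N.
pose b := a + (l * w)%N%:Z; pose c := b + (l * v)%N%:Z.
have lw : (w <= l * w)%N by rewrite leq_pmull.
have lv : (v <= l * v)%N by rewrite leq_pmull.
pose U := kLambda a `|` [set z | b < z /\ z <= c].
have UM : MZ U.
  by apply/MZP; exists (`|a| + `|c|) => z; rewrite /U /kLambda /setU /=; lia.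
have [B3 HB3] := Theta_cut MZ' UM.
pose C := (B3 + `|B| + `|c| + N + l * w + l * v)%N.
have bN : N%:Z < b by rewrite /b /w in lw *; lia.
have bc : b <= c by rewrite /c; lia.
have aN : a <= N%:Z by rewrite /N; lia.
have cC : c <= C%:Z by rewrite /C; lia.
have aC : - C%:Z <= a by rewrite /C /N; lia.
have thc : Theta M (kLambda c) = Theta M (kLambda a).
  by rewrite /c /b !Theta_period_mul.
have thb : Theta M (kLambda b) = Theta M (kLambda a).
  by rewrite /b Theta_period_mul.
have h1 : Theta M (kLambda a) <= Theta M U.
  have := Theta_gap_ge MZ' eps0 a (l * w) (l * v).
  by rewrite -/b -/c thc thb addrK.
have HU : M (cut (- C%:Z) C%:Z U) = Theta M U by apply: HB3; rewrite /C; lia.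
(* Union and intersection with the half-line above N separate the two parts of U. Both resulting
   components equal [Theta M (kLambda a)], the second one by translation. *)
have := BZ_superset MB (cut_MZc (- C%:Z) C%:Z U) (MZc_gt N%:Z).
have -> : cut (- C%:Z) C%:Z U `|` [set z | N%:Z < z] =
    cut (- C%:Z) N%:Z (kLambda a).
  rewrite predeqE => z; rewrite /cut /U /kLambda /setU /=.
  by clear -bN bc aN cC aC; clearbody b c N C; lia.
have -> : cut (- C%:Z) C%:Z U `&` [set z | N%:Z < z] = cut b C%:Z (kLambda c).
  rewrite predeqE => z; rewrite /cut /U /kLambda /setU /setI /=.
  by clear -bN bc aN cC aC; clearbody b c N C; lia.
rewrite (BZ_norm MB) HU HB; try by rewrite /C /N; lia.
have cE : c = a + (l * (w + v))%N%:Z by rewrite /c /b mulnDr; lia.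
rewrite cE cut_period_mul // HB.
- by move: h1; move: (Theta M U) (Theta M _) => x y; clear; lia.
- by rewrite /b mulnDr; rewrite /v in lv *; lia.
by rewrite mulnDr /C; lia.
Qed.

(** Two uses of supermodularity with half-lines: first the cut of Z_(<= a) with upper end N is
    nonnegative, since the one with a distant upper end vanishes; then everything below a is filled
    in by the union. *)
Lemma BZ_singleton_ge0 (a N : int) : a <= N -> 0 <= M (ad [set z | N < z] a).
Proof.
move=> aN; have [B HB] := Theta_stable MZ' (MZ_kLambda a).
rewrite Theta_kLambda_eq0 in HB.
pose n : int := - `|B| - `|a| - 1; pose N' : int := `|B| + `|N|.
have na : n < a by rewrite /n; lia.
have NN : N <= N' by rewrite /N'; lia.
have h0 : M (cut n N' (kLambda a)) = 0 by apply: HB; rewrite /n /N'; lia.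
have h1 := BZ_superset MB (cut_MZc n N' (kLambda a)) (MZc_gt N).
have h2 := BZ_superset MB (cut_MZc n N (kLambda a)) (MZc_gt (a - 1)).
move: h1 h2; rewrite !(BZ_norm MB) h0.
have -> : cut n N' (kLambda a) `|` [set z | N < z] = cut n N (kLambda a).
  rewrite predeqE => z; rewrite /cut /kLambda /setU /=.
  by clear -na NN aN; clearbody n N'; lia.
have -> : cut n N' (kLambda a) `&` [set z | N < z] = [set z | N' < z].
  rewrite predeqE => z; rewrite /cut /kLambda /setI /=.
  by clear -na NN aN; clearbody n N'; lia.
have -> : cut n N (kLambda a) `|` [set z | a - 1 < z] = [set z | n < z].
  rewrite predeqE => z; rewrite /cut /kLambda /setU /=.
  by clear -na NN aN; clearbody n N'; lia.
have -> : cut n N (kLambda a) `&` [set z | a - 1 < z] = ad [set z | N < z] a.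
  rewrite predeqE => z; rewrite /cut /kLambda /setI /ad /=.
  by clear -na NN aN; clearbody n N'; lia.
rewrite !(BZ_norm MB); move: (M _) (M _) => x y; clear; lia.
Qed.

Lemma BZZ_highest_weight : M = zero_collection.
Proof.
rewrite funeqE => k; rewrite /zero_collection.
have [kM|kM] := pselect (MZc k); last exact: BZ_indexed MB _ kM.
apply/eqP; rewrite eq_le BZ_le0 //=.
have [B HB] := (MZcP k).1 kM; pose C : set int := [set z | B < z].
have CM : MZc C by apply: MZc_gt.
have Ck : C `<=` k by move=> z /= /(HB z).2.
have [u [uu -> mu]] := finite_ad Ck (finite_setD_MZc kM CM).
have {}mu j : j \in u -> j <= B.
  by move=> /mu[_]; rewrite /C /= => nC; rewrite leNgt; apply/negP.
elim: u uu mu => [|i u IH] /=; first by rewrite (BZ_norm MB).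
move=> /andP[iu uu] mu.
have Ci j : j \in i :: u -> ~ C j by move=> /mu; rewrite /C /=; lia.
(* Based at a half-line, where M vanishes, the component at k is at least the sum of those obtained
   by adjoining single elements. *)
have h1 := supermodular_ad MZc_ad (BZ_super MB) CM (Ci i (mem_head _ _)) iu uu
  (fun j ju => Ci j (mem_behead (s := i :: u) ju)).
have h2 := BZ_singleton_ge0 (mu i (mem_head _ _)).
have h3 : 0 <= M (foldl ad C u).
  by apply: IH => // j ju; apply: mu; rewrite inE ju orbT.
rewrite (BZ_norm MB) addr0 in h1.
by apply: le_trans h1; apply: addr_ge0.
Qed.

End HighestWeight.

(** * Connectedness and the star involution *)

Section Main.
Variable l : nat.
Hypothesis l3 : (3 <= l)%N.

(** The residue class is invariant under translation by l, so [sigma l N] has the properties that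
    determine N. *)
Lemma raises_sigma (p : nat) M N : BZZ M -> sigma l M = M ->
  raises (residue_class l p) M N -> sigma l N = N.
Proof.
move=> MZ' sM R; have NZ := raises_BZZ R.
have shift r : residue_class l p (r - l%:Z) <-> residue_class l p r.
  split=> -[z e]; first by exists (z + 1); lia.
  by exists (z - 1); lia.
rewrite funeqE => k.
apply: (@BZZ_agree (residue_class l p) (residue_class l p)) => //.
- exact: residue_separated.
- exact: BZZ_sigma_closed.
- move=> r Qr; rewrite Theta_sigma ?sigma_kLambda //; last exact: MZ_kLambda.
  rewrite (raises_Theta R Qr) (raises_Theta R) ?Theta_period //.
  exact/shift.
move=> k' kQ; rewrite (raises_agree R) // -[in RHS]sM /sigma.
apply: (raises_agree R) => r Qr; rewrite sigma_drops; apply: kQ.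
by apply/shift; rewrite addrK.
Qed.

Definition height (M : collection) : int :=
  \sum_(p < l) - Theta M (kLambda (p : nat)%:Z).

Lemma height_ge0 M : BZZ M -> 0 <= height M.
Proof.
move=> MZ'; apply: sumr_ge0 => p _; rewrite oppr_ge0.
exact: Theta_le0 (MZ_kLambda _).
Qed.

Lemma height_raises (p : 'I_l) M N : BZZ M ->
  raises (residue_class l p) M N -> height N = height M - 1.
Proof.
move=> MZ' R; rewrite /height (bigD1 p) //= [in RHS](bigD1 p) //=.
have Qp : residue_class l p (p : nat)%:Z by exists 0; lia.
rewrite (raises_Theta R Qp) (eq_bigr (fun q : 'I_l =>
  - Theta M (kLambda (q : nat)%:Z))).
  by move: (Theta M _) (\sum_(i < l | _) _) => x y; clear; lia.
move=> q qp; congr (- _).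
apply: (Theta_no_drop MZ' (raises_BZZ R) (MZ_kLambda _) (raises_agree R)).
move=> r [z rz] h; have := drops_kLambda h; rewrite rz => e.
have pl := ltn_ord p; have ql := ltn_ord q.
have /eqP qp' : nat_of_ord q != nat_of_ord p by [].
have z0 : z = 0 by nia.
by apply: qp'; rewrite z0 in e; lia.
Qed.

Lemma connected_to_zero M : BZZ_sigma l M ->
  clos_refl_sym_trans collection (crystal_edge (crystal_BZZ_sigma l))
    zero_collection M.
Proof.
have [n] := ubnP (absz (height M)); elim: n M => // n IH M hM [MZ' sM].
have l0 : (0 < l)%N by lia.
have [[p ep]|ne] := pselect (exists p : 'I_l, 0 < eps_hat p M); last first.
  have eps0 r : eps r M = 0.
    have l0' : l%:Z != 0 by lia.
    have r1 := modz_ge0 r l0'; have r2 := ltz_pmod r (_ : 0 < l%:Z).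
    have rl : (absz (r %% l%:Z)%Z < l)%N by have := r2 ltac:(lia); lia.
    have Qr : residue_class l (Ordinal rl) r.
      by exists (r %/ l%:Z)%Z; rewrite {1}(divz_eq r l%:Z) /=; lia.
    rewrite (eps_residue MZ' sM Qr); apply/eqP; rewrite eq_le eps_ge0 // andbT.
    by rewrite leNgt; apply/negP => h; apply: ne; exists (Ordinal rl).
  by rewrite (BZZ_highest_weight l0 MZ' sM eps0); apply: rst_refl.
have [N [R fN]] := f_hat_raises l3 MZ' sM ep.
have NZ := raises_BZZ R; have sN := raises_sigma MZ' sM R.
have hN := height_raises MZ' R.
apply: rst_trans (IH N _ (conj NZ sN)) _.
  by have := height_ge0 NZ; rewrite hN; move: hM; clear; lia.
by apply: rst_step; split; [split|split|exists p].
Qed.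

End Main.

(** * Complementation exchanges the two kinds of data *)

Lemma setC_embedc I k : k `<=` pts_tilde I ->
  ~` embedc I k = embed I (pts_tilde I `\` k).
Proof.
move=> kI; rewrite predeqE => z.
rewrite /embedc /embed /setC /setU /setD /= pts_tildeE.
have [kz|/propF ->] := pselect (k z); last by clear; lia.
by have /pts_tildeE := kI z kz; rewrite (propT kz); clear; lia.
Qed.

Lemma setDDI (k A : set int) : k `<=` A -> A `\` (A `\` k) = k.
Proof.
move=> kA; rewrite predeqE => z; rewrite /setD /=; split.
  by case=> Az h; apply: contrapT => nk; apply: h.
by move=> kz; split; [apply: kA|case].
Qed.

Lemma Mx_setD I k : Mx I k -> Mx I (pts_tilde I `\` k).
Proof.
move=> [kI k0 k1]; split; first by move=> z [].
  by move=> e; apply: k1; rewrite -(setDDI kI) e setD0.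
move=> e; apply: k0; rewrite -(setDDI kI) e; exact: setDv.
Qed.

Lemma restrc_star I M k : k `<=` pts_tilde I ->
  restrc I (star M) k = restr I M (pts_tilde I `\` k).
Proof.
move=> kI; rewrite /restrc /restr /patch; case: ifPn => [|/negP].
  by rewrite inE => kM; rewrite ifT ?inE;
    [rewrite /star setC_embedc|apply: Mx_setD].
rewrite inE => nk; rewrite ifF //; apply/negP; rewrite inE => /Mx_setD.
by rewrite setDDI.
Qed.

(** Both relations are self-dual: if c is the complement of k and of the two or three indices,
    complementation in tilde I turns each two-term sum for k into the same sum for c, with its terms
    interchanged. *)
Lemma BZ_datum_compl I X Y :
  (forall k, k `<=` pts_tilde I -> Y k = X (pts_tilde I `\` k)) ->
  indexed_by (Mx I) Y -> BZ_datum I X -> BZ_datum I Y.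
Proof.
move=> XY YI [_ X1 X2]; split=> //.
- move=> i j k iI jI ij kI kij.
  have ki : ~ k i by apply: setI_set1 kij _; left.
  have kj : ~ k j by apply: setI_set1 kij _; right.
  pose c := pts_tilde I `\` (k `|` [set i; j]).
  have cI : c `<=` pts_tilde I by move=> z [].
  have cij : c `&` [set i; j] = set0.
    by rewrite predeqE => z; split=> // -[[_ h] zij]; apply: h; right.
  have := X1 i j c iI jI ij cI cij.
  rewrite !XY //; try by move=> z; rewrite /setU /=; intuition (subst; auto).
  have -> : pts_tilde I `\` (k `|` [set i]) = c `|` [set j].
    rewrite predeqE => z; rewrite /c /setU /setD /=.
    have [->|/eqP zi] := eqVneq z i; first by intuition.
    have [->|/eqP zj] := eqVneq z j; intuition.
  have -> : pts_tilde I `\` (k `|` [set j]) = c `|` [set i].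
    rewrite predeqE => z; rewrite /c /setU /setD /=.
    have [->|/eqP zi] := eqVneq z i; first by intuition.
    have [->|/eqP zj] := eqVneq z j; intuition.
  have -> : pts_tilde I `\` k = c `|` [set i; j].
    rewrite predeqE => z; rewrite /c /setU /setD /=.
    have [->|/eqP zi] := eqVneq z i; first by intuition.
    have [->|/eqP zj] := eqVneq z j; intuition.
  rewrite -/c; move: (X _) (X _) (X _) (X _) => a b u v; clear; lia.
move=> i j h k iI jI hI ij jh kI kij.
have ki : ~ k i by apply: setI_set1 kij _; left; left.
have kj : ~ k j by apply: setI_set1 kij _; left; right.
have kh : ~ k h by apply: setI_set1 kij _; right.
have nij : i <> j by lia.
have nih : i <> h by lia.
have njh : j <> h by lia.
pose c := pts_tilde I `\` (k `|` [set i; j; h]).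
have cI : c `<=` pts_tilde I by move=> z [].
have cij : c `&` [set i; j; h] = set0.
  by rewrite predeqE => z; split=> // -[[_ h'] zij]; apply: h'; right.
have := X2 i j h c iI jI hI ij jh cI cij.
rewrite !XY //; try by move=> z; rewrite /setU /=; intuition (subst; auto).
have E A B : (forall z, z <> i -> z <> j -> z <> h -> ~ A z /\ ~ B z) ->
    (A i <-> ~ B i) -> (A j <-> ~ B j) -> (A h <-> ~ B h) ->
    pts_tilde I `\` (k `|` A) = c `|` B.
  move=> n1 n2 n3 n4; rewrite predeqE => z; rewrite /c /setU /setD /=.
  have {}ki : z = i -> ~ k z by move=> ->.
  have {}kj : z = j -> ~ k z by move=> ->.
  have {}kh : z = h -> ~ k z by move=> ->.
  have {}iI : z = i -> pts_tilde I z by move=> ->.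
  have {}jI : z = j -> pts_tilde I z by move=> ->.
  have {}hI : z = h -> pts_tilde I z by move=> ->.
  have {}n2 : z = i -> A z <-> ~ B z by move=> ->.
  have {}n3 : z = j -> A z <-> ~ B z by move=> ->.
  have {}n4 : z = h -> A z <-> ~ B z by move=> ->.
  have {}n1 := n1 z; clear -n1 n2 n3 n4 ki kj kh iI jI hI.
  have [zi|zi] := pselect (z = i); have [zj|zj] := pselect (z = j);
    have [zh|zh] := pselect (z = h); have [Bz|Bz] := pselect (B z); tauto.
rewrite (E [set i; h] [set j]) ?(E [set j] [set i; h]) ?(E [set i; j] [set h])
  ?(E [set h] [set i; j]) ?(E [set j; h] [set i]) ?(E [set i] [set j; h]);
  try by rewrite /setU /=; intuition.
move: (X _) (X _) (X _) (X _) (X _) (X _) => a b u v x y; clear; lia.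
Qed.

Lemma restrc_indexed I M : indexed_by (Mx I) (restrc I M).
Proof.
by move=> k nk; rewrite /restrc /patch ifF //; apply/negP; rewrite inE.
Qed.

Lemma restr_indexed I M : indexed_by (Mx I) (restr I M).
Proof.
by move=> k nk; rewrite /restr /patch ifF //; apply/negP; rewrite inE.
Qed.

Lemma BZ_restrc_star I M :
  BZ I (restrc I (star M)) <-> BZe I (restr I M).
Proof.
have low i : pts I i -> `[I.1 + 1, i]%classic `<=` pts_tilde I.
  move=> /ptsE iI z /=; rewrite in_itv /= => /andP[z1 z2].
  by apply/pts_tildeE; lia.
have E i : pts I i -> pts_tilde I `\` `[i + 1, I.1 + I.2%:Z + 1]%classic =
    `[I.1 + 1, i]%classic.
  move=> /ptsE iI; rewrite predeqE => z; rewrite /setD /= pts_tildeE !in_itv /=.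
  by split=> [[z1 /negP z2]|/andP[z1 z2]]; [|split; [|apply/negP]]; lia.
have high i : pts I i -> `[i + 1, I.1 + I.2%:Z + 1]%classic `<=` pts_tilde I.
  move=> /ptsE iI z /=; rewrite in_itv /= => /andP[z1 z2].
  by apply/pts_tildeE; lia.
split=> -[D nD]; split.
- apply: BZ_datum_compl D; last exact: restr_indexed.
  move=> k kI; rewrite restrc_star; last by move=> z [].
  by rewrite setDDI.
- move=> i iI; have := nD i iI; rewrite restrc_star ?E //; exact: high.
- apply: BZ_datum_compl D; last exact: restrc_indexed.
  exact: restrc_star.
by move=> i iI; rewrite restrc_star ?E ?nD //; exact: high.
Qed.

Lemma setC_Omegac J k : ~` Omegac J (~` k) = Omega J k.
Proof.
rewrite OmegacE predeqE => z; rewrite /Omega /embed /res /cut.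
rewrite /setC /setU /setD /setI /= pts_tildeE /hi.
by have [/propT ->|/propF ->] := pselect (k z); clear; lia.
Qed.

Lemma MZ_fin_star I k : MZ_fin I k <-> MZc_fin I (~` k).
Proof.
split=> -[kI kM E]; exists (pts_tilde I `\` kI); try exact: Mx_setD.
  rewrite -E -[LHS]setCK setC_embedc; last by move=> z [].
  by rewrite setDDI //; apply: Mx_sub.
by rewrite -setC_embedc ?E ?setCK //; apply: Mx_sub.
Qed.

Lemma Intc_star M k : Intc (star M) (~` k) = Int M k.
Proof.
rewrite predeqE => I; rewrite /Intc /Int /=; split=> -[I0 kI H]; split=> //.
- exact/MZ_fin_star.
- by move=> J J0 IJ; have := H J J0 IJ; rewrite /star !setC_Omegac.
- exact/MZ_fin_star.
by move=> J J0 IJ; rewrite /star !setC_Omegac; apply: H.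
Qed.

Lemma starK : involutive star.
Proof. by move=> M; rewrite funeqE => k; rewrite /star setCK. Qed.

Lemma BZZ_star M : BZZ (star M) <-> BZZe M.
Proof.
split=> -[MI MK MS]; split.
- by move=> k nk; rewrite -[M]starK; apply: MI => /MZ_setC; rewrite setCK.
- by move=> K K0; apply/BZ_restrc_star; apply: MK.
- by move=> k kM; rewrite -Intc_star; apply: MS; exists k.
- by move=> k nk; apply: MI => kM; apply: nk; apply/MZ_setC.
- by move=> K K0; apply/BZ_restrc_star; apply: MK.
move=> k /MZ_setC kM; rewrite -[k]setCK Intc_star; exact: MS.
Qed.

Lemma BZZ_sigma_star l M : BZZ_sigma l (star M) <-> BZZe_sigma l M.
Proof.
have sE : sigma l (star M) = star (sigma l M) by [].
split=> -[/BZZ_star MZ' sM]; split=> //; last by rewrite sE sM.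
by apply: (inv_inj starK); rewrite -sE.
Qed.

Lemma edge_star l M N : crystal_edge (crystal_BZZ_sigma l) M N ->
  crystal_edge (crystal_BZZe_sigma l) (star M) (star N).
Proof.
move=> [/= MZ' NZ [p fp]]; split=> /=.
- by apply/BZZ_sigma_star; rewrite starK.
- by apply/BZZ_sigma_star; rewrite starK.
by exists p; rewrite /f_hat_star starK fp.
Qed.

Lemma connected_star l M N :
  clos_refl_sym_trans collection (crystal_edge (crystal_BZZ_sigma l)) M N ->
  clos_refl_sym_trans collection (crystal_edge (crystal_BZZe_sigma l))
    (star M) (star N).
Proof.
elim=> {M N} [M N e|M|M N _|M N P _ MN _ NP].
- by apply: rst_step; apply: edge_star.
- exact: rst_refl.
- exact: rst_sym.
exact: rst_trans MN NP.
Qed.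

Theorem corollary5p2p3 (l : nat) (hl : (3 <= l)%N) :
  connected_component (crystal_BZZe_sigma l) zero_collection = BZZe_sigma l /\
  connected_component (crystal_BZZ_sigma l) zero_collection = BZZ_sigma l.
Proof.
split; rewrite predeqE => M; split=> [[]//|MZ']; split=> //.
  have sz : star zero_collection = zero_collection by [].
  rewrite -[M]starK -{1}sz; apply: connected_star.
  by apply: connected_to_zero => //; apply/BZZ_sigma_star.
exact: connected_to_zero.
Qed.
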